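(* Let $n_1,n_2\ge 1$, $n=n_1+n_2$. Let $D_1$ be a domain in $\mathbb{C}^{n_1}$ and let $D_2=\{z\in\mathbb{C}^{n_2}:\ \mathrm{Re}(z_{n_2})=0\}\cap B^{n_2}(0,\tfrac12)$. Put $K=\overline{D_1\times D_2}$. If $K$ is a compact subset of the unit ball $B^n$ and $D:=B^n\setminus K$ is connected, then for every $z\in D$, $$s_D(z)=\tilde e_D(z)=d_{c_{B^n}}^{K}(z).$$
   Context: $B^n$ is the open Euclidean unit ball in $\mathbb{C}^n$, $B^n(p,\delta)$ the open Euclidean ball with centre $p$ and radius $\delta$, $\mathbb{D}$ the unit disk in $\mathbb{C}$, and $O(X,Y)$ the set of holomorphic maps from $X$ into $Y$. Carathéodory pseudodistance on a domain $X$: $c_X(z,w)=\sup\{\tanh^{-1}|\lambda| : f\in O(X,\mathbb{D}),\ f(z)=0,\ f(w)=\lambda\}$, with balls $B^c_X(z,r)=\{w\in X: c_X(z,w)<r\}$. For a nonempty compact $S\subset B^n$ and $z\in B^n\setminus S$, $d_{c_{B^n}}^{S}(z)=\min_{w\in S}\tanh[c_{B^n}(z,w)]$. For a bounded domain $X\subset\mathbb{C}^n$ and $z\in X$: squeezing function $s_X(z)=\sup\{r>0:\ rB^n\subset f(X)$ for some injective $f\in O(X,B^n)$ with $f(z)=0\}$; Fridman invariant $\tilde e_X(z)=\sup\{\tanh(r):\ B^c_X(z,r)\subset f(B^n)$ for some injective $f\in O(B^n,X)\}$. *)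

(* Defs.v *)
From HB Require Import structures.
From mathcomp Require Import all_boot all_order all_algebra.
From mathcomp Require Import all_classical all_reals all_analysis.
From mathcomp Require Import complex.

Set Implicit Arguments.
Unset Strict Implicit.
Unset Printing Implicit Defensive.

Import Order.TTheory GRing.Theory Num.Theory.
Import numFieldNormedType.Exports.

Local Open Scope classical_set_scope.
Local Open Scope ring_scope.

(* R[i], presented as a numFieldType so that the topology and the normed-module
   structure that MathComp-Analysis puts on numFieldTypes are inferred. *)
Definition Cplx (R : realType) : numFieldType := R[i].

Definition cmod (R : realType) (x : Cplx R) : R := ComplexField.Normc.normc x.

Definition creal (R : realType) (x : Cplx R) : R := complex.Re x.

(* The library norm on row vectors is the sup norm; it induces the same
   topology and the same differentiability, but different balls. *)
Definition enorm (R : realType) (n : nat) (z : 'rV[Cplx R]_n) : R :=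
  Num.sqrt (\sum_(i < n) cmod (z 0 i) ^+ 2).

Definition eball (R : realType) (n : nat) (p : 'rV[Cplx R]_n) (r : R) :
    set 'rV[Cplx R]_n :=
  [set z | enorm (z - p) < r].

Definition unit_ball (R : realType) (n : nat) : set 'rV[Cplx R]_n := eball 0 1.
Arguments unit_ball : clear implicits.

Definition unit_disk (R : realType) : set (Cplx R) := [set x | cmod x < 1].
Arguments unit_disk : clear implicits.

Definition domain (T : topologicalType) (X : set T) : Prop :=
  [/\ open X, connected X & X !=set0].

(* O(X, Y), for X open.  Differentiability is over Cplx R, hence complex
   differentiability; values of f outside X are irrelevant. *)
Definition holo (R : realType) (V W : normedModType (Cplx R))
    (X : set V) (Y : set W) : set (V -> W) :=
  [set f | (forall z, X z -> differentiable f z) /\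
           (forall z, X z -> Y (f z))].

Definition tanh (R : realType) (x : R) : R :=
  (expR x - expR (- x)) / (expR x + expR (- x)).

(* Inverse of tanh on ]-1, 1[. *)
Definition artanh (R : realType) (x : R) : R :=
  ln ((1 + x) / (1 - x)) / 2.

(* Extended-real valued, so that the supremum is a genuine one for every X. *)
Definition caratheodory (R : realType) (n : nat) (X : set 'rV[Cplx R]_n)
    (z w : 'rV[Cplx R]_n) : \bar R :=
  ereal_sup [set (artanh (cmod (f w)))%:E |
              f in [set f | holo X (unit_disk R) f /\ f z = 0]].

Definition cara_ball (R : realType) (n : nat) (X : set 'rV[Cplx R]_n)
    (z : 'rV[Cplx R]_n) (r : R) : set 'rV[Cplx R]_n :=
  [set w | X w /\ (caratheodory X z w < r%:E)%E].

(* The least element of A (an arbitrary value if there is none). *)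
Definition minimum (R : realType) (A : set R) : R :=
  xget 0 [set m | A m /\ lbound A m].

(* [fine] does not lose information: the Caratheodory distance is finite on
   the ball. *)
Definition cara_dist (R : realType) (n : nat) (S : set 'rV[Cplx R]_n)
    (z : 'rV[Cplx R]_n) : R :=
  minimum [set tanh (fine (caratheodory (unit_ball R n) z w)) | w in S].

Definition squeezing (R : realType) (n : nat) (X : set 'rV[Cplx R]_n)
    (z : 'rV[Cplx R]_n) : R :=
  sup [set r : R | 0 < r /\
    exists f : 'rV[Cplx R]_n -> 'rV[Cplx R]_n,
      [/\ holo X (unit_ball R n) f, set_inj X f, f z = 0
        & eball 0 r `<=` f @` X]].

Definition fridman (R : realType) (n : nat) (X : set 'rV[Cplx R]_n)
    (z : 'rV[Cplx R]_n) : R :=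
  sup [set tanh r | r in [set r : R |
    exists f : 'rV[Cplx R]_n -> 'rV[Cplx R]_n,
      [/\ holo (unit_ball R n) X f, set_inj (unit_ball R n) f
        & cara_ball X z r `<=` f @` unit_ball R n]]].

Definition slice (R : realType) (m : nat) : set 'rV[Cplx R]_m.+1 :=
  [set z : 'rV[Cplx R]_m.+1 | creal (z 0 ord_max) = 0] `&` eball 0 2^-1.
Arguments slice : clear implicits.

Definition prod_set (R : realType) (n1 n2 : nat)
    (A : set 'rV[Cplx R]_n1) (B : set 'rV[Cplx R]_n2) :
    set 'rV[Cplx R]_(n1 + n2) :=
  [set z | A (lsubmx z) /\ B (rsubmx z)].

(* Main.v *)
(* Since K lies in the real hyperplane Re z_n = 0, bounded holomorphic functions on D extend
   to the ball without increasing their sup norm, so the Caratheodory distances of D and of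
   the ball agree on D and equal artanh |phi_z w|, phi_z being the automorphism of the ball
   exchanging z and 0.  Let m be the minimum of |phi_z| on K.  The map phi_z on D and the map
   x |-> phi_z (m x) on the ball show that both invariants are at least m.

   If some injective f on D with f z = 0 had an image containing a ball of radius r > m,
   then |f| <= |phi_z| (Schwarz) would send points of D tending to a nearest point of K to a
   compact part of that ball, contradicting the openness of f (Osgood).

   If some injective f from the ball to D had an image containing a Caratheodory ball of
   radius larger than artanh m, its inverse g would be defined on one side of a relatively
   open piece of K, and |g| would tend to 1 there.  By Schwarz-Pick g would become constant
   along the complex direction contained in the piece, and a Rado type uniqueness theorem
   would make g constant along that direction, contradicting injectivity. *)
Require Import Defs.
From mathcomp Require Import all_boot all_order all_algebra.
From mathcomp Require Import all_classical all_reals all_analysis.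
From mathcomp Require Import complex ring lra.
From HB Require Import structures.
Import Order.TTheory GRing.Theory Num.Theory.
Import numFieldNormedType.Exports.
Set Implicit Arguments.
Unset Strict Implicit.
Unset Printing Implicit Defensive.
Local Open Scope classical_set_scope.
Local Open Scope ring_scope.

(** * Norms and limits over the complex numbers *)

(** Contour integrals are replaced by averages over dyadic midpoints, for which Goursat's bisection
    yields the mean value property up to any prescribed error. Normal families are replaced by
    pointwise limits along one fixed ultrafilter, whose holomorphy comes from a Taylor bound uniform
    in the family.

    The recurrent obstacle is a function that is continuous, but known to be holomorphic only off
    its zeros. The maximum principle is therefore proved in that form. Applied to [s ^+ k * j] for
    all [k], it bounds [s] off the zeros of [j]; with [s t = (t - a)^-1] it shows that vanishing
    near the centre of a disc spreads to the whole disc. The same argument serves Osgood's theorem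
    and the final contradiction for the Fridman invariant.

    Two features of the shape of [K] carry the proof: it lies in a real hyperplane, and arbitrarily
    close to each of its points it contains a relatively open piece of that hyperplane. The factor
    [D1] supplies a coordinate axis [i0] parallel to the hyperplane as a complex line: discs along
    it carry the extension across [K], and a translation along it gives the contradiction with
    injectivity. *)

Section ComplexModulus.
Context {R : realType}.
Implicit Types x y : Cplx R.

Definition ofr (r : R) : Cplx R := r%:C%C.

Definition cI : Cplx R := 'i%C.

Definition cconj x : Cplx R := (x^*)%C.

Definition cimag x : R := complex.Im x.

Lemma ofrD : {morph ofr : a b / a + b >-> a + b}.
Proof. exact: rmorphD. Qed.
Lemma ofrB : {morph ofr : a b / a - b >-> a - b}.
Proof. exact: rmorphB. Qed.
Lemma ofrN : {morph ofr : a / - a >-> - a}.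
Proof. exact: rmorphN. Qed.
Lemma ofrM : {morph ofr : a b / a * b >-> a * b}.
Proof. exact: rmorphM. Qed.
Lemma ofrV : {morph ofr : a / a^-1 >-> a^-1}.
Proof. exact: fmorphV. Qed.
Lemma ofr0 : ofr 0 = 0. Proof. by []. Qed.
Lemma ofr1 : ofr 1 = 1. Proof. by []. Qed.
Lemma ofr_nat n : ofr n%:R = n%:R.
Proof. exact: rmorph_nat. Qed.

Lemma cE x : x = ofr (creal x) + cI * ofr (cimag x).
Proof. exact: complexE. Qed.

Lemma cIsqr : cI * cI = -1.
Proof. by rewrite -expr2; exact: sqr_i. Qed.

Lemma normE x : `|x| = ofr (cmod x).
Proof. by case: x. Qed.

Lemma creal_ofr r : creal (ofr r) = r. Proof. by []. Qed.

Lemma ofr_eq0 r : (ofr r == 0) = (r == 0).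
Proof. by apply/eqP/eqP => [[]|->]. Qed.

Lemma le_ofr a b : (ofr a <= ofr b) = (a <= b).
Proof. exact: lecR. Qed.

Lemma lt_ofr a b : (ofr a < ofr b) = (a < b).
Proof. exact: ltcR. Qed.

Lemma creal_ge0 x : 0 <= x -> x = ofr (creal x).
Proof. by case: x => a b; rewrite lecE /= => /andP[/eqP -> _]. Qed.

Lemma cmod_ge0 x : 0 <= cmod x.
Proof. by rewrite -le_ofr -normE; exact: normr_ge0. Qed.

Lemma cmod0 : cmod (0 : Cplx R) = 0.
Proof. exact: ComplexField.Normc.normc0. Qed.

Lemma cmod1 : cmod (1 : Cplx R) = 1.
Proof. exact: ComplexField.Normc.normc1. Qed.

Lemma cmod_eq0 x : (cmod x == 0) = (x == 0).
Proof.
apply/eqP/eqP => [|->]; [exact: ComplexField.Normc.eq0_normc | exact: cmod0].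
Qed.

Lemma cmod_gt0 x : (0 < cmod x) = (x != 0).
Proof. by rewrite lt_neqAle cmod_ge0 andbT eq_sym cmod_eq0. Qed.

Lemma cmodM x y : cmod (x * y) = cmod x * cmod y.
Proof. exact: ComplexField.Normc.normcM. Qed.

Lemma cmodV x : cmod x^-1 = (cmod x)^-1.
Proof. exact: ComplexField.Normc.normcV. Qed.

Lemma cmodN x : cmod (- x) = cmod x.
Proof. by case: x => a b; rewrite /cmod /= !sqrrN. Qed.

Lemma cmodB x y : cmod (x - y) = cmod (y - x).
Proof. by rewrite -cmodN opprB. Qed.

Lemma cmodX x n : cmod (x ^+ n) = cmod x ^+ n.
Proof. by elim: n => [|n IH]; rewrite ?cmod1 // !exprS cmodM IH. Qed.

Lemma cmodD x y : cmod (x + y) <= cmod x + cmod y.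
Proof. by rewrite -le_ofr ofrD -!normE ler_normD. Qed.

Lemma cmod_ofr r : cmod (ofr r) = `|r|.
Proof. by rewrite /cmod /= expr0n /= addr0 sqrtr_sqr. Qed.

Lemma cmod_sqr x : cmod x ^+ 2 = creal x ^+ 2 + cimag x ^+ 2.
Proof. by case: x => a b; rewrite /cmod /= sqr_sqrtr // addr_ge0 // sqr_ge0. Qed.

Lemma cmod_I : cmod cI = 1.
Proof. by rewrite /cmod /= expr0n /= add0r expr1n sqrtr1. Qed.

Lemma creal_le x : `|creal x| <= cmod x.
Proof. by rewrite -(ler_sqr _ (cmod_ge0 x)) // ?nnegrE // real_normK ?num_real // cmod_sqr lerDl sqr_ge0. Qed.

Lemma cimag_le x : `|cimag x| <= cmod x.
Proof. by rewrite -(ler_sqr _ (cmod_ge0 x)) // ?nnegrE // real_normK ?num_real // cmod_sqr lerDr sqr_ge0. Qed.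

Lemma crealD x y : creal (x + y) = creal x + creal y.
Proof. by case: x; case: y. Qed.
Lemma crealN x : creal (- x) = - creal x.
Proof. by case: x. Qed.
Lemma crealB x y : creal (x - y) = creal x - creal y.
Proof. by rewrite crealD crealN. Qed.
Lemma cimagD x y : cimag (x + y) = cimag x + cimag y.
Proof. by case: x; case: y. Qed.
Lemma cimagN x : cimag (- x) = - cimag x.
Proof. by case: x. Qed.
Lemma crealM x y : creal (x * y) = creal x * creal y - cimag x * cimag y.
Proof. by case: x; case: y. Qed.
Lemma cimagM x y : cimag (x * y) = creal x * cimag y + cimag x * creal y.
Proof. by case: x; case: y. Qed.
Lemma creal_conj x : creal (cconj x) = creal x. Proof. by case: x. Qed.
Lemma cimag_conj x : cimag (cconj x) = - cimag x. Proof. by case: x. Qed.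
Lemma cimag_ofr r : cimag (ofr r) = 0. Proof. by []. Qed.
Lemma creal_I : creal cI = 0. Proof. by []. Qed.
Lemma cimag_I : cimag cI = 1. Proof. by []. Qed.

Lemma eq_cplx x y : creal x = creal y -> cimag x = cimag y -> x = y.
Proof. by case: x => a b; case: y => c d /= -> ->. Qed.

Lemma cconjD : {morph cconj : x y / x + y >-> x + y}.
Proof. exact: rmorphD. Qed.
Lemma cconjM : {morph cconj : x y / x * y >-> x * y}.
Proof. exact: rmorphM. Qed.
Lemma cconjK : involutive cconj.
Proof. exact: conjcK. Qed.
Lemma cconj_ofr r : cconj (ofr r) = ofr r.
Proof. exact: conjc_real. Qed.
Lemma cmod_conj x : cmod (cconj x) = cmod x.
Proof. by case: x => a b; rewrite /cmod /= sqrrN. Qed.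
Lemma mulcconj x : x * cconj x = ofr (cmod x ^+ 2).
Proof.
apply: eq_cplx; rewrite ?crealM ?cimagM creal_conj cimag_conj ?creal_ofr ?cimag_ofr.
  by rewrite cmod_sqr; ring.
by ring.
Qed.

End ComplexModulus.

(** * Real-valued norms on complex normed modules *)

Section RealNorm.
Context {R : realType}.
Local Notation C := (Cplx R).

(** Norms over [Cplx R] are themselves complex numbers; passing to the real part loses nothing and
    makes real order reasoning available. On row vectors this is still the sup norm. *)
Definition rnorm (V : normedModType C) (x : V) : R := creal `|x|.

Section Module.
Context {V : normedModType C}.
Implicit Types x y : V.

Lemma rnormE x : `|x| = ofr (rnorm x).
Proof. exact: creal_ge0. Qed.

Lemma rnorm_ge0 x : 0 <= rnorm x.
Proof. by rewrite -le_ofr -rnormE; exact: normr_ge0. Qed.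

Lemma rnorm0 : rnorm (0 : V) = 0.
Proof. by rewrite /rnorm normr0. Qed.

Lemma rnorm_eq0 x : (rnorm x == 0) = (x == 0).
Proof. by rewrite -ofr_eq0 -rnormE normr_eq0. Qed.

Lemma rnorm_gt0 x : (0 < rnorm x) = (x != 0).
Proof. by rewrite lt_neqAle rnorm_ge0 andbT eq_sym rnorm_eq0. Qed.

Lemma rnormN x : rnorm (- x) = rnorm x.
Proof. by rewrite /rnorm normrN. Qed.

Lemma rnormB x y : rnorm (x - y) = rnorm (y - x).
Proof. by rewrite -rnormN opprB. Qed.

Lemma rnormD x y : rnorm (x + y) <= rnorm x + rnorm y.
Proof. by rewrite -le_ofr ofrD -!rnormE ler_normD. Qed.

Lemma rnormZ (a : C) x : rnorm (a *: x) = cmod a * rnorm x.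
Proof. by apply/complexI; rewrite -[LHS]rnormE normrZ normE rnormE -ofrM. Qed.

Lemma rnorm_nbhsP x (A : set V) :
  nbhs x A <-> exists2 d : R, 0 < d & forall y, rnorm (y - x) < d -> A y.
Proof.
split=> [/nbhs_ballP[e /= e0 eA]|[d d0 dA]].
  exists (creal e); first by rewrite -lt_ofr -creal_ge0 // ltW.
  move=> y yd; apply: eA; rewrite -ball_normE /ball_ /= distrC rnormE.
  by rewrite (creal_ge0 (ltW e0)) lt_ofr.
apply/nbhs_ballP; exists (ofr d); first by rewrite /= -ofr0 lt_ofr.
by move=> y; rewrite -ball_normE /ball_ /= distrC rnormE lt_ofr; exact: dA.
Qed.

Lemma near_rnormP x (P : V -> Prop) :
  (\forall y \near x, P y) <->
  exists2 d : R, 0 < d & forall y, rnorm (y - x) < d -> P y.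
Proof. exact: (rnorm_nbhsP x P). Qed.

Lemma nbhs_rball x (d : R) : 0 < d -> nbhs x [set y | rnorm (y - x) < d].
Proof. by move=> d0; apply/rnorm_nbhsP; exists d. Qed.

End Module.

Lemma rnormC (x : C) : rnorm x = cmod x.
Proof. by rewrite /rnorm normE. Qed.

Lemma cvg_rnormP (T : Type) (F : set_system T) (FF : Filter F) (V : normedModType C)
    (f : T -> V) (l : V) :
  f @ F --> l <-> forall e : R, 0 < e -> \forall t \near F, rnorm (f t - l) < e.
Proof.
split=> [fl e e0|fl].
  exact: (fl [set y | rnorm (y - l) < e] (nbhs_rball l e0)).
move=> A /rnorm_nbhsP[d d0 dA]; apply: filterS (fl d d0) => t; exact: dA.
Qed.

Lemma continuous_rnormP (V W : normedModType C) (f : V -> W) (x : V) :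
  {for x, continuous f} <->
  forall e : R, 0 < e ->
    exists2 d : R, 0 < d & forall y, rnorm (y - x) < d -> rnorm (f y - f x) < e.
Proof.
split=> [/cvg_rnormP fx e /fx /near_rnormP //|H].
by apply/cvg_rnormP => e /H /near_rnormP.
Qed.

Lemma continuous_realP (V : normedModType C) (f : V -> R) (x : V) :
  {for x, continuous f} <->
  forall e : R, 0 < e ->
    exists2 d : R, 0 < d & forall y, rnorm (y - x) < d -> `|f y - f x| < e.
Proof.
split=> [fx e e0|H A /nbhs_ballP[e /= e0 eA]].
  have /near_rnormP[d d0 dP] := fx _ (nbhsx_ballx (f x) _ e0).
  by exists d => // y /dP /=; rewrite /ball /= distrC.
have [d d0 dP] := H e e0; apply/rnorm_nbhsP; exists d => // y /dP yx.
by apply: eA; rewrite /ball /= distrC.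
Qed.

Lemma differentiable_rnorm (V W : normedModType C) (f : V -> W) (x : V) :
  differentiable f x -> forall e : R, 0 < e ->
    exists2 d : R, 0 < d & forall h, rnorm h < d ->
      rnorm (f (x + h) - f x - 'd f x h) <= e * rnorm h.
Proof.
move=> /diff_locally Hd e e0.
have /eqaddoP Ho := Hd.
have e0' : 0 < ofr e by rewrite -ofr0 lt_ofr.
have /near_rnormP[d d0 dP] := Ho (ofr e) e0'.
exists d => // h hd; have := dP h; rewrite subr0 => /(_ hd).
rewrite !rnormE -ofrM le_ofr.
by rewrite !fctE /= [h + x]addrC opprD addrA.
Qed.

(** Converse of [differentiable_rnorm]. The bound by [k] makes [df] continuous, and this is what
    allows the uniqueness of differentials to identify [df] with ['d f x]. *)
Lemma rnorm_differentiable (V W : normedModType C) (f : V -> W) (x : V)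
    (df : {linear V -> W}) (k : R) :
  (forall h, rnorm (df h) <= k * rnorm h) ->
  (forall e : R, 0 < e -> exists2 d : R, 0 < d & forall h, rnorm h < d ->
      rnorm (f (x + h) - f x - df h) <= e * rnorm h) ->
  differentiable f x /\ 'd f x = df :> (V -> W).
Proof.
move=> dfk H.
have dfc : continuous df.
  move=> y; apply/continuous_rnormP => e e0.
  have k1 : 0 < `|k| + 1 by rewrite ltr_wpDl.
  exists (e / (`|k| + 1)) => [|z zy]; first by rewrite divr_gt0.
  rewrite -linearB; apply: le_lt_trans (dfk _) _.
  rewrite ltr_pdivlMr // mulrC in zy; apply: le_lt_trans zy.
  by rewrite ler_wpM2r ?rnorm_ge0 // (le_trans (ler_norm k)) // lerDl.
have E : f \o shift x = cst (f x) + df +o_ 0 id.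
  apply/eqaddoP => e e0; have e0' : 0 < creal e.
    by rewrite -lt_ofr -creal_ge0 // ltW.
  have [d d0 dP] := H _ e0'.
  apply/near_rnormP; exists d => // h; rewrite subr0 => /dP.
  rewrite !rnormE (creal_ge0 (ltW e0)) -ofrM le_ofr.
  by rewrite !fctE /= [h + x]addrC opprD addrA.
have dE := diff_unique dfc E.
by split=> //; apply/diff_locallyP; rewrite dE.
Qed.

Definition packlin (V W : lmodType C) (f : V -> W) (lf : linear f) :
  {linear V -> W} := HB.pack f (GRing.isLinear.Build _ _ _ _ f lf).

End RealNorm.

(** * Row vectors and matrices in the sup norm *)

Section Rows.
Context {R : realType}.
Local Notation C := (Cplx R).

Lemma cmod_coord m n (x : 'M[C]_(m, n)) i j : cmod (x i j) <= rnorm x.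
Proof.
rewrite -le_ofr -normE -rnormE.
have -> : `|x| = mx_norm x by [].
rewrite mx_normE.
by rewrite -[leLHS]nngE num_le; exact: (le_bigmax _ _ (i, j)).
Qed.

Lemma rnorm_le m n (x : 'M[C]_(m, n)) (M : R) :
  0 <= M -> (forall i j, cmod (x i j) <= M) -> rnorm x <= M.
Proof.
move=> M0 H; rewrite -le_ofr -rnormE; have -> : `|x| = mx_norm x by [].
have [/eqP E|/mx_norm_neq0[[i j] ->]] := boolP (mx_norm x == 0).
  by rewrite E -ofr0 le_ofr.
by rewrite normE le_ofr.
Qed.

Lemma rnorm_mulmx m n p (A : 'M[C]_(n, p)) :
  exists2 k : R, 0 < k & forall h : 'M[C]_(m, n), rnorm (h *m A) <= k * rnorm h.
Proof.
exists (n%:R * rnorm A + 1) => [|h].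
  by rewrite ltr_wpDl // mulr_ge0 ?rnorm_ge0.
rewrite mulrDl mul1r -[leLHS]addr0 lerD ?rnorm_ge0 //.
apply: rnorm_le => [|i j]; first by rewrite !mulr_ge0 ?rnorm_ge0.
rewrite mxE.
have: \sum_(l < n) cmod (h i l * A l j) <= \sum_(l < n) rnorm A * rnorm h.
  apply: ler_sum => l _; rewrite cmodM mulrC.
  by rewrite ler_pM ?cmod_ge0 ?cmod_coord.
rewrite sumr_const card_ord -[X in _ <= X -> _]mulr_natl mulrA; apply: le_trans.
elim/big_ind2: _ => [|a b c d ab cd|//]; first by rewrite cmod0.
by rewrite (le_trans (cmodD _ _)) // lerD.
Qed.

Lemma mulmxr_is_linear m n p (A : 'M[C]_(n, p)) :
  linear (fun h : 'M[C]_(m, n) => h *m A).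
Proof. by move=> a u v; rewrite mulmxDl scalemxAl. Qed.

Lemma differentiable_mulmx m n p (A : 'M[C]_(n, p)) (x : 'M[C]_(m, n)) :
  differentiable (fun h : 'M[C]_(m, n) => h *m A) x.
Proof.
have [k k0 kP] := rnorm_mulmx m A.
pose L := packlin (@mulmxr_is_linear m n p A).
have [] // := @rnorm_differentiable R _ _ (fun h : 'M[C]_(m, n) => h *m A) x L k.
move=> e e0; exists 1 => // h _.
by rewrite /= mulmxDl [_ + h *m A]addrC addrK subrr rnorm0 mulr_ge0 ?rnorm_ge0 // ltW.
Qed.

Lemma differentiable_mx (V : normedModType C) m n (f : V -> 'M[C]_(m, n)) x :
  (forall i j, differentiable (fun y => f y i j) x) -> differentiable f x.
Proof.
move=> H.
have -> : f = \sum_(i < m) \sum_(j < n) (fun y => f y i j *: delta_mx i j).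
  apply/funext => y; rewrite fct_sumE [LHS]matrix_sum_delta.
  by apply: eq_bigr => i _; rewrite fct_sumE.
by apply: differentiable_sum => i; apply: differentiable_sum => j; exact: differentiableZl.
Qed.

Lemma differentiable_coordP (V : normedModType C) m n (f : V -> 'M[C]_(m, n)) x i j :
  differentiable f x -> differentiable (fun y => f y i j) x.
Proof.
move=> df; exact: (differentiable_comp df (differentiable_coord (f x) i j)).
Qed.

End Rows.

(** * Compact polydiscs and ultrafilter limits *)

Section Compactness.
Context {R : realType}.
Local Notation C := (Cplx R).

(** The disc is a closed subset of the continuous image of a real square. *)
Lemma compact_disc (a : C) (r : R) : compact [set x : C | cmod (x - a) <= r].
Proof.
pose g (p : R * R) : C := a + (ofr p.1 + cI * ofr p.2).
have gc : continuous g.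
  move=> p; apply/cvg_rnormP => e e0.
  have e2 : 0 < e / 2 by rewrite divr_gt0.
  have H1 : \forall q \near p, `|p.1 - q.1| < e / 2.
    exact: (@cvg_fst _ _ (nbhs p.1) (nbhs p.2) _ _ (nbhsx_ballx p.1 _ e2)).
  have H2 : \forall q \near p, `|p.2 - q.2| < e / 2.
    exact: (@cvg_snd _ _ (nbhs p.1) (nbhs p.2) _ _ (nbhsx_ballx p.2 _ e2)).
  near=> q.
  have -> : g q - g p = ofr (q.1 - p.1) + cI * ofr (q.2 - p.2).
    by rewrite /g !ofrB; ring.
  rewrite rnormC (le_lt_trans (cmodD _ _)) // cmodM cmod_I mul1r !cmod_ofr.
  rewrite [e]splitr ltrD // distrC; near: q; [exact: H1|exact: H2].
have K : compact (g @` (`[- r, r]%classic `*` `[- r, r]%classic)).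
  apply: continuous_compact; first exact: continuous_subspaceT.
  by apply: compact_setX; exact: segment_compact.
apply: subclosed_compact K _.
  have cc : continuous (fun x : C => cmod (x - a)).
    move=> x; apply/continuous_realP => e e0.
    exists e => // y; rewrite rnormC => yx; rewrite ltr_norml.
    have := cmodD (x - y) (y - a); have := cmodD (y - x) (x - a).
    by rewrite !addrA !subrK [cmod (x - y)]cmodB => *; lra.
  have -> : [set x : C | cmod (x - a) <= r] = (fun x : C => cmod (x - a)) @^-1` [set y | y <= r] by [].
  by apply: closed_comp => [x _|]; [exact: cc | exact: closed_le].
move=> x /= xr; exists (creal (x - a), cimag (x - a)).
  split; rewrite /= in_itv /= -ler_norml.
    exact: le_trans (creal_le _) xr.
  exact: le_trans (cimag_le _) xr.
by rewrite /g /= -cE addrC subrK.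
Unshelve. all: by end_near. Qed.

Lemma compact_polydisc n (p : 'rV[C]_n) (r : R) :
  0 <= r -> compact [set v : 'rV[C]_n | rnorm (v - p) <= r].
Proof.
move=> r0.
have -> : [set v : 'rV[C]_n | rnorm (v - p) <= r] =
          [set v | forall i, [set x : C | cmod (x - p 0 i) <= r] (v 0 i)].
  apply/seteqP; split=> v /= H => [i|].
    by have := cmod_coord (v - p) 0 i; rewrite !mxE => /le_trans; apply.
  by apply: rnorm_le => // i j; rewrite ord1 !mxE.
by apply: (@rV_compact C n (fun i => [set x : C | cmod (x - p 0 i) <= r])) => i; exact: compact_disc.
Qed.

(* Limits along one fixed ultrafilter replace the extraction of subsequences. *)
Definition nat_ultra : set_system nat :=
  projT1 (cid (ultraFilterLemma (F := @nbhs nat _ \oo) _)).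

#[global] Instance nat_ultraP : UltraFilter nat_ultra.
Proof. by rewrite /nat_ultra; case: cid => G []. Qed.

Lemma nat_ultra_near (P : nat -> Prop) :
  (\forall k \near \oo, P k) -> \forall k \near nat_ultra, P k.
Proof. by rewrite /nat_ultra; case: cid => G [_ /= GS]; exact: GS. Qed.

Lemma nat_ultra_cvg (T : topologicalType) (u : nat -> T) (l : T) :
  u @ \oo --> l -> u @ nat_ultra --> l.
Proof. by move=> H A /H; exact: nat_ultra_near. Qed.

Lemma fmap_ultra (T U : Type) (f : T -> U) (F : set_system T) :
  UltraFilter F -> UltraFilter (f @ F).
Proof.
move=> FU; split; first exact: _.
move=> G GF sG; apply/seteqP; split=> [A GA|]; last exact: sG.
have [//|FnA] := in_ultra_setVsetC (f @^-1` A) FU.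
have : G (~` A) by apply: sG.
by move=> /(filterI GA); rewrite setICr => /filter_not_empty.
Qed.

Lemma ultra_compact_cvg (T : topologicalType) (A : set T) (u : nat -> T) :
  compact A -> (forall k, A (u k)) -> exists2 l, A l & u @ nat_ultra --> l.
Proof.
rewrite compact_ultra => cA uA.
have UF : UltraFilter (u @ nat_ultra) by exact: fmap_ultra.
have FA : (u @ nat_ultra) A by apply: nat_ultra_near; exact: filterE.
by have [l [Al ul]] := cA _ UF FA; exists l.
Qed.

End Compactness.

(** * Cauchy theory in one variable *)

Section Average.
Context {R : realType}.
Local Notation C := (Cplx R).
Implicit Types (phi psi : C -> C) (a d : C).

(* Average of [phi] over the midpoints of the [2 ^ m] equal pieces of the segment [a, a + d]. *)
Fixpoint avg (m : nat) phi a d : C :=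
  if m is m'.+1 then (avg m' phi a (d / 2) + avg m' phi (a + d / 2) (d / 2)) / 2
  else phi (a + d / 2).

(** Used for discs and half-planes: a midpoint-convex condition on the values is inherited by dyadic
    averages. *)
Lemma avg_closed (P : C -> Prop) m phi a d :
  (forall x y, P x -> P y -> P ((x + y) / 2)) ->
  (forall t : R, 0 <= t <= 1 -> P (phi (a + ofr t * d))) -> P (avg m phi a d).
Proof.
move=> PC; elim: m a d => [|m IH] a d H /=.
  rewrite [d / 2]mulrC -[2]ofr_nat -ofrV; apply: H; lra.
have E2 : 2^-1 = ofr 2^-1 :> C by rewrite ofrV ofr_nat.
apply: PC; apply: IH => t t01.
  by rewrite [d / 2]mulrC E2 mulrA -ofrM; apply: H; lra.
have -> : a + d / 2 + ofr t * (d / 2) = a + ofr (2^-1 + t / 2) * d.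
  by rewrite ofrD ofrM E2; ring.
by apply: H; lra.
Qed.

Lemma avg_cmod_le m phi a d (M : R) :
  (forall t : R, 0 <= t <= 1 -> cmod (phi (a + ofr t * d)) <= M) ->
  cmod (avg m phi a d) <= M.
Proof.
apply: (@avg_closed (fun x => cmod x <= M)) => x y xM yM.
rewrite cmodM cmodV -[2]ofr_nat cmod_ofr ger0_norm // ler_pdivrMr //.
by apply: le_trans (cmodD _ _) _; lra.
Qed.

Lemma avg_creal_le m phi a d (M : R) :
  (forall t : R, 0 <= t <= 1 -> creal (phi (a + ofr t * d)) <= M) ->
  creal (avg m phi a d) <= M.
Proof.
apply: (@avg_closed (fun x => creal x <= M)) => x y xM yM.
rewrite -[2]ofr_nat -ofrV crealM cimag_ofr mulr0 subr0 creal_ofr crealD; lra.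
Qed.

Lemma avgB m phi psi a d :
  avg m (fun s => phi s - psi s) a d = avg m phi a d - avg m psi a d.
Proof. by elim: m a d => [|m IH] a d //=; rewrite !IH; ring. Qed.

Lemma avg_affine m (al be : C) a d :
  avg m (fun s => al + be * s) a d = al + be * (a + d / 2).
Proof. by elim: m a d => [|m IH] a d //=; rewrite !IH; field. Qed.

Lemma eq_avg m phi psi a d : phi =1 psi -> avg m phi a d = avg m psi a d.
Proof. by move=> /funext ->. Qed.

Lemma avg_shift m phi (c : C) a d :
  avg m (fun s => phi (s + c)) a d = avg m phi (a + c) d.
Proof.
elim: m a d => [|m IH] a d /=; first by rewrite addrAC.
by rewrite !IH addrAC.
Qed.

(** The midpoint-rule approximation to the integral of [H] around the parallelogram with corner [a]
    and sides [w], [h]. *)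
Definition boundary_sum (H : C -> C) m a w h : C :=
  w * (avg m H a w - avg m H (a + h) w) + h * (avg m H (a + w) h - avg m H a h).

(** Goursat's subdivision: the inner edges of the four quarters cancel, and one level of refinement
    is spent on halving the sides. *)
Lemma boundary_sumS H m a w h :
  boundary_sum H m.+1 a w h =
  boundary_sum H m a (w / 2) (h / 2) +
  boundary_sum H m (a + w / 2) (w / 2) (h / 2) +
  boundary_sum H m (a + h / 2) (w / 2) (h / 2) +
  boundary_sum H m (a + w / 2 + h / 2) (w / 2) (h / 2).
Proof.
rewrite /boundary_sum /=.
have -> : a + w / 2 + h / 2 + h / 2 = a + h + w / 2 by field.
have -> : a + w / 2 + h / 2 + w / 2 = a + w + h / 2 by field.
have -> : a + h / 2 + h / 2 = a + h by field.
have -> : a + w / 2 + w / 2 = a + w by field.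
have -> : a + h / 2 + w / 2 = a + w / 2 + h / 2 by field.
by field.
Qed.

(** The midpoint rule is exact on affine functions, so this holds at every level [m] without any
    limit. *)
Lemma boundary_sum_affine (al be : C) m a w h :
  boundary_sum (fun s => al + be * s) m a w h = 0.
Proof. by rewrite /boundary_sum !avg_affine; field. Qed.

Lemma boundary_sumB (H G : C -> C) m a w h :
  boundary_sum (fun s => H s - G s) m a w h =
  boundary_sum H m a w h - boundary_sum G m a w h.
Proof. by rewrite /boundary_sum !avgB; ring. Qed.

Lemma boundary_sum_le (H : C -> C) m a w h (M : R) :
  (forall s t : R, 0 <= s <= 1 -> 0 <= t <= 1 ->
     cmod (H (a + ofr s * w + ofr t * h)) <= M) ->
  cmod (boundary_sum H m a w h) <= 2 * M * (cmod w + cmod h).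
Proof.
move=> HM.
have B (b c : C) : cmod b <= M -> cmod c <= M -> cmod (b - c) <= 2 * M.
  by move=> bM cM; apply: le_trans (cmodD _ _) _; rewrite cmodN; lra.
rewrite /boundary_sum; apply: le_trans (cmodD _ _) _; rewrite !cmodM mulrDr.
rewrite [_ * cmod w]mulrC [_ * cmod h]mulrC.
apply: lerD; apply: ler_wpM2l; rewrite ?cmod_ge0 //; apply: B; apply: avg_cmod_le => t t01.
- by have := HM t 0 t01; rewrite ofr0 mul0r addr0; apply; lra.
- by have := HM t 1 t01; rewrite ofr1 mul1r addrAC; apply; lra.
- by have := HM 1 t; rewrite ofr1 mul1r; apply => //; lra.
- by have := HM 0 t; rewrite ofr0 mul0r addr0; apply => //; lra.
Qed.

Lemma nested_dyadic (x : nat -> R) :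
  (forall k, x k <= x k.+1) ->
  (forall k, x k.+1 + 2^-1 ^+ k.+1 <= x k + 2^-1 ^+ k) ->
  exists s, forall k, x k <= s <= x k + 2^-1 ^+ k.
Proof.
move=> xi xd.
have mono k l : (k <= l)%N -> x k <= x l.
  by move=> /subnK <-; elim: (_ - _)%N => // i /le_trans; apply; rewrite addSn.
have anti k l : (k <= l)%N -> x l + 2^-1 ^+ l <= x k + 2^-1 ^+ k.
  by move=> /subnK <-; elim: (_ - _)%N => // i; apply: le_trans; rewrite addSn.
have ub k l : x l <= x k + 2^-1 ^+ k.
  have p l' : 0 <= 2^-1 ^+ l' :> R by rewrite exprn_ge0.
  have [kl|lk] := leqP k l.
    by have := anti _ _ kl; have := p l; lra.
  by have := mono _ _ (ltnW lk); have := p k; lra.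
exists (sup (range x)) => k; apply/andP; split.
  apply: sup_upper_bound; last by exists k.
  split; first by exists (x 0%N), 0%N.
  by exists (x 0%N + 2^-1 ^+ 0) => _ [l _ <-].
by apply: sup_le_ub => [|_ [l _ <-]] //; exists (x 0%N), 0%N.
Qed.

Lemma half_pow_small (e : R) : 0 < e -> exists k, (2^-1 : R) ^+ k < e.
Proof.
move=> e0.
have /cvgrPdist_lt/(_ e e0)[k _ H] : (fun k => (2^-1 : R) ^+ k) @ \oo --> (0 : R).
  by apply: cvg_expr; rewrite ger0_norm ?invf_lt1 ?ltr1n.
exists k; have := H k (leqnn k); by rewrite sub0r normrN ger0_norm // exprn_ge0.
Qed.

(** Bisection by contradiction: a bad parallelogram has a bad quarter, and the quarters shrink to a
    point where differentiability makes [H] affine up to a negligible error. No integral is formed;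
    the claim is only that the boundary sums tend to 0. *)
Lemma goursat (H : C -> C) a w h :
  (forall s t : R, 0 <= s <= 1 -> 0 <= t <= 1 ->
     differentiable H (a + ofr s * w + ofr t * h)) ->
  forall e : R, 0 < e -> \forall m \near \oo, cmod (boundary_sum H m a w h) <= e.
Proof.
move=> dH e e0; apply: contrapT => bad0.
pose dl k : R := 2^-1 ^+ k.
pose E m (st : R * R) k := boundary_sum H m (a + ofr st.1 * w + ofr st.2 * h)
  (ofr (dl k) * w) (ofr (dl k) * h).
pose good st k := \forall m \near \oo, cmod (E m st k) <= e * dl k ^+ 2.
have dlS k : dl k = dl k.+1 + dl k.+1 by rewrite /dl exprS; field.
(* The tolerance is proportional to the area, so the tolerances of the four quarters add up to that
   of the whole. *)
have split st k : (forall i j : bool, good (st.1 + i%:R * dl k.+1, st.2 + j%:R * dl k.+1) k.+1) ->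
    good st k.
  move=> G; have := filterI (filterI (G false false) (G false true))
                            (filterI (G true false) (G true true)).
  (* The threshold moves by one because level [m.+1] on the whole is level [m] on the quarters. *)
  move=> [N _ HN]; exists N.+1 => // -[//|m] /= Nm.
  have [[/= h1 h2] [/= h3 h4]] := HN m Nm.
  rewrite /E boundary_sumS.
  have ht x : ofr (dl k) * x / 2 = ofr (dl k.+1) * x.
    by rewrite (dlS k) ofrD; field.
  rewrite !ht; move: h1 h2 h3 h4; rewrite /E /= !mul0r !mul1r !addr0.
  have -> : a + ofr st.1 * w + ofr (st.2 + dl k.+1) * h =
            a + ofr st.1 * w + ofr st.2 * h + ofr (dl k.+1) * h by rewrite ofrD; ring.
  have -> : a + ofr (st.1 + dl k.+1) * w + ofr st.2 * h =
            a + ofr st.1 * w + ofr st.2 * h + ofr (dl k.+1) * w by rewrite ofrD; ring.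
  have -> : a + ofr (st.1 + dl k.+1) * w + ofr (st.2 + dl k.+1) * h =
            a + ofr st.1 * w + ofr st.2 * h + ofr (dl k.+1) * w + ofr (dl k.+1) * h.
    by rewrite !ofrD; ring.
  rewrite (dlS k).
  have -> : (dl k.+1 + dl k.+1) ^+ 2 = 4 * dl k.+1 ^+ 2 by ring.
  move=> h1 h2 h3 h4; apply: le_trans (cmodD _ _) _.
  have := le_trans (cmodD _ _) (lerD h1 h3) => h5.
  have := le_trans (cmodD _ _) (lerD h5 h2); lra.
have [g gP] : exists g : R * R -> nat -> R * R, forall st k, ~ good st k ->
    [/\ ~ good (g st k) k.+1, st.1 <= (g st k).1 <= st.1 + dl k.+1 &
        st.2 <= (g st k).2 <= st.2 + dl k.+1].
  suff /choice[g gP] : forall p : (R * R) * nat, exists st', ~ good p.1 p.2 ->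
    [/\ ~ good st' p.2.+1, p.1.1 <= st'.1 <= p.1.1 + dl p.2.+1 &
        p.1.2 <= st'.2 <= p.1.2 + dl p.2.+1].
    by exists (fun st' k' => g (st', k')) => st' k'; exact: (gP (st', k')).
  move=> [st k] /=; have [gk|bk] := pselect (good st k); first by exists st.
  have [i [j bij]] : exists i j : bool,
      ~ good (st.1 + i%:R * dl k.+1, st.2 + j%:R * dl k.+1) k.+1.
    apply: contrapT => N; apply: bk; apply: split => i j.
    by apply: contrapT => b; apply: N; exists i, j.
  have d0 : 0 <= dl k.+1 by rewrite exprn_ge0.
  exists (st.1 + i%:R * dl k.+1, st.2 + j%:R * dl k.+1) => _; split=> //=.
    by case: i {bij}; rewrite ?mul1r ?mul0r; lra.
  by case: j {bij}; rewrite ?mul1r ?mul0r; lra.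
pose q := fix q k := if k is k'.+1 then g (q k') k' else ((0, 0) : R * R).
have qbad k : ~ good (q k) k.
  elim: k => [|k /gP[]//] /=; rewrite /good /E /dl /= expr0 expr1n mulr1.
  by rewrite ofr0 ofr1 !mul0r !addr0 !mul1r.
have qS k := gP _ _ (qbad k).
have [s sP] : exists s, forall k, (q k).1 <= s <= (q k).1 + dl k.
  apply: nested_dyadic => k; have [_ /= h1 _] := qS k; move: h1 => /andP[h1 h2] //.
  by rewrite -/(dl k) -/(dl k.+1) (dlS k); lra.
have [t tP] : exists s, forall k, (q k).2 <= s <= (q k).2 + dl k.
  apply: nested_dyadic => k; have [_ /= _ h1] := qS k; move: h1 => /andP[h1 h2] //.
  by rewrite -/(dl k) -/(dl k.+1) (dlS k); lra.
have s01 : 0 <= s <= 1 by have := sP 0%N; rewrite /dl /= expr0 add0r.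
have t01 : 0 <= t <= 1 by have := tP 0%N; rewrite /dl /= expr0 add0r.
pose p := a + ofr s * w + ofr t * h.
pose B := cmod w + cmod h + 1.
have B0 : 0 < B by have := cmod_ge0 w; have := cmod_ge0 h; rewrite /B; lra.
(* At scale [dl k] the remainder is at most this slope times [dl k * B], and the perimeter
   contributes a further factor [2 * dl k * B]; the product is [e * dl k ^+ 2]. The [+ 1] in [B]
   covers degenerate sides. *)
have kap0 : 0 < e / (2 * B ^+ 2) by rewrite divr_gt0 // mulr_gt0 // exprn_gt0.
have [del del0 delP] := differentiable_rnorm (dH s t s01 t01) kap0.
have [k kP] := half_pow_small (divr_gt0 del0 B0).
have dk0 : 0 < dl k by rewrite exprn_gt0.
apply: (qbad k); apply: nearW => m; rewrite /E.
have [be beP] : exists be : C, forall z, 'd H p z = be * z.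
  exists ('d H p 1) => z; rewrite -[in LHS](mulr1 z) -[z * 1]/(z *: (1 : C)).
  by rewrite linearZ mulrC.
set b := a + _ + _.
(* Subtracting the first-order expansion of [H] at [p] leaves the boundary sum unchanged. *)
have -> : boundary_sum H m b (ofr (dl k) * w) (ofr (dl k) * h) =
   boundary_sum (fun z => H z - (H p - be * p + be * z)) m b (ofr (dl k) * w) (ofr (dl k) * h).
  by rewrite boundary_sumB boundary_sum_affine subr0.
apply: le_trans (boundary_sum_le _ (M := e / (2 * B ^+ 2) * (dl k * B)) _) _.
  move=> s' t' s'01 t'01; set z := b + _ + _.
  have zp : cmod (z - p) <= dl k * B.
    have -> : z - p = ofr ((q k).1 + s' * dl k - s) * w + ofr ((q k).2 + t' * dl k - t) * h.
      by rewrite /z /b /p !ofrB !ofrD !ofrM; ring.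
    apply: le_trans (cmodD _ _) _; rewrite !cmodM !cmod_ofr /B.
    have n1 : `|(q k).1 + s' * dl k - s| <= dl k.
      by rewrite ler_norml; have := sP k; nra.
    have n2 : `|(q k).2 + t' * dl k - t| <= dl k.
      by rewrite ler_norml; have := tP k; nra.
    have := ler_wpM2r (cmod_ge0 w) n1; have := ler_wpM2r (cmod_ge0 h) n2; nra.
  have := delP (z - p); rewrite !rnormC -/p [p + _]addrC subrK beP.
  have -> : H z - H p - be * (z - p) = H z - (H p - be * p + be * z) by ring.
  have zd : cmod (z - p) < del.
    by apply: le_lt_trans zp _; rewrite -ltr_pdivlMr.
  move=> /(_ zd) /le_trans; apply.
  by rewrite ler_wpM2l // ltW.
rewrite !cmodM !cmod_ofr (ger0_norm (ltW dk0)) -mulrDr.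
have -> : 2 * (e / (2 * B ^+ 2) * (dl k * B)) * (dl k * (cmod w + cmod h)) =
  e * dl k ^+ 2 * ((cmod w + cmod h) / B).
  by field; rewrite gt_eqF.
rewrite -[leRHS]mulr1; apply: ler_wpM2l; first by rewrite mulr_ge0 ?exprn_ge0 // ltW.
by rewrite ler_pdivrMr // mul1r /B lerDl.
Qed.

End Average.

(** * The complex exponential *)

Section ComplexExponential.
Context {R : realType}.
Local Notation C := (Cplx R).

Definition cexp (s : C) : C :=
  ofr (expR (creal s)) * (ofr (cos (cimag s)) + cI * ofr (sin (cimag s))).

Lemma cexpD s t : cexp (s + t) = cexp s * cexp t.
Proof.
rewrite /cexp crealD cimagD expRD cosD sinD !ofrD ofrN !ofrM.
have := @cIsqr R; move: cI => i ii; ring: ii.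
Qed.

Lemma cmod_cexp s : cmod (cexp s) = expR (creal s).
Proof.
rewrite /cexp cmodM cmod_ofr ger0_norm ?expR_ge0 //.
suff -> : cmod (ofr (cos (cimag s)) + cI * ofr (sin (cimag s))) = 1 by rewrite mulr1.
apply/eqP; rewrite -(eqrXn2 (n := 2)) ?cmod_ge0 // cmod_sqr crealD cimagD crealM cimagM.
rewrite !creal_ofr !cimag_ofr creal_I cimag_I !mul0r !mul1r subr0 !addr0 !add0r.
by rewrite cos2Dsin2 expr1n.
Qed.

Definition period : C := ofr (pi *+ 2) * cI.

Lemma creal_vertical (a t : R) : creal (ofr a + ofr t * period) = a.
Proof.
rewrite crealD crealM /period crealM cimagM !creal_ofr !cimag_ofr creal_I cimag_I.
by rewrite !(mulr0, mul0r, subr0, subrr, addr0).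
Qed.

Lemma cexp_period s : cexp (s + period) = cexp s.
Proof.
rewrite /cexp /period crealD cimagD crealM cimagM creal_ofr cimag_ofr creal_I cimag_I.
by rewrite !mul0r mulr0 subr0 !addr0 mulr1 cosD2pi sinD2pi.
Qed.

Lemma is_derive_eps (f : R -> R) (l : R) : is_derive (0 : R) (1 : R) f l ->
  forall e, 0 < e -> exists2 d, 0 < d & forall h, `|h| < d -> `|f h - f 0 - l * h| <= e * `|h|.
Proof.
move=> [df lE] e e0.
have : (fun h => h^-1 *: ((f \o shift 0) (h *: 1) - f 0)) @ 0^' --> l by rewrite -lE.
move=> /cvgrPdist_lt/(_ e e0); rewrite near_withinE => /nbhs_ballP[d /= d0 dP].
exists d => // h hd; have [->|h0] := eqVneq h 0.
  by rewrite subrr mulr0 subrr normr0 mulr0.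
have := dP h; rewrite /ball /= sub0r normrN => /(_ hd h0) /ltW.
have -> : l - h^-1 *: ((f \o shift 0) (h *: 1) - f 0) = (l * h - (f h - f 0)) / h.
  by rewrite /= addr0 -[h *: 1]/(h * 1) mulr1 -[_ *: _]/(_ * _); field.
by rewrite normf_div ler_pdivrMr ?normr_gt0 // distrC.
Qed.

Lemma cexp_near0 (e : R) : 0 < e ->
  exists2 d : R, 0 < d & forall h : C, cmod h < d -> cmod (cexp h - 1 - h) <= e * cmod h.
Proof.
(* The error terms below add up to at most [9 * k * cmod h]; the quadratic one is of this size
   because [cmod h < k]. *)
move=> e0; have [k [k0 k1 ke]] : exists k, [/\ 0 < k, k <= 1 & k <= e / 16].
  by exists (Num.min (e / 16) 1); rewrite lt_min !ge_min !lexx orbT divr_gt0 /=.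
have [d1 d10 H1] := @is_derive_eps expR 1 (is_derive_eq (is_derive_expR 0) (expR0 R)) k k0.
have cos'0 : is_derive (0 : R) (1 : R) cos 0.
  by apply: is_derive_eq (is_derive_cos 0) _; rewrite sin0 oppr0.
have [d2 d20 H2] := is_derive_eps cos'0 k0.
have [d3 d30 H3] := @is_derive_eps sin 1 (is_derive_eq (is_derive_sin 0) (cos0 R)) k k0.
exists (Num.min (Num.min d1 d2) (Num.min d3 k)); first by rewrite !lt_min d10 d20 d30 k0.
move=> h; rewrite !lt_min => /andP[/andP[hd1 hd2] /andP[hd3 hk]].
have xh := creal_le h; have yh := cimag_le h.
have := H1 _ (le_lt_trans xh hd1); have := H2 _ (le_lt_trans yh hd2).
have := H3 _ (le_lt_trans yh hd3).
rewrite expR0 cos0 sin0 mul0r !subr0 !mul1r.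
rewrite [X in _ -> _ -> _ -> cmod (_ - X) <= _](cE h) /cexp.
have hh := cmod_ge0 h.
move: (creal h) (cimag h) xh yh => x y xh yh Hs Hc He.
have -> : ofr (expR x) * (ofr (cos y) + cI * ofr (sin y)) - 1 - (ofr x + cI * ofr y) =
   ofr (expR x * (cos y - 1) + (expR x - 1 - x)) +
   cI * ofr ((expR x - 1) * sin y + (sin y - y)).
  by rewrite !(ofrD, ofrN, ofrM) ofr1; ring.
apply: le_trans (cmodD _ _) _; rewrite cmodM cmod_I mul1r !cmod_ofr.
move: (expR x) (cos y) (sin y) Hs Hc He => E c s.
have x0 := normr_ge0 x; have y0 := normr_ge0 y.
set X := `|x| in xh x0 *; set Y := `|y| in yh y0 *.
move=> Hs Hc He.
have sY : `|s| <= 2 * Y.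
  by have := ler_normD (s - y) y; rewrite subrK -/Y; nra.
have EX : `|E - 1| <= 2 * X.
  by have := ler_normD (E - 1 - x) x; rewrite subrK -/X; nra.
have E3 : `|E| <= 3.
  by have := ler_normD (E - 1) 1; rewrite subrK normr1; nra.
have t1 := ler_normD (E * (c - 1)) (E - 1 - x).
have t2 := ler_normD ((E - 1) * s) (s - y).
have t3 : `|E * (c - 1)| <= 3 * (k * Y) by rewrite normrM ler_pM.
have t4 : `|(E - 1) * s| <= 2 * X * (2 * Y) by rewrite normrM ler_pM.
have t5 : k * X <= k * cmod h by rewrite (ler_wpM2l (ltW k0)).
have t6 : k * Y <= k * cmod h by rewrite (ler_wpM2l (ltW k0)).
have t7 : X * Y <= k * cmod h by apply: ler_pM => //; exact: ltW (le_lt_trans xh hk).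
have t8 : k * cmod h <= e / 16 * cmod h by rewrite ler_wpM2r.
have t9 : 0 <= e * cmod h by rewrite mulr_ge0 // ltW.
lra.
Qed.

Lemma cderiv_differentiable (u : C -> C) t (l : C) :
  (forall e : R, 0 < e -> exists2 d : R, 0 < d &
     forall h, cmod h < d -> cmod (u (t + h) - u t - l * h) <= e * cmod h) ->
  differentiable u t.
Proof.
move=> H.
have lin : linear (fun h : C => l * h : C).
  by move=> a x y; rewrite -![_ *: _]/(_ * _) mulrDr mulrCA.
have [] // := @rnorm_differentiable R _ _ u t (packlin lin) (cmod l).
by move=> h; rewrite !rnormC cmodM.
Qed.

Lemma differentiable_cderiv (u : C -> C) t : differentiable u t ->
  exists l : C, forall e : R, 0 < e -> exists2 d : R, 0 < d &
     forall h, cmod h < d -> cmod (u (t + h) - u t - l * h) <= e * cmod h.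
Proof.
move=> du; exists ('d u t 1) => e /(differentiable_rnorm du)[d d0 dP].
exists d => // h hd; have := dP h; rewrite !rnormC => /(_ hd).
by have -> : 'd u t h = 'd u t 1 * h by rewrite -[in LHS](mulr1 h) -[h * 1]/(h *: (1 : C)) linearZ mulrC.
Qed.

Lemma differentiable_cexp s : differentiable cexp s.
Proof.
apply: (@cderiv_differentiable _ _ (cexp s)) => e e0.
have c0 : 0 < cmod (cexp s) by rewrite cmod_cexp expR_gt0.
have [d d0 dP] := cexp_near0 (divr_gt0 e0 c0).
exists d => // h /dP H; rewrite cexpD.
have -> : cexp s * cexp h - cexp s - cexp s * h = cexp s * (cexp h - 1 - h) by ring.
by rewrite cmodM mulrC -ler_pdivlMr // mulrAC.
Qed.

End ComplexExponential.

(** * Mean value property and maximum principle *)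

Section MeanValue.
Context {R : realType}.
Local Notation C := (Cplx R).

Lemma differentiable_comp_C (V : normedModType C) (f : V -> C) (g : C -> C) x :
  differentiable f x -> differentiable g (f x) -> differentiable (fun y => g (f y)) x.
Proof. exact: differentiable_comp. Qed.

Lemma differentiableDl (V W : normedModType C) (a : W) (f : V -> W) x :
  differentiable f x -> differentiable (fun y => a + f y) x.
Proof. by move=> df; apply: differentiableD => //; exact: differentiable_cst. Qed.

(* In the coordinate log (t - p) circles become segments, and by periodicity the two
   horizontal sides of the rectangle cancel. *)
Lemma mean_value (u : C -> C) (p : C) (r : R) : 0 < r ->
  {for p, continuous u} ->
  (forall t, 0 < cmod (t - p) <= r -> differentiable u t) ->
  forall e : R, 0 < e -> \forall m \near \oo,
    cmod (avg m (fun s => u (p + cexp s)) (ofr (ln r)) period - u p) <= e.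
Proof.
move=> r0 /continuous_rnormP uc du e e0.
have e2 : 0 < e / 2 by rewrite divr_gt0.
have [d d0 dP] := uc _ e2.
(* On the circle of radius [r1], continuity alone puts the average within [e / 2] of [u p]. Goursat
   then compares this circle with the one of radius [r], over an annulus that excludes [p]. *)
pose r1 := Num.min (d / 2) r.
have r10 : 0 < r1 by rewrite lt_min r0 divr_gt0.
have r1r : r1 <= r by rewrite /r1 ge_min lexx orbT.
have r1d : r1 < d by rewrite /r1 gt_min; apply/orP; left; lra.
pose H s := u (p + cexp s).
have per0 : 0 < cmod (period : C).
  by rewrite cmodM cmod_I mulr1 cmod_ofr normr_gt0 mulrn_eq0 /= gt_eqF ?pi_gt0.

have dH (s t : R) : 0 <= s <= 1 -> 0 <= t <= 1 ->
    differentiable H (ofr (ln r1) + ofr s * ofr (ln r - ln r1) + ofr t * period).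
  move=> s01 t01.
  apply: (@differentiable_comp_C _ (fun s => p + cexp s) u).
    by apply: differentiableDl; exact: differentiable_cexp.
  apply: du; rewrite addrC addKr cmod_cexp expR_gt0 andTb.
  rewrite -ofrM -ofrD creal_vertical.
  rewrite -[leRHS](lnK r0) ler_expR.
  have : ln r1 <= ln r by rewrite ler_ln.
  nra.
have := goursat dH (mulr_gt0 e2 per0).
apply: filterS => m; rewrite /boundary_sum.
have -> : avg m H (ofr (ln r1) + period) (ofr (ln r - ln r1)) =
          avg m H (ofr (ln r1)) (ofr (ln r - ln r1)).
  by rewrite -avg_shift; apply: eq_avg => s; rewrite /H cexp_period.
rewrite subrr mulr0 add0r cmodM -ofrD [ln r1 + _]addrC subrK mulrC ler_pM2r // => B.
have small : cmod (avg m H (ofr (ln r1)) period - u p) <= e / 2.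
  have -> : u p = avg m (fun=> u p) (ofr (ln r1)) period.
    have := avg_affine m (u p) 0 (ofr (ln r1)) period.
    by under eq_avg do rewrite mul0r addr0; rewrite mul0r addr0 => ->.
  rewrite -avgB; apply: avg_cmod_le => t t01.
  rewrite -rnormC; apply/ltW/dP; rewrite rnormC addrC addKr cmod_cexp.
  by rewrite creal_vertical lnK.
rewrite -/H; have -> : avg m H (ofr (ln r)) period - u p =
  (avg m H (ofr (ln r)) period - avg m H (ofr (ln r1)) period) +
  (avg m H (ofr (ln r1)) period - u p) by ring.
by apply: le_trans (cmodD _ _) _; lra.
Qed.

(* Maximum principle in the style of Rado: nothing is required of [u] near its zeros. *)
Lemma max_modulus (u : C -> C) (a : C) (r M : R) : 0 < r ->
  (forall t, cmod (t - a) <= r -> {for t, continuous u}) ->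
  (forall p, cmod (p - a) < r -> u p != 0 -> exists2 d : R, 0 < d &
     forall t, 0 < cmod (t - p) < d -> differentiable u t) ->
  (forall t, cmod (t - a) = r -> cmod (u t) <= M) ->
  forall t, cmod (t - a) <= r -> cmod (u t) <= M.
Proof.
move=> r0 uc du uM t tr.
have M0 : 0 <= M.
  have /uM/(le_trans (cmod_ge0 _)) // : cmod (a + ofr r - a) = r.
  by rewrite addrC addKr cmod_ofr gtr0_norm.
(* The term in [eta] makes the function to be maximised strictly subharmonic, which excludes
   interior maxima outright. *)
suff H (eta : R) : 0 < eta -> cmod (u t) ^+ 2 <= M ^+ 2 + eta * r ^+ 2.
  rewrite -(ler_sqr (cmod_ge0 _)) ?nnegrE //.
  apply/ler_addgt0Pr => e e0.
  have r20 : 0 < r ^+ 2 by rewrite exprn_gt0.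
  by have := H _ (divr_gt0 e0 r20); rewrite divfK // gt_eqF.
move=> eta0.
pose v t := cmod (u t) ^+ 2 + eta * cmod (t - a) ^+ 2.
have cmodc (f : C -> C) x : {for x, continuous f} -> {for x, continuous (fun y => cmod (f y))}.
  move=> /continuous_rnormP fc; apply/continuous_realP => e e0.
  have [d d0 dP] := fc e e0; exists d => // y /dP; rewrite rnormC /= => h.
  rewrite ltr_norml; have := cmodD (f x - f y) (f y); have := cmodD (f y - f x) (f x).
  by rewrite !subrK [cmod (f x - f y)]cmodB => *; lra.
have vc x : cmod (x - a) <= r -> {for x, continuous v}.
  move=> xr.
  have -> : v = fun t => cmod (u t) * cmod (u t) + eta * (cmod (t - a) * cmod (t - a)).
    by apply/funext => y; rewrite /v !expr2.
  have c1 : {for x, continuous (fun t => cmod (u t))} by apply: cmodc; exact: uc.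
  have c2 : {for x, continuous (fun t => cmod (t - a))}.
    by apply: cmodc; apply: continuousB => //; exact: cst_continuous.
  apply: continuousD; first exact: continuousM.
  by apply: continuousM; [exact: cst_continuous|exact: continuousM].
have [p pA pmax] : exists2 p, p \in [set x : C | cmod (x - a) <= r] &
    forall x, x \in [set x : C | cmod (x - a) <= r] -> v x <= v p.
  apply: compact_EVT_max.
  - by exists t.
  - exact: compact_disc.
  - apply: continuous_in_subspaceT => x; rewrite inE; exact: vc.
rewrite inE /= in pA.
have {}pmax x : cmod (x - a) <= r -> v x <= v p by move=> xr; apply: pmax; rewrite inE.
suff vp : v p <= M ^+ 2 + eta * r ^+ 2.
  apply: le_trans vp; apply: le_trans (pmax t tr).
  by rewrite /v lerDl mulr_ge0 ?sqr_ge0 // ltW.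
have pr2 : eta * cmod (p - a) ^+ 2 <= eta * r ^+ 2.
  by rewrite (ler_wpM2l (ltW eta0)) // ler_sqr // nnegrE ?cmod_ge0 // ltW.
have [pr|pr] := eqVneq (cmod (p - a)) r.
  rewrite /v lerD // ler_sqr ?nnegrE ?cmod_ge0 //; exact: uM.
have {}pr : cmod (p - a) < r by rewrite lt_neqAle pr.
(* At a zero of [u] the value of [v] is only the [eta] term, so the bound holds without holomorphy
   near [p]. *)
have [up0|up0] := eqVneq (u p) 0.
  by rewrite /v up0 cmod0 expr0n /= add0r ler_wpDl // sqr_ge0.
exfalso.
have [d d0 dP] := du p pr up0.
pose r1 := Num.min (d / 2) (r - cmod (p - a)).
have r10 : 0 < r1 by rewrite lt_min divr_gt0 //= subr_gt0.
have r1d : r1 < d by rewrite /r1 gt_min; apply/orP; left; lra.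
have r1r : r1 <= r - cmod (p - a) by rewrite /r1 ge_min lexx orbT.
(* The holomorphic first-order part: [v t - v p] equals [creal (G t) + cmod (u t - u p) ^+ 2 + eta *
   cmod (t - p) ^+ 2]. Maximality makes [creal G] at most [- (eta * r1 ^+ 2)] on the circle, while
   the mean value of [G] there is [G p = 0]. *)
pose G t := ofr 2 * cconj (u p) * (u t - u p) + ofr (2 * eta) * cconj (p - a) * (t - p).
have Gp : G p = 0 by rewrite /G !subrr !mulr0 addr0.
have dG x : differentiable u x -> differentiable G x.
  move=> dux; apply: differentiableD; apply: differentiableM; try exact: differentiable_cst.
    by apply: differentiableB => //; exact: differentiable_cst.
  by apply: differentiableB => //; exact: differentiable_cst.
have Gc : {for p, continuous G}.
  apply: continuousD; apply: continuousM; try exact: cst_continuous.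
    by apply: continuousB; [apply: uc; exact: ltW|exact: cst_continuous].
  by apply: continuousB => //; exact: cst_continuous.
have Gneg x : cmod (x - p) = r1 -> creal (G x) <= - (eta * r1 ^+ 2).
  move=> xp.
  have xa : cmod (x - a) <= r.
    have -> : x - a = (x - p) + (p - a) by ring.
    by apply: le_trans (cmodD _ _) _; lra.
  have := pmax x xa; rewrite /v -xp /G.
  have [A ->] : exists A, u x = A + u p by exists (u x - u p); rewrite subrK.
  have -> : x - a = (x - p) + (p - a) by ring.
  rewrite addrK; move: (u p) (x - p) (p - a) => B D E.
  rewrite !cmod_sqr !crealD !cimagD !crealM !cimagM !creal_ofr !cimag_ofr.
  rewrite !creal_conj !cimag_conj.
  move: (creal A) (cimag A) (creal B) (cimag B) (creal D) (cimag D) (creal E) (cimag E).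
  by move=> a1 a2 b1 b2 d1 d2 e1 e2; nra.
have er : 0 < eta * r1 ^+ 2 by rewrite mulr_gt0 // exprn_gt0.
have er2 : 0 < eta * r1 ^+ 2 / 2 by rewrite divr_gt0.
have := mean_value r10 Gc _ er2.
case=> [x /andP[x0 xr1]|N _ HN]; first by apply/dG/dP; rewrite x0 (le_lt_trans xr1).
have := HN N (leqnn N); rewrite /= Gp subr0 => B1.
have B2 : creal (avg N (fun s => G (p + cexp s)) (ofr (ln r1)) period) <= - (eta * r1 ^+ 2).
  apply: avg_creal_le => x _; apply: Gneg.
  by rewrite addrC addKr cmod_cexp creal_vertical lnK.
have := creal_le (avg N (fun s => G (p + cexp s)) (ofr (ln r1)) period).
by rewrite ler_norml => /andP[]; lra.
Qed.

End MeanValue.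

(** * Rado-type uniqueness and Schwarz estimates in one variable *)

Section OneVariable.
Context {R : realType}.
Local Notation C := (Cplx R).

Lemma differentiable_near (V W : normedModType C) (f g : V -> W) x :
  (\forall y \near x, f y = g y) -> differentiable f x -> differentiable g x.
Proof.
move=> fg df; have fgx := nbhs_singleton fg.
have [k k0 kP] := linear_lipschitz (diff_continuous df).
have kr : k = ofr (creal k) by apply: creal_ge0; exact: ltW.
have [] // := @rnorm_differentiable _ _ _ g x ('d f x) (creal k).
  by move=> h; rewrite -le_ofr ofrM -!rnormE -kr.
move=> e /(differentiable_rnorm df)[d d0 dP].
move/near_rnormP: fg => [d' d'0 d'P].
exists (Num.min d d'); first by rewrite lt_min d0.
move=> h; rewrite lt_min => /andP[hd hd'].
by rewrite -fgx -d'P; [exact: dP|rewrite addrC addKr].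
Qed.

Lemma differentiable_pow (V : normedModType C) (f : V -> C) k x :
  differentiable f x -> differentiable (fun y => f y ^+ k) x.
Proof.
move=> df; elim: k => [|k IH].
  have -> : (fun y => f y ^+ 0) = cst 1 by apply/funext => y; rewrite expr0.
  exact: differentiable_cst.
have -> : (fun y => f y ^+ k.+1) = (fun y => f y * f y ^+ k).
  by apply/funext => y; rewrite exprS.
exact: differentiableM.
Qed.

Lemma continuous_near (V W : normedModType C) (f g : V -> W) x :
  (\forall y \near x, f y = g y) -> {for x, continuous f} -> {for x, continuous g}.
Proof.
move=> fg; rewrite /prop_for /continuous_at -(nbhs_singleton fg).
by move=> fx; apply: cvg_trans fx; exact: near_eq_cvg.
Qed.

Lemma near_cmod (x : C) (d : R) : 0 < d -> \forall y \near x, cmod (y - x) < d.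
Proof. by move=> d0; apply/near_rnormP; exists d => // y; rewrite rnormC. Qed.

Lemma near_cmod_open (a x : C) (d : R) : cmod (x - a) < d ->
  \forall y \near x, cmod (y - a) < d.
Proof.
rewrite -subr_gt0 => /(near_cmod x); apply: filterS => y yx.
have -> : y - a = (y - x) + (x - a) by ring.
by apply: le_lt_trans (cmodD _ _) _; lra.
Qed.

Lemma near_neq (a x : C) : x != a -> \forall y \near x, y != a.
Proof.
rewrite -subr_eq0 -cmod_gt0 => /(near_cmod x); apply: filterS => y.
by apply: contraTneq => ->; rewrite cmodB ltxx.
Qed.

Lemma cmod_disc_bound (u : C -> C) (a : C) (r : R) :
  (forall t, cmod (t - a) <= r -> {for t, continuous u}) ->
  exists2 B : R, 0 < B & forall t, cmod (t - a) <= r -> cmod (u t) <= B.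
Proof.
move=> uc; have [r0|r0] := ltP r 0.
  exists 1 => // t /le_lt_trans/(_ r0); by rewrite ltNge cmod_ge0.
have [p _ pmax] : exists2 p, p \in [set x : C | cmod (x - a) <= r] &
    forall x, x \in [set x : C | cmod (x - a) <= r] -> cmod (u x) <= cmod (u p).
  apply: compact_EVT_max.
  - by exists a; rewrite /= subrr cmod0.
  - exact: compact_disc.
  - apply: continuous_in_subspaceT => x; rewrite inE => /uc/continuous_rnormP H.
    apply/continuous_realP => e /H[d d0 dP]; exists d => // y /dP; rewrite rnormC => h.
    rewrite ltr_norml; have := cmodD (u x - u y) (u y); have := cmodD (u y - u x) (u x).
    by rewrite !subrK [cmod (u x - u y)]cmodB => *; lra.
exists (cmod (u p) + 1) => [|t tr]; first by rewrite ltr_wpDl ?cmod_ge0.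
by apply: le_trans (pmax t _) _; rewrite ?inE ?lerDl.
Qed.

(** After division by [a ^+ k] the constants [c] and [B] cannot survive the limit if [M < a]. *)
Lemma pow_bound (a M c B : R) : 0 <= M -> 0 < c ->
  (forall k, a ^+ k * c <= M ^+ k * B) -> a <= M.
Proof.
move=> M0 c0 H; rewrite leNgt; apply/negP => Ma.
have a0 : 0 < a by exact: le_lt_trans Ma.
have q : (fun k => (M / a) ^+ k * B) @ \oo --> (0 * B : R).
  apply: cvgM; last exact: cvg_cst.
  by apply: cvg_expr; rewrite ger0_norm ?ltr_pdivrMr ?mul1r // divr_ge0 // ltW.
move/cvgrPdist_lt: q => /(_ c c0)[N _ HN].
have := HN N (leqnn N); rewrite mul0r sub0r normrN; apply/negP; rewrite -leNgt.
apply: le_trans (ler_norm _).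
by rewrite expr_div_n mulrAC ler_pdivlMr ?exprn_gt0 // mulrC.
Qed.

(** The maximum principle for [s ^+ k * j], followed by [k]-th roots, removes [j] from the estimate.
    Continuity is asked of the products, so [s] may be singular where [j] vanishes. *)
Lemma rado_bound (s j : C -> C) (a : C) (r M : R) : 0 < r -> 0 <= M ->
  (forall k t, cmod (t - a) <= r -> {for t, continuous (fun t => s t ^+ k * j t)}) ->
  (forall p, cmod (p - a) < r -> j p != 0 -> exists2 d : R, 0 < d &
     forall t, 0 < cmod (t - p) < d -> differentiable s t /\ differentiable j t) ->
  (forall t, cmod (t - a) = r -> cmod (s t) <= M) ->
  forall t, cmod (t - a) <= r -> j t != 0 -> cmod (s t) <= M.
Proof.
move=> r0 M0 sjc dsj sM t tr jt.
have jc x : cmod (x - a) <= r -> {for x, continuous j}.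
  have E : (fun t => s t ^+ 0 * j t) = j by apply/funext => y; rewrite expr0 mul1r.
  by move=> /(sjc 0%N); rewrite E.
have [B B0 jB] := cmod_disc_bound jc.
apply: (@pow_bound _ _ (cmod (j t)) B) => // [|k]; first by rewrite cmod_gt0.
rewrite -cmodX -cmodM.
apply: (max_modulus r0 (sjc k) _ _ tr) => [p pr|x xr].
  rewrite mulf_eq0 negb_or => /andP[_ /(dsj p pr)[d d0 dP]].
  exists d => // x /dP[ds dj]; apply: differentiableM; last exact: dj.
  exact: differentiable_pow.
rewrite cmodM cmodX ler_pM ?exprn_ge0 ?cmod_ge0 //; last by apply: jB; rewrite xr.
by rewrite lerXn2r ?nnegrE ?cmod_ge0 // sM.
Qed.

(** Take [s t = (t - a)^-1] in [rado_bound]: its pole sits inside the set where [j] is 0. At a point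
    with [j t != 0] the bound reads [cmod (t - a) >= r]. *)
Lemma vanish_propagates (j : C -> C) (a : C) (r d0 : R) : 0 < r -> 0 < d0 ->
  (forall t, cmod (t - a) <= r -> {for t, continuous j}) ->
  (forall p, cmod (p - a) < r -> j p != 0 -> exists2 d : R, 0 < d &
     forall t, 0 < cmod (t - p) < d -> differentiable j t) ->
  (forall t, cmod (t - a) < d0 -> j t = 0) ->
  forall t, cmod (t - a) < r -> j t = 0.
Proof.
move=> r0 d00 jc dj j0 t tr; apply: contrapT => /eqP jt.
have ta : t != a by apply: contraNneq jt => ->; rewrite j0 // subrr cmod0.
have jneq p : j p != 0 -> p != a.
  by apply: contraNneq => ->; rewrite j0 // subrr cmod0.
have ta0 : 0 < cmod (t - a) by rewrite cmod_gt0 subr_eq0.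
have ds x : x != a -> differentiable (fun t : C => (t - a)^-1) x.
  move=> xa; apply: differentiableV; last by rewrite subr_eq0.
  by apply: differentiableB => //; exact: differentiable_cst.
have : cmod (t - a)^-1 <= r^-1.
  apply: (@rado_bound (fun t => (t - a)^-1) j a r r^-1 r0 _ _ _ _ t (ltW tr) jt).
  - by rewrite invr_ge0 ltW.
  - move=> k x xr; have [->|xa] := eqVneq x a.
      apply: (@continuous_near _ _ (fun=> 0)); last exact: cst_continuous.
      by apply: filterS (near_cmod a d00) => y /j0 ->; rewrite mulr0.
    apply: continuousM; last exact: jc.
    apply: differentiable_continuous.
    by apply: differentiable_pow; exact: ds.
  - move=> p pr jp; have [d dgt0 dP] := dj p pr jp.
    have pa : 0 < cmod (p - a) by rewrite cmod_gt0 subr_eq0 jneq.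
    exists (Num.min d (cmod (p - a))); first by rewrite lt_min dgt0.
    move=> x /andP[xp]; rewrite lt_min => /andP[xd xpa].
    split; last by apply: dP; rewrite xp.
    by apply: ds; apply: contraTneq xpa => ->; rewrite cmodB ltxx.
  - by move=> x xr; rewrite cmodV xr.
by rewrite cmodV lef_pV2 ?posrE // leNgt tr.
Qed.

(** The value [l] at [a] stands for the derivative, which makes the quotient continuous there; the
    maximum principle then tolerates the point [a]. *)
Definition slope (u : C -> C) (a l t : C) : C :=
  if t == a then l else (u t - u a) / (t - a).

Definition has_cderiv (u : C -> C) (a l : C) :=
  forall e : R, 0 < e -> exists2 d : R, 0 < d &
     forall h, cmod h < d -> cmod (u (a + h) - u a - l * h) <= e * cmod h.

Lemma slope_continuous (u : C -> C) (a l : C) :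
  has_cderiv u a l -> {for a, continuous (slope u a l)}.
Proof.
move=> H; apply/continuous_rnormP => e e0.
have e2 : 0 < e / 2 by rewrite divr_gt0.
have [d d0 dP] := H _ e2; exists d => // y; rewrite !rnormC => yd.
rewrite /slope eqxx; case: eqVneq => [_|ya]; first by rewrite subrr cmod0.
have ya0 : 0 < cmod (y - a) by rewrite cmod_gt0 subr_eq0.
have := dP _ yd; rewrite [a + _]addrC subrK.
have -> : u y - u a - l * (y - a) = ((u y - u a) / (y - a) - l) * (y - a).
  by field; rewrite subr_eq0.
by rewrite cmodM ler_pM2r // => h; apply: le_lt_trans h _; lra.
Qed.

Lemma slope_differentiable (u : C -> C) (a l t : C) :
  t != a -> differentiable u t -> differentiable (slope u a l) t.
Proof.
move=> ta du; apply: (@differentiable_near _ _ (fun t => (u t - u a) * (t - a)^-1)).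
  by apply: filterS (near_neq ta) => y ya; rewrite /slope (negbTE ya).
apply: differentiableM.
  by apply: differentiableB => //; exact: differentiable_cst.
apply: differentiableV; last by rewrite subr_eq0.
by apply: differentiableB => //; exact: differentiable_cst.
Qed.

Lemma slopeE (u : C -> C) (a l t : C) : u t - u a = slope u a l t * (t - a).
Proof.
rewrite /slope; case: eqVneq => [->|ta]; first by rewrite !subrr mulr0.
by rewrite divfK // subr_eq0.
Qed.

Lemma slope_bound (u : C -> C) (a l : C) (r M : R) : 0 < r ->
  has_cderiv u a l ->
  (forall t, cmod (t - a) <= r -> differentiable u t) ->
  (forall t, cmod (t - a) = r -> cmod (u t - u a) <= M) ->
  forall t, cmod (t - a) <= r -> cmod (slope u a l t) <= M / r.
Proof.
move=> r0 ul du uM.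
have sc t : cmod (t - a) <= r -> {for t, continuous (slope u a l)}.
  move=> tr; have [->|ta] := eqVneq t a; first exact: slope_continuous.
  by apply/differentiable_continuous/slope_differentiable => //; exact: du.
apply: max_modulus => // [p pr _|t tr].
  have [d d0 dP] : exists2 d : R, 0 < d & forall t, cmod (t - p) < d -> cmod (t - a) < r.
    by have /near_rnormP[d d0 dP] := near_cmod_open pr; exists d.
  have [->|pa] := eqVneq p a.
    exists r => // t /andP[ta tr]; apply: slope_differentiable; last exact/du/ltW.
    by move: ta; rewrite cmod_gt0 subr_eq0.
  exists (Num.min d (cmod (p - a))); first by rewrite lt_min d0 cmod_gt0 subr_eq0.
  move=> t /andP[_]; rewrite lt_min => /andP[/dP/ltW/du dut tpa].
  by apply: slope_differentiable => //; apply: contraTneq tpa => ->; rewrite cmodB ltxx.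
have ta : t != a.
  by apply: contra_eq_neq tr => ->; rewrite subrr cmod0 lt_eqF.
rewrite /slope (negbTE ta) cmodM cmodV tr.
by apply: ler_wpM2r; [rewrite invr_ge0 ltW|exact: uM].
Qed.

(** [slope_bound] works on closed discs, so it is applied on all radii [r' < r]; a violation of the
    bound would contradict it for [r'] close to [r]. *)
Lemma schwarz_bound (u : C -> C) (a : C) (r M : R) : 0 < r ->
  (forall t, cmod (t - a) < r -> differentiable u t) ->
  (forall t, cmod (t - a) < r -> cmod (u t - u a) <= M) ->
  forall t, cmod (t - a) < r -> cmod (u t - u a) <= M / r * cmod (t - a).
Proof.
move=> r0 du uM t tr.
have a0 : cmod (a - a) < r by rewrite subrr cmod0.
have [l lP] := differentiable_cderiv (du a a0).
have M0 : 0 <= M by apply: le_trans (uM a a0); rewrite cmod_ge0.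
have H (r' : R) : cmod (t - a) <= r' -> 0 < r' < r -> cmod (u t - u a) * r' <= M * cmod (t - a).
  move=> tr' /andP[r'0 r'r]; rewrite (slopeE u a l) cmodM mulrAC ler_wpM2r ?cmod_ge0 //.
  rewrite -ler_pdivlMr //; apply: slope_bound tr' => // x xr.
    by apply: du; exact: le_lt_trans r'r.
  by apply: uM; rewrite xr.
rewrite mulrAC ler_pdivlMr // leNgt; apply/negP => lt1.
have c0 : 0 < cmod (u t - u a).
  rewrite lt_neqAle cmod_ge0 andbT; apply: contraTneq lt1 => <-.
  by rewrite mul0r -leNgt mulr_ge0 // cmod_ge0.
have x1 : M * cmod (t - a) / cmod (u t - u a) < r by rewrite ltr_pdivrMr // [r * _]mulrC.
have x0 : 0 <= M * cmod (t - a) / cmod (u t - u a).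
  by rewrite divr_ge0 ?mulr_ge0 ?cmod_ge0.
have [x xP] : exists x, [/\ cmod (t - a) <= x, 0 < x < r & M * cmod (t - a) / cmod (u t - u a) < x].
  exists ((Num.max (cmod (t - a)) (M * cmod (t - a) / cmod (u t - u a)) + r) / 2).
  have m1 : Num.max (cmod (t - a)) (M * cmod (t - a) / cmod (u t - u a)) < r by rewrite gt_max tr.
  have m2 : cmod (t - a) <= Num.max (cmod (t - a)) (M * cmod (t - a) / cmod (u t - u a)).
    by rewrite le_max lexx.
  have m3 : M * cmod (t - a) / cmod (u t - u a) <= Num.max (cmod (t - a)) (M * cmod (t - a) / cmod (u t - u a)).
    by rewrite le_max lexx orbT.
  have := cmod_ge0 (t - a); split; [|apply/andP; split|]; lra.
case: xP => h1 h2; rewrite ltr_pdivrMr // => h3.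
by have := H x h1 h2; rewrite mulrC leNgt h3.
Qed.

(** The remainder equals [psi a * (t - a) ^+ 2], where [psi] is the slope at [t] of the slope of [u]
    at [a]; the maximum principle bounds [psi]. *)
Lemma quadratic_bound (u : C -> C) (a l : C) (r M : R) : 0 < r ->
  has_cderiv u a l ->
  (forall t, cmod (t - a) < r -> differentiable u t) ->
  (forall t, cmod (t - a) < r -> cmod (u t) <= M) ->
  forall t, cmod (t - a) <= r / 2 ->
    cmod (u t - u a - l * (t - a)) <= 64 * M / r ^+ 2 * cmod (t - a) ^+ 2.
Proof.
move=> r0 ul du uM t tr.
have a0 : cmod (a - a) < r by rewrite subrr cmod0.
have M0 : 0 <= M by apply: le_trans (uM a a0); rewrite cmod_ge0.
have [->|ta] := eqVneq t a; first by rewrite !subrr mulr0 subrr cmod0 expr0n /= mulr0.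
(* The circle of radius [r'] stays inside the domain and at distance at least [r / 4] from [t], so
   the divided difference [psi] is controlled on it. *)
pose r' := 3 / 4 * r.
have r'0 : 0 < r' by rewrite /r'; lra.
have r'r : r' < r by rewrite /r'; lra.
pose phi := slope u a l.
have phiB x : cmod (x - a) <= r' -> cmod (phi x) <= 2 * M / r'.
  apply: slope_bound => // y yr; first exact/du/(le_lt_trans yr).
  apply: le_trans (cmodD _ _) _; rewrite cmodN.
  have := uM a a0; have := uM y; rewrite yr => /(_ r'r); lra.
have dphi x : x != a -> cmod (x - a) < r -> differentiable phi x.
  by move=> xa xr; apply: slope_differentiable => //; exact: du.
have tr2 : cmod (t - a) < r by lra.
have [lt ltP] := differentiable_cderiv (dphi t ta tr2).
pose psi := slope phi t lt.
have phic x : cmod (x - a) < r -> {for x, continuous phi}.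
  move=> xr; have [->|xa] := eqVneq x a; first exact: slope_continuous.
  by apply/differentiable_continuous/dphi.
have psic x : cmod (x - a) <= r' -> {for x, continuous psi}.
  move=> xr; have [->|xt] := eqVneq x t; first exact: slope_continuous.
  apply: (@continuous_near _ _ (fun y => (phi y - phi t) * (y - t)^-1)).
    by apply: filterS (near_neq xt) => y ya; rewrite /psi [RHS]/slope (negbTE ya).
  apply: continuousM.
    by apply: continuousB; [apply: phic; lra|exact: cst_continuous].
  apply/differentiable_continuous/differentiableV; last by rewrite subr_eq0.
  by apply: differentiableB => //; exact: differentiable_cst.
have dpsi x : x != a -> x != t -> cmod (x - a) < r -> differentiable psi x.
  by move=> xa xt xr; apply: slope_differentiable => //; exact: dphi.
have B : cmod (psi a) <= 16 * (2 * M / r') / r.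
  apply: (@max_modulus _ psi a r') => // [p pr _|x xr|]; last by rewrite subrr cmod0 ltW.
    have : \forall y \near p, cmod (y - a) < r.
      by apply: near_cmod_open; lra.
    have N b : \forall y \near p, y != p -> y != b.
      have [->|/near_neq] := eqVneq p b; first by apply: (@filterE _ (nbhs b)).
      by apply: filterS.
    move=> /filterI/(_ (N a))/filterI/(_ (N t))/near_rnormP[d d0 dP].
    exists d => // x /andP[]; rewrite cmod_gt0 subr_eq0 => xp xd.
    have [[/= h1 h2] h3] := dP x xd.
    by apply: dpsi; [exact: h2|exact: h3|].
  have xt0 : r / 4 <= cmod (x - t).
    have := cmodD (x - t) (t - a); rewrite addrA subrK xr /r'; lra.
  have xt : x != t.
    by apply: contraTneq xt0 => ->; rewrite subrr cmod0 -ltNge; lra.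
  rewrite /psi /slope (negbTE xt) cmodM cmodV.
  have b1 : cmod (phi x - phi t) <= 4 * (2 * M / r').
    apply: le_trans (cmodD _ _) _; rewrite cmodN.
    have p1 : cmod (phi x) <= 2 * M / r' by apply: phiB; rewrite xr.
    have p2 : cmod (phi t) <= 2 * M / r' by apply: phiB; rewrite /r'; lra.
    have := cmod_ge0 (phi x); lra.
  have xt1 : 0 < cmod (x - t) by lra.
  rewrite ler_pdivrMr //; apply: le_trans b1 _.
  have -> : 4 * (2 * M / r') = 16 * (2 * M / r') / r * (r / 4).
    by field; rewrite !gt_eqF.
  by rewrite ler_wpM2l // divr_ge0 ?(ltW r0) // mulr_ge0 // divr_ge0 ?(ltW r'0) // mulr_ge0.
have -> : u t - u a - l * (t - a) = psi a * (t - a) ^+ 2 * (1 : C).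
  rewrite (slopeE u a l) -/phi.
  have -> : l = phi a by rewrite /phi /slope eqxx.
  have := slopeE phi t lt a; rewrite -/psi => E.
  have -> : phi t = phi a - psi a * (a - t) by rewrite -E; ring.
  by ring.
rewrite mulr1 cmodM cmodX; apply: ler_wpM2r; first by rewrite exprn_ge0 ?cmod_ge0.
apply: le_trans B _; rewrite /r'.
have -> : 16 * (2 * M / (3 / 4 * r)) / r = 128 / 3 * (M / r ^+ 2).
  by field; rewrite gt_eqF.
have : 0 <= M / r ^+ 2 by rewrite divr_ge0 // exprn_ge0 // ltW.
rewrite -mulrA; lra.
Qed.

End OneVariable.

(** * Holomorphic functions of several variables *)

Section SeveralVariables.
Context {R : realType}.
Local Notation C := (Cplx R).

Lemma has_cderiv_bound (u : C -> C) (a l : C) (K d : R) : 0 < d ->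
  has_cderiv u a l ->
  (forall h, cmod h < d -> cmod (u (a + h) - u a) <= K * cmod h) -> cmod l <= K.
Proof.
move=> d0 ul uK; apply/ler_addgt0Pr => e e0.
have [d' d'0 dP] := ul e e0.
pose m := Num.min d d' / 2.
have m0 : 0 < m by rewrite divr_gt0 // lt_min d0.
have mm : m < Num.min d d' by rewrite /m ltr_pdivrMr // ltr_pMr ?ltr1n // lt_min d0.
have cm : cmod (ofr m) = m by rewrite cmod_ofr gtr0_norm.
move: mm; rewrite -{1}cm lt_min => /andP[/uK h1].
rewrite -{1}cm => /dP h2; rewrite cm in h1 h2.
have : cmod (l * ofr m) <= (K + e) * m.
  have -> : l * ofr m = (u (a + ofr m) - u a) - (u (a + ofr m) - u a - l * ofr m) by ring.
  by rewrite cm in h2; apply: le_trans (cmodD _ _) _; rewrite cmodN mulrDl lerD.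
by rewrite cmodM cm ler_pM2r.
Qed.

Section Line.
Context {V : normedModType C}.

Lemma differentiable_line (p v : V) (t : C) : differentiable (fun t : C => p + t *: v) t.
Proof.
apply: differentiableD; first exact: differentiable_cst.
exact/differentiableZl.
Qed.

Lemma differentiable_along (f : V -> C) (p v : V) (t : C) :
  differentiable f (p + t *: v) -> differentiable (fun t : C => f (p + t *: v)) t.
Proof. by move=> df; apply: (differentiable_comp (differentiable_line p v t)). Qed.

Lemma has_cderiv_line (f : V -> C) (p v : V) :
  differentiable f p -> has_cderiv (fun t : C => f (p + t *: v)) 0 ('d f p v).
Proof.
move=> df e e0.
have k0 : 0 < rnorm v + 1 by rewrite ltr_wpDl ?rnorm_ge0.
have [d d0 dP] := differentiable_rnorm df (divr_gt0 e0 k0).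
exists (d / (rnorm v + 1)) => [|h]; first by rewrite divr_gt0.
rewrite ltr_pdivlMr // => hd; rewrite add0r scale0r addr0.
have hv : rnorm (h *: v) <= cmod h * (rnorm v + 1).
  by rewrite rnormZ ler_wpM2l ?cmod_ge0 // lerDl.
have := dP _ (le_lt_trans hv hd); have E : 'd f p (h *: v) = 'd f p v * h by rewrite linearZ [RHS]mulrC.
rewrite rnormC E => /le_trans; apply; rewrite mulrAC ler_pdivrMr // -mulrA ler_wpM2l //; exact: ltW.
Qed.

(** [schwarz_bound] on the complex line through [p] and [y], parametrised so that [y] is at
    parameter 1. *)
Lemma slice_bound (f : V -> C) (p y : V) (r M : R) : 0 < r ->
  (forall x, rnorm (x - p) < r -> differentiable f x) ->
  (forall x, rnorm (x - p) < r -> cmod (f x - f p) <= M) ->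
  rnorm (y - p) < r -> cmod (f y - f p) <= M / r * rnorm (y - p).
Proof.
move=> r0 df fM yp; have [->|yp0] := eqVneq y p.
  by rewrite !subrr cmod0 rnorm0 mulr0.
pose v := y - p; have v0 : 0 < rnorm v by rewrite rnorm_gt0 subr_eq0.
have inb (t : C) : cmod (t - 0) < r / rnorm v -> rnorm (p + t *: v - p) < r.
  by rewrite subr0 ltr_pdivlMr // addrC addKr rnormZ.
have := @schwarz_bound _ (fun t => f (p + t *: v)) 0 (r / rnorm v) M (divr_gt0 r0 v0) _ _ 1.
rewrite scale0r addr0 scale1r subr0 cmod1 mulr1.
have -> : p + v = y by rewrite /v addrC subrK.
have -> : M / (r / rnorm v) = M / r * rnorm v by field; rewrite !gt_eqF.
apply.
- by move=> t /inb/df; exact: differentiable_along.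
- by move=> t /inb/fM.
- by rewrite ltr_pdivlMr // mul1r.
Qed.

Lemma quadratic_slice (f : V -> C) (p y : V) (r M : R) : 0 < r ->
  (forall x, rnorm (x - p) < r -> differentiable f x) ->
  (forall x, rnorm (x - p) < r -> cmod (f x) <= M) ->
  rnorm (y - p) <= r / 2 ->
  cmod (f y - f p - 'd f p (y - p)) <= 64 * M / r ^+ 2 * rnorm (y - p) ^+ 2.
Proof.
move=> r0 df fM yp; have [->|yp0] := eqVneq y p.
  by rewrite !subrr linear0 subrr cmod0 rnorm0 expr0n /= mulr0.
pose v := y - p; have v0 : 0 < rnorm v by rewrite rnorm_gt0 subr_eq0.
have inb (t : C) : cmod (t - 0) < r / rnorm v -> rnorm (p + t *: v - p) < r.
  by rewrite subr0 ltr_pdivlMr // addrC addKr rnormZ.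
have dfp : differentiable f p by apply: df; rewrite subrr rnorm0.
have := @quadratic_bound _ (fun t => f (p + t *: v)) 0 _ (r / rnorm v) M
  (divr_gt0 r0 v0) (has_cderiv_line v dfp) _ _ 1.
rewrite scale0r addr0 scale1r subr0 mulr1 cmod1 expr1n mulr1.
have -> : p + v = y by rewrite /v addrC subrK.
have -> : 64 * M / (r / rnorm v) ^+ 2 = 64 * M / r ^+ 2 * rnorm v ^+ 2.
  by field; rewrite !gt_eqF.
apply.
- by move=> t /inb/df; exact: differentiable_along.
- by move=> t /inb/fM.
- by rewrite mulrAC ler_pdivlMr // mul1r.
Qed.

Lemma diff_bound (f : V -> C) (p v : V) (r M : R) : 0 < r ->
  (forall x, rnorm (x - p) < r -> differentiable f x) ->
  (forall x, rnorm (x - p) < r -> cmod (f x - f p) <= M) ->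
  cmod ('d f p v) <= M / r * rnorm v.
Proof.
move=> r0 df fM.
have dfp : differentiable f p by apply: df; rewrite subrr rnorm0.
have k0 : 0 < rnorm v + 1 by rewrite ltr_wpDl ?rnorm_ge0.
apply: (has_cderiv_bound (divr_gt0 r0 k0) (has_cderiv_line v dfp)) => h.
rewrite add0r scale0r addr0 ltr_pdivlMr // => hr.
have hv : rnorm (p + h *: v - p) < r.
  rewrite addrC addKr rnormZ; apply: le_lt_trans hr.
  by rewrite ler_wpM2l ?cmod_ge0 // lerDl.
apply: le_trans (slice_bound r0 df fM hv) _.
by rewrite addrC addKr rnormZ mulrCA mulrC.
Qed.

Lemma ultra_cmod_cvg (u : nat -> C) (M : R) :
  (forall k, cmod (u k) <= M) -> exists l : C, u @ nat_ultra --> l.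
Proof.
move=> uM; have [|l _ ul] := ultra_compact_cvg (@compact_disc R 0 M) (u := u).
  by move=> k; rewrite /= subr0.
by exists l.
Qed.

Lemma ultra_cmod_le (u : nat -> C) (l : C) (M : R) :
  u @ nat_ultra --> l -> (forall k, cmod (u k) <= M) -> cmod l <= M.
Proof.
move=> /cvg_rnormP ul uM; apply/ler_addgt0Pr => e /ul /filter_ex[k].
rewrite rnormC cmodB => h; have := cmodD (l - u k) (u k); rewrite subrK.
have := uM k; lra.
Qed.

(* The uniform quadratic Taylor bound survives in the limit. *)
Lemma limit_differentiable (F : nat -> V -> C) (f : V -> C) (p : V) (r M : R) : 0 < r ->
  (forall k x, rnorm (x - p) < r -> differentiable (F k) x) ->
  (forall k x, rnorm (x - p) < r -> cmod (F k x) <= M) ->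
  (forall x, rnorm (x - p) < r -> F ^~ x @ nat_ultra --> f x) ->
  differentiable f p.
Proof.
move=> r0 dF FM Ff.
have M0 : 0 <= M.
  by apply: le_trans (FM 0%N p _); rewrite ?cmod_ge0 // subrr rnorm0.
have pp : rnorm (p - p) < r by rewrite subrr rnorm0.
have db k h : cmod ('d (F k) p h) <= 2 * M / r * rnorm h.
  apply: diff_bound => // [x|x xr]; first exact: dF.
  apply: le_trans (cmodD _ _) _; rewrite cmodN.
  by have := FM k x xr; have := FM k p pp; lra.
have [L LP] : exists L : V -> C, forall h, (fun k => 'd (F k) p h) @ nat_ultra --> L h.
  suff /choice[L LP] : forall h, exists l : C, (fun k => 'd (F k) p h) @ nat_ultra --> l.
    by exists L.
  by move=> h; apply: (ultra_cmod_cvg (M := 2 * M / r * rnorm h)) => k; exact: db.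
have linL : linear L.
  move=> a x y; apply: (norm_cvg_unique (LP (a *: x + y))).
  have -> : (fun k => 'd (F k) p (a *: x + y)) = (fun k => a *: 'd (F k) p x + 'd (F k) p y).
    by apply/funext => k; rewrite linearP.
  by apply: cvgD (LP y); apply: cvgZr; exact: LP.
have [] // := @rnorm_differentiable _ _ _ f p (packlin linL) (2 * M / r).
  by move=> h; rewrite rnormC; apply: ultra_cmod_le (LP h) _ => k; exact: db.
move=> e e0.
pose K := 64 * M / r ^+ 2.
have K0 : 0 <= K by apply: divr_ge0; [exact: mulr_ge0|exact: sqr_ge0].
have K1 : 0 < K + 1 by rewrite ltr_wpDl.
exists (Num.min (r / 2) (e / (K + 1))); first by rewrite lt_min !divr_gt0.
move=> h; rewrite lt_min => /andP[hr he].
have E : p + h - p = h by rewrite addrC addKr.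
have hr' : rnorm (p + h - p) < r by rewrite E; lra.
have Q : cmod (f (p + h) - f p - L h) <= K * rnorm h ^+ 2.
  apply: (@ultra_cmod_le (fun k => F k (p + h) - F k p - 'd (F k) p h)) => [|k].
    by apply: cvgB; [apply: cvgB; [exact: Ff|exact: Ff]|exact: LP].
  have := @quadratic_slice (F k) p (p + h) r M r0 (dF k) (FM k).
  by rewrite E; apply; exact: ltW.
rewrite rnormC; apply: le_trans Q _.
have h0 := rnorm_ge0 h.
rewrite ltr_pdivlMr // in he; rewrite expr2 mulrA ler_wpM2r //.
nra.
Qed.

Lemma differentiable_bounded (f : V -> C) (p : V) : differentiable f p ->
  exists2 r : R, 0 < r & forall x, rnorm (x - p) < r -> cmod (f x) <= cmod (f p) + 1.
Proof.
move=> /differentiable_continuous/continuous_rnormP/(_ 1 ltr01)[d d0 dP].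
exists d => // x /dP; rewrite rnormC => h.
by have := cmodD (f x - f p) (f p); rewrite subrK; lra.
Qed.

(** A directional derivative is the limit of difference quotients, which are holomorphic and, by
    [slice_bound], bounded uniformly in the step; [limit_differentiable] concludes. *)
Lemma differentiable_diff (f : V -> C) (p v : V) :
  (\forall x \near p, differentiable f x) -> differentiable (fun x => 'd f x v) p.
Proof.
move=> df; have [r0 r00 fM] := differentiable_bounded (nbhs_singleton df).
move/near_rnormP: df => [r1 r10 df].
pose r := Num.min r0 r1; have rgt0 : 0 < r by rewrite lt_min r00.
pose M := cmod (f p) + 1.
have dfr x : rnorm (x - p) < r -> differentiable f x.
  by rewrite lt_min => /andP[_]; exact: df.
have fMr x : rnorm (x - p) < r -> cmod (f x) <= M.
  by rewrite lt_min => /andP[/fM].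
(* Steps tending to 0 and small enough that every shift by [t k] times [v] has norm at most [r / 4];
   the [+ 1] covers [v = 0]. *)
pose t k : R := (r / 4) / (rnorm v + 1) / k.+1%:R.
have v1 : 0 < rnorm v + 1 by rewrite ltr_wpDl ?rnorm_ge0.
have t0 k : 0 < t k by rewrite !divr_gt0.
have tv k : t k * rnorm v <= r / 4.
  have : t k * (rnorm v + 1) <= r / 4.
    rewrite /t mulrAC divfK ?gt_eqF // ler_pdivrMr ?ltr0n // ler_peMr ?ler1n //.
    by rewrite divr_ge0 // ltW.
  by apply: le_trans; apply: ler_wpM2l; [exact: ltW|rewrite lerDl].
have tnv k : rnorm (ofr (t k) *: v) <= r / 4.
  by rewrite rnormZ cmod_ofr gtr0_norm.
pose F k x := (f (x + ofr (t k) *: v) - f x) / ofr (t k).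
have sh x k : rnorm (x - p) < r / 2 -> rnorm (x + ofr (t k) *: v - p) < r.
  move=> xr; rewrite addrAC; apply: le_lt_trans (rnormD _ _) _; have := tnv k; lra.
have w x : rnorm (x - p) < r / 2 -> rnorm (x - p) < r by lra.
apply: (@limit_differentiable F _ p (r / 2) (2 * M / (r / 2) * rnorm v)).
- by rewrite divr_gt0.
- move=> k x xr; apply: differentiableM; last exact: differentiable_cst.
  apply: differentiableB; last exact/dfr/w.
  apply: (@differentiable_comp _ _ _ _ (fun x => x + ofr (t k) *: v) f).
    by apply: differentiableD; [exact: ex_diff|exact: differentiable_cst].
  by apply: dfr; exact: sh.
- move=> k x xr; rewrite cmodM cmodV cmod_ofr gtr0_norm // ler_pdivrMr //.
  have := @slice_bound f x (x + ofr (t k) *: v) (r / 2) (2 * M).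
  rewrite addrC addKr rnormZ cmod_ofr gtr0_norm // => H.
  rewrite -[_ * rnorm v * _]mulrA (mulrC (rnorm v)); apply: H.
  + by rewrite divr_gt0.
  + move=> y yx; apply: dfr.
    have -> : y - p = (y - x) + (x - p) by rewrite addrA subrK.
    by apply: le_lt_trans (rnormD _ _) _; lra.
  + move=> y yx; apply: le_trans (cmodD _ _) _; rewrite cmodN.
    have h1 : cmod (f y) <= M.
      apply: fMr; have -> : y - p = (y - x) + (x - p) by rewrite addrA subrK.
      by apply: le_lt_trans (rnormD _ _) _; lra.
    by have h2 := fMr x (w x xr); lra.
  + by have := tv k; lra.
- move=> x xr; apply: nat_ultra_cvg; apply/cvg_rnormP => e e0.
  have e2 : 0 < e / 2 by rewrite divr_gt0.
  have [d d0 dP] := has_cderiv_line v (dfr x (w x xr)) e2.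
  have [N HN] : exists N : nat, r / 4 / (rnorm v + 1) / d < N%:R.
    exists (Num.bound (r / 4 / (rnorm v + 1) / d)); apply: archi_boundP.
    by rewrite !divr_ge0 // ltW.
  exists N => // k /= Nk.
  have tk : t k < d.
    rewrite /t ltr_pdivrMr ?ltr0n // [d * _]mulrC -ltr_pdivrMr //.
    by apply: lt_le_trans HN _; rewrite ler_nat ltnW.
  have := dP (ofr (t k)); rewrite cmod_ofr gtr0_norm // => /(_ tk).
  rewrite add0r scale0r addr0 rnormC /F => H.
  have tn : ofr (t k) != 0 by rewrite ofr_eq0 gt_eqF.
  have -> : (f (x + ofr (t k) *: v) - f x) / ofr (t k) - 'd f x v =
     (f (x + ofr (t k) *: v) - f x - 'd f x v * ofr (t k)) / ofr (t k) by field.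
  rewrite cmodM cmodV cmod_ofr gtr0_norm // ltr_pdivrMr //.
  by apply: le_lt_trans H _; rewrite ltr_pM2r //; lra.
Qed.

End Line.

Lemma differentiable_bigsum (V : normedModType C) (I : Type) (s : seq I) (F : I -> V -> C) x :
  (forall i, differentiable (F i) x) -> differentiable (fun y => \sum_(i <- s) F i y) x.
Proof.
move=> dF; elim: s => [|i s IH].
  have -> : (fun y => \sum_(i <- [::]) F i y) = cst 0 by apply/funext => y; rewrite big_nil.
  exact: differentiable_cst.
have -> : (fun y => \sum_(j <- i :: s) F j y) = (fun y => F i y + \sum_(j <- s) F j y).
  by apply/funext => y; rewrite big_cons.
exact: differentiableD.
Qed.

Lemma differentiable_bigprod (V : normedModType C) (I : Type) (s : seq I) (F : I -> V -> C) x :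
  (forall i, differentiable (F i) x) -> differentiable (fun y => \prod_(i <- s) F i y) x.
Proof.
move=> dF; elim: s => [|i s IH].
  have -> : (fun y => \prod_(i <- [::]) F i y) = cst 1 by apply/funext => y; rewrite big_nil.
  exact: differentiable_cst.
have -> : (fun y => \prod_(j <- i :: s) F j y) = (fun y => F i y * \prod_(j <- s) F j y).
  by apply/funext => y; rewrite big_cons.
exact: differentiableM.
Qed.

Lemma differentiable_det (V : normedModType C) n (A : V -> 'M[C]_n) x :
  (forall i j, differentiable (fun y => A y i j) x) ->
  differentiable (fun y => \det (A y)) x.
Proof.
move=> dA; rewrite /determinant; apply: differentiable_bigsum => s.
apply: differentiableM; first exact: differentiable_cst.
exact: differentiable_bigprod.
Qed.

(** * Jacobian matrices *)

Section Jacobian.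
Context {m n : nat}.
Implicit Types (f : 'rV[C]_m -> 'rV[C]_n) (x h : 'rV[C]_m).

(** Vectors are rows multiplied on the right, so this is the transpose of the usual Jacobian
    matrix. *)
Definition jac f x : 'M[C]_(m, n) :=
  \matrix_(i, j) 'd (fun y => f y 0 j) x (delta_mx 0 i).

Lemma mul_jac f x h j : (h *m jac f x) 0 j = 'd (fun y => f y 0 j) x h.
Proof.
rewrite mxE [in RHS](row_sum_delta h) linear_sum; apply: eq_bigr => i _.
by rewrite mxE linearZ.
Qed.

Lemma jacP f x : differentiable f x -> forall e : R, 0 < e ->
  exists2 d : R, 0 < d & forall h, rnorm h < d ->
    rnorm (f (x + h) - f x - h *m jac f x) <= e * rnorm h.
Proof.
move=> df e e0.
have H j : exists d : R, 0 < d /\ forall h, rnorm h < d ->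
    cmod (f (x + h) 0 j - f x 0 j - 'd (fun y => f y 0 j) x h) <= e * rnorm h.
  have [d d0 dP] := differentiable_rnorm (differentiable_coordP 0 j df) e0.
  by exists d; split=> // h /dP; rewrite rnormC.
have /choice[d dP] := H.
exists (\big[Num.min/1]_j d j).
  by apply: lt_bigmin => // j _; have [] := dP j.
move=> h hd; apply: rnorm_le => [|i j]; first by rewrite mulr_ge0 ?rnorm_ge0 // ltW.
rewrite ord1.
have -> : (f (x + h) - f x - h *m jac f x) 0 j =
          f (x + h) 0 j - f x 0 j - 'd (fun y => f y 0 j) x h.
  by rewrite -mul_jac !mxE.
have [_] := dP j; apply; apply: lt_le_trans hd _; exact: bigmin_le.
Qed.

Lemma differentiable_jac f x i j :
  (\forall y \near x, differentiable f y) -> differentiable (fun y => jac f y i j) x.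
Proof.
move=> df; have -> : (fun y => jac f y i j) = (fun y => 'd (fun z => f z 0 j) y (delta_mx 0 i)).
  by apply/funext => y; rewrite mxE.
apply: differentiable_diff; apply: filterS df => y; exact: differentiable_coordP.
Qed.

Lemma has_jac_differentiable f x (A : 'M[C]_(m, n)) :
  (forall e : R, 0 < e -> exists2 d : R, 0 < d & forall h, rnorm h < d ->
    rnorm (f (x + h) - f x - h *m A) <= e * rnorm h) -> differentiable f x.
Proof.
move=> H; have [k k0 kP] := rnorm_mulmx 1 A.
by have [] := @rnorm_differentiable _ _ _ f x (packlin (@mulmxr_is_linear _ 1 m n A)) k kP H.
Qed.

Lemma lipschitz_bound f (p y : 'rV[C]_m) (r M : R) : 0 < r ->
  (forall x, rnorm (x - p) < r -> differentiable f x) ->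
  (forall x, rnorm (x - p) < r -> rnorm (f x - f p) <= M) ->
  rnorm (y - p) < r -> rnorm (f y - f p) <= M / r * rnorm (y - p).
Proof.
move=> r0 df fM yp.
have M0 : 0 <= M.
  by apply: le_trans (fM p _); rewrite ?rnorm_ge0 // subrr rnorm0.
apply: rnorm_le => [|i j]; first by rewrite mulr_ge0 ?rnorm_ge0 // divr_ge0 // ltW.
rewrite ord1 !mxE; apply: (@slice_bound _ (fun y => f y 0 j) p y r M r0) => // x xr.
  by apply: differentiable_coordP; exact: df.
by apply: le_trans (fM x xr); have := cmod_coord (f x - f p) 0 j; rewrite !mxE.
Qed.

End Jacobian.

End SeveralVariables.

(** * Inverse function theorem *)

Section InverseFunction.
Context {R : realType}.
Local Notation C := (Cplx R).

Lemma diff_jac m n (f : 'rV[C]_m -> 'rV[C]_n) x h :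
  differentiable f x -> 'd f x h = h *m jac f x.
Proof.
move=> df; have [k k0 kP] := rnorm_mulmx 1 (jac f x).
have [_ ->] // := @rnorm_differentiable _ _ _ f x (packlin (@mulmxr_is_linear _ 1 m n (jac f x))) k kP (jacP df).
Qed.

Lemma jac_unique m n (f : 'rV[C]_m -> 'rV[C]_n) x (A : 'M[C]_(m, n)) :
  (forall e : R, 0 < e -> exists2 d : R, 0 < d & forall h, rnorm h < d ->
    rnorm (f (x + h) - f x - h *m A) <= e * rnorm h) ->
  forall h, 'd f x h = h *m A.
Proof.
move=> H h; have [k k0 kP] := rnorm_mulmx 1 A.
by have [_ ->] := @rnorm_differentiable _ _ _ f x (packlin (@mulmxr_is_linear _ 1 m n A)) k kP H.
Qed.

Lemma singular_vector n (A : 'M[C]_n) :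
  A \notin unitmx -> exists2 v : 'rV[C]_n, v != 0 & v *m A = 0.
Proof. by rewrite unitmxE unitfE negbK => /det0P. Qed.

(** The Lipschitz bound at [y] turns the expansion of [f] at [g y] into
    [h = (g (y + h) - g y) *m A + o(h)]. This already forces [A] to be invertible: if
    [A *m v^T = 0], then [h *m v^T = o(h)], which fails along a coordinate where [v] is nonzero. *)
Lemma inverse_differentiable n (f g : 'rV[C]_n -> 'rV[C]_n) (y : 'rV[C]_n) (L d0 : R) :
  0 < d0 -> differentiable f (g y) ->
  (forall y', rnorm (y' - y) < d0 ->
     f (g y') = y' /\ rnorm (g y' - g y) <= L * rnorm (y' - y)) ->
  [/\ jac f (g y) \in unitmx, differentiable g y &
      forall h, 'd g y h = h *m invmx (jac f (g y))].
Proof.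
move=> d00 df H; set A := jac f (g y).
have fgy : f (g y) = y by have [] := H y; rewrite ?subrr ?rnorm0.
have L1 : 0 < `|L| + 1 by rewrite ltr_wpDl.
have err (e : R) : 0 < e -> exists2 d : R, 0 < d & forall h, rnorm h < d ->
    rnorm (h - (g (y + h) - g y) *m A) <= e * rnorm h.
  move=> e0; have [d1 d10 d1P] := jacP df (divr_gt0 e0 L1).
  exists (Num.min d0 (d1 / (`|L| + 1))); first by rewrite lt_min d00 divr_gt0.
  move=> h; rewrite lt_min => /andP[hd0 hd1].
  have [|fg gL] := H (y + h); first by rewrite addrC addKr.
  rewrite [y + h - y]addrC addKr in gL.
  have gL' : rnorm (g (y + h) - g y) <= (`|L| + 1) * rnorm h.
    apply: le_trans gL _; rewrite ler_wpM2r ?rnorm_ge0 //.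
    by apply: le_trans (ler_norm L) _; rewrite lerDl.
  have := d1P (g (y + h) - g y).
  rewrite [g y + _]addrC subrK fg fgy [y + h - y]addrC addKr => K.
  apply: le_trans (K _) _; first by apply: le_lt_trans gL' _; rewrite mulrC -ltr_pdivlMr.
  by rewrite mulrAC ler_pdivrMr // -mulrA ler_wpM2l ?(ltW e0) // mulrC.
have uA : A \in unitmx.
  apply: contrapT => /negP; rewrite -unitmx_tr => /singular_vector[v v0 vA].
  have [i vi] : exists i, v 0 i != 0.
    apply: contrapT => N; case/eqP: v0; apply/rowP => i; rewrite mxE.
    by apply: contrapT => /eqP vi; apply: N; exists i.
  have Av : A *m v^T = 0 by rewrite -[A]trmxK -trmx_mul vA trmx0.
  have [k k0 kP] := rnorm_mulmx 1 v^T.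
  have vi0 : 0 < cmod (v 0 i) by rewrite cmod_gt0.
  have e0 : 0 < cmod (v 0 i) / (2 * k) by rewrite divr_gt0 // mulr_gt0.
  have [d dd0 dP] := err _ e0.
  pose E : 'rV[C]_n := delta_mx 0 i.
  have nE : rnorm E <= 1.
    apply: rnorm_le => // a b; rewrite mxE; case: (_ && _); rewrite ?cmod1 ?cmod0 //.
  pose h := ofr (d / 2) *: E.
  have d2 : 0 < d / 2 by rewrite divr_gt0.
  have hd2 : rnorm h <= d / 2.
    by rewrite rnormZ cmod_ofr gtr0_norm // ler_piMr // ltW.
  have hd : rnorm h < d by lra.
  have := kP (h - (g (y + h) - g y) *m A).
  rewrite mulmxBl -mulmxA Av mulmx0 subr0 => K1.
  have K2 := cmod_coord (h *m v^T) 0 0.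
  have E2 : (h *m v^T) 0 0 = ofr (d / 2) * v 0 i.
    by rewrite -scalemxAl mxE -rowE !mxE.
  rewrite E2 cmodM cmod_ofr gtr0_norm // in K2.
  have K3 := ler_wpM2l (ltW k0) (dP h hd).
  have K4 : k * (cmod (v 0 i) / (2 * k) * rnorm h) <= k * (cmod (v 0 i) / (2 * k) * (d / 2)).
    by rewrite (ler_wpM2l (ltW k0)) // (ler_wpM2l (ltW e0)).
  have K5 : k * (cmod (v 0 i) / (2 * k) * (d / 2)) = d / 2 * cmod (v 0 i) / 2.
    by field; rewrite gt_eqF.
  have : 0 < d / 2 * cmod (v 0 i) by rewrite mulr_gt0.
  lra.
suff HJ : forall e : R, 0 < e -> exists2 d : R, 0 < d & forall h, rnorm h < d ->
    rnorm (g (y + h) - g y - h *m invmx A) <= e * rnorm h.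
  by split; [exact: uA|exact: has_jac_differentiable HJ|exact: jac_unique HJ].
move=> e e0.
have [k k0 kP] := rnorm_mulmx 1 (invmx A).
have [d dd0 dP] := err _ (divr_gt0 e0 k0).
exists d => // h /dP K.
have := kP (h - (g (y + h) - g y) *m A); rewrite mulmxBl mulmxK // rnormB => /le_trans; apply.
rewrite -ler_pdivlMl //; apply: le_trans K _.
by rewrite mulrA [_^-1 * e]mulrC.
Qed.

(** Differentiability at [p] controls [f] only relative to [p]. It makes the nonlinear part [phi]
    small on a ball, and the Schwarz estimate [lipschitz_bound] converts smallness into a Lipschitz
    bound between two arbitrary points. *)
Lemma near_injective n (f : 'rV[C]_n -> 'rV[C]_n) (p : 'rV[C]_n) (r : R) : 0 < r ->
  (forall x, rnorm (x - p) < r -> differentiable f x) -> jac f p \in unitmx ->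
  exists d k : R, [/\ 0 < d, d <= r, 0 < k,
    (forall h : 'rV[C]_n, rnorm (h *m invmx (jac f p)) <= k * rnorm h) &
    forall x y, rnorm (x - p) < d -> rnorm (y - p) < d ->
      rnorm (f y - f x - (y - x) *m jac f p) <= (2 * k)^-1 * rnorm (y - x)].
Proof.
move=> r0 df uA; set A := jac f p.
have [k k0 kP] := rnorm_mulmx 1 (invmx A).
have dfp : differentiable f p by apply: df; rewrite subrr rnorm0.
(* Passing through [p] doubles the oscillation [(8 * k)^-1 * d], and division by the radius [d / 2]
   doubles once more: the Lipschitz constant becomes [(2 * k)^-1]. *)
have e0 : 0 < (8 * k)^-1 by rewrite invr_gt0 mulr_gt0.
have [d1 d10 d1P] := jacP dfp e0.
pose d := Num.min r d1; have dgt0 : 0 < d by rewrite lt_min r0.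
have dr : d <= r by rewrite /d ge_min lexx.
exists (d / 4), k; split=> //; [by rewrite divr_gt0|lra|].
move=> x y xp yp.
pose phi z := f z - z *m A.
have phip z : rnorm (z - p) < d -> rnorm (phi z - phi p) <= (8 * k)^-1 * d.
  rewrite lt_min => /andP[zr zd1].
  have := d1P _ zd1; rewrite [p + _]addrC subrK mulmxBl -/A.
  have -> : f z - f p - (z *m A - p *m A) = phi z - phi p.
    by apply/rowP => l; rewrite !mxE; ring.
  move=> /le_trans; apply; rewrite ler_wpM2l ?(ltW e0) // /d le_min.
  by rewrite (ltW zr) (ltW zd1).
have -> : f y - f x - (y - x) *m A = phi y - phi x.
  by rewrite mulmxBl /phi; apply/rowP => l; rewrite !mxE; ring.
have S z : rnorm (z - x) < d / 2 -> rnorm (z - p) < d.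
  move=> zx; have -> : z - p = (z - x) + (x - p) by rewrite addrA subrK.
  by apply: le_lt_trans (rnormD _ _) _; lra.
have d20 : 0 < d / 2 by rewrite divr_gt0.
have yx : rnorm (y - x) < d / 2.
  have -> : y - x = (y - p) + (p - x) by rewrite addrA subrK.
  apply: le_lt_trans (rnormD _ _) _; rewrite [rnorm (p - x)]rnormB; lra.
apply: le_trans (@lipschitz_bound _ _ _ phi x y (d / 2) (2 * ((8 * k)^-1 * d)) d20 _ _ yx) _.
- move=> z /S zd; apply: differentiableB; last exact: differentiable_mulmx.
  by apply: df; exact: lt_le_trans dr.
- move=> z /S zd.
  have -> : phi z - phi x = (phi z - phi p) + (phi p - phi x) by rewrite addrA subrK.
  have xd : rnorm (x - p) < d by apply: lt_trans xp _; lra.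
  apply: le_trans (rnormD _ _) _; rewrite [X in _ + X]rnormB mulr_natl mulr2n.
  exact: lerD (phip z zd) (phip x xd).
- rewrite le_eqVlt; apply/orP; left; apply/eqP; congr (_ * _).
  by field; rewrite !gt_eqF.
Qed.

(** Surjectivity by minimising [rnorm (f x - y)] on a compact polydisc: a Newton step from a minimum
    with nonzero value would decrease it. *)
Lemma inverse_function n (f : 'rV[C]_n -> 'rV[C]_n) (p : 'rV[C]_n) (r : R) : 0 < r ->
  (forall x, rnorm (x - p) < r -> differentiable f x) -> jac f p \in unitmx ->
  exists (d : R) (g : 'rV[C]_n -> 'rV[C]_n), 0 < d /\
    forall y, rnorm (y - f p) < d ->
      [/\ rnorm (g y - p) < r, f (g y) = y, differentiable g y, jac f (g y) \in unitmx &
          forall h, 'd g y h = h *m invmx (jac f (g y))].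
Proof.
move=> r0 df uA; have [d [k [d0 dr k0 kP H]]] := near_injective r0 df uA.
set A := jac f p in uA kP H.
have c0 : 0 < (2 * k)^-1 by rewrite invr_gt0 mulr_gt0.
have low x y : rnorm (x - p) < d -> rnorm (y - p) < d ->
    (2 * k)^-1 * rnorm (y - x) <= rnorm (f y - f x).
  move=> xp yp; have h1 := H x y xp yp.
  have h2 : rnorm (y - x) <= k * rnorm ((y - x) *m A).
    by have := kP ((y - x) *m A); rewrite mulmxK.
  have h3 : rnorm ((y - x) *m A) <= rnorm (f y - f x) + (2 * k)^-1 * rnorm (y - x).
    have -> : (y - x) *m A = (f y - f x) - (f y - f x - (y - x) *m A) by rewrite subKr.
    by apply: le_trans (rnormD _ _) _; rewrite rnormN lerD2l.
  have h4 : k^-1 * rnorm (y - x) <= rnorm ((y - x) *m A) by rewrite ler_pdivrMl.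
  have h5 : k^-1 * rnorm (y - x) = (2 * k)^-1 * rnorm (y - x) + (2 * k)^-1 * rnorm (y - x).
    by field; rewrite gt_eqF.
  lra.
pose r2 := d / 2; have r20 : 0 < r2 by rewrite divr_gt0.
have r2d : r2 < d by rewrite /r2; lra.
pose del := (2 * k)^-1 * r2 / 2; have del0 : 0 < del by rewrite divr_gt0 // mulr_gt0.
have surj y : rnorm (y - f p) < del -> exists2 x, rnorm (x - p) < r2 & f x = y.
  move=> yp.
  have [x xN xmin] : exists2 x, x \in [set x | rnorm (x - p) <= r2] &
      forall t, t \in [set x | rnorm (x - p) <= r2] -> rnorm (f x - y) <= rnorm (f t - y).
    apply: compact_EVT_min.
    - by exists p; rewrite /= subrr rnorm0 ltW.
    - by apply: compact_polydisc; exact: ltW.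
    - apply: continuous_in_subspaceT => x; rewrite inE /= => xr2.
      apply/continuous_realP => e e0.
      have /differentiable_continuous/continuous_rnormP/(_ e e0)[d' d'0 d'P] : differentiable f x.
        by apply: df; lra.
      exists d' => // z /d'P fz; apply: le_lt_trans fz.
      rewrite ler_norml; have := rnormD (f z - f x) (f x - y); have := rnormD (f x - f z) (f z - y).
      by rewrite !addrA !subrK [rnorm (f x - f z)]rnormB => *; lra.
  rewrite inE /= in xN.
  have {}xmin t : rnorm (t - p) <= r2 -> rnorm (f x - y) <= rnorm (f t - y).
    by move=> tN; apply: xmin; rewrite inE.
  have xlt : rnorm (x - p) < r2.
    (* On the boundary [f] is at least [2 * del] away from [f p], hence farther from [y] than [f p]
       is. *)
    rewrite lt_neqAle xN andbT; apply/eqP => xr2.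
    have pd : rnorm (p - p) < d by rewrite subrr rnorm0.
    have xd : rnorm (x - p) < d by rewrite xr2.
    have := low p x pd xd; rewrite xr2.
    have := xmin p; rewrite subrr rnorm0 => /(_ (ltW r20)).
    have := rnormD (f x - y) (y - f p); rewrite addrA subrK [rnorm (f p - y)]rnormB.
    rewrite /del in yp; lra.
  exists x => //; apply: contrapT => /eqP fxy.
  pose N := rnorm (f x - y); have N0 : 0 < N by rewrite rnorm_gt0 subr_eq0.
  pose w := (y - f x) *m invmx A.
  have wN : rnorm w <= k * N by rewrite /w /N rnormB; exact: kP.
  (* The Newton step [w] is shortened so as to stay in the polydisc. It removes the fraction [t] of
     the error [N] and adds at most [t * N / 2]. *)
  pose t := Num.min 1 ((r2 - rnorm (x - p)) / (k * N)).
  have t0 : 0 < t by rewrite lt_min ltr01 divr_gt0 ?subr_gt0 ?mulr_gt0.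
  have t1 : t <= 1 by rewrite /t ge_min lexx.
  have tw : rnorm (ofr t *: w) <= t * (k * N).
    by rewrite rnormZ cmod_ofr gtr0_norm // ler_wpM2l // ltW.
  have tkN : t * (k * N) <= r2 - rnorm (x - p).
    by rewrite -ler_pdivlMr ?mulr_gt0 // /t ge_min lexx orbT.
  have xt : rnorm (x + ofr t *: w - p) <= r2.
    by rewrite addrAC; apply: le_trans (rnormD _ _) _; lra.
  have xd : rnorm (x - p) < d by exact: le_lt_trans xN r2d.
  have xtd : rnorm (x + ofr t *: w - p) < d by exact: le_lt_trans xt r2d.
  have := H x (x + ofr t *: w) xd xtd; rewrite [x + _ - x]addrC addKr => E.
  have E2 : (ofr t *: w) *m A = ofr t *: (y - f x) by rewrite -scalemxAl /w mulmxKV.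
  have := xmin _ xt; rewrite -/N.
  have -> : f (x + ofr t *: w) - y = ofr (1 - t) *: (f x - y) +
      (f (x + ofr t *: w) - f x - (ofr t *: w) *m A).
    rewrite E2 ofrB ofr1 scalerBl scale1r -[y - f x]opprB scalerN opprK.
    by apply/rowP => l; rewrite !mxE; ring.
  move=> N1; have := rnormD (ofr (1 - t) *: (f x - y)) (f (x + ofr t *: w) - f x - (ofr t *: w) *m A).
  rewrite rnormZ cmod_ofr ger0_norm ?subr_ge0 // -/N => N2.
  have N3 : (2 * k)^-1 * rnorm (ofr t *: w) <= (2 * k)^-1 * (t * (k * N)).
    by rewrite ler_wpM2l // ltW.
  have N4 : (2 * k)^-1 * (t * (k * N)) = t * N / 2 by field; rewrite gt_eqF.
  have N5 : N <= (1 - t) * N + t * N / 2.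
    apply: le_trans N1 _; apply: le_trans N2 _; rewrite lerD2l -N4.
    exact: le_trans E N3.
  have : 0 < t * N by rewrite mulr_gt0.
  by clear - N5; lra.
have [g gP] : exists g : 'rV[C]_n -> 'rV[C]_n, forall y, rnorm (y - f p) < del ->
    rnorm (g y - p) < r2 /\ f (g y) = y.
  suff /choice[g gP] : forall y, exists x, rnorm (y - f p) < del -> rnorm (x - p) < r2 /\ f x = y.
    by exists g.
  move=> y; have [/surj[x h1 h2]|h] := ltP (rnorm (y - f p)) del; first by exists x.
  by exists 0.
exists del, g; split; first exact: del0.
move=> y yd; have [gyp fgy] := gP y yd.
have gyd := lt_trans gyp r2d.
have gyr := lt_le_trans gyd dr.
have dfg : differentiable f (g y) by exact: df.
have dy0 : 0 < del - rnorm (y - f p) by rewrite subr_gt0.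
have near_y y' : rnorm (y' - y) < del - rnorm (y - f p) ->
    f (g y') = y' /\ rnorm (g y' - g y) <= 2 * k * rnorm (y' - y).
  move=> y'y.
  have y'd : rnorm (y' - f p) < del.
    have -> : y' - f p = (y' - y) + (y - f p) by rewrite addrA subrK.
    by apply: le_lt_trans (rnormD _ _) _; rewrite -ltrBrDr.
  have [gy'p fgy'] := gP y' y'd; split; first exact: fgy'.
  have := low _ _ gyd (lt_trans gy'p r2d).
  by rewrite fgy fgy' ler_pdivrMl // mulr_gt0.
have [uJ dg Dg] := inverse_differentiable dy0 dfg near_y.
by split; [exact: gyr|exact: fgy|exact: dg|exact: uJ|exact: Dg].
Qed.

(** With zero differential the increment is quadratic in the distance. Cutting the segment in two
    replaces one square by two quarters of it, so each bisection halves the bound. *)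
Lemma diff_eq0_constant (V : normedModType C) (f : V -> C) (p : V) (r : R) : 0 < r ->
  (forall x, rnorm (x - p) < r -> differentiable f x) ->
  (forall x v, rnorm (x - p) < r -> 'd f x v = 0) ->
  exists2 d : R, 0 < d & forall x y, rnorm (x - p) < d -> rnorm (y - p) < d -> f x = f y.
Proof.
move=> r0 df df0; have pp : rnorm (p - p) < r by rewrite subrr rnorm0.
have [r1 r10 fM] := differentiable_bounded (df p pp).
pose M := cmod (f p) + 1; pose r2 := Num.min r r1.
have r20 : 0 < r2 by rewrite lt_min r0.
exists (r2 / 8) => [|x y xp yp]; first by rewrite divr_gt0.
pose K := 64 * M / (r2 / 2) ^+ 2.
have K0 : 0 <= K.
  by apply: divr_ge0; [rewrite mulr_ge0 // addr_ge0 ?cmod_ge0|exact: sqr_ge0].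
have Q k a b : rnorm (a - p) < r2 / 8 -> rnorm (b - p) < r2 / 8 ->
    cmod (f b - f a) <= K * 2^-1 ^+ k * rnorm (b - a) ^+ 2.
  elim: k a b => [|k IH] a b ap bp.
    have ba : rnorm (b - a) <= r2 / 2 / 2.
      have -> : b - a = (b - p) + (p - a) by rewrite addrA subrK.
      by apply: le_trans (rnormD _ _) _; rewrite [rnorm (p - a)]rnormB; lra.
    have S z : rnorm (z - a) < r2 / 2 -> rnorm (z - p) < r2.
      move=> za; have -> : z - p = (z - a) + (a - p) by rewrite addrA subrK.
      by apply: le_lt_trans (rnormD _ _) _; lra.
    have r22 : 0 < r2 / 2 by rewrite divr_gt0.
    have := @quadratic_slice _ _ f a b (r2 / 2) M r22 _ _ ba.
    rewrite df0 ?subr0 ?expr0 ?mulr1; first apply.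
    + by move=> z /S; rewrite lt_min => /andP[/df].
    + by move=> z /S; rewrite lt_min => /andP[_ /fM].
    + have : r2 <= r by rewrite /r2 ge_min lexx.
      lra.
  have half2 (z : V) : z = (2^-1 : C) *: z + (2^-1 : C) *: z.
    have E : 2^-1 + 2^-1 = 1 :> C by field.
    by rewrite -scalerDl E scale1r.
  pose c := a + (2^-1 : C) *: (b - a).
  have ca : c - a = (2^-1 : C) *: (b - a) by rewrite /c addrC addKr.
  have bc : b - c = (2^-1 : C) *: (b - a).
    have -> : b - c = (b - a) - (c - a) by rewrite opprB addrA subrK.
    by rewrite ca {1}(half2 (b - a)) addrK.
  have half : cmod (2^-1 : C) = 2^-1 by rewrite -[2]ofr_nat -ofrV cmod_ofr ger0_norm.
  have cp : rnorm (c - p) < r2 / 8.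
    have -> : c - p = (2^-1 : C) *: (a - p) + (2^-1 : C) *: (b - p).
      have E : c - p = (a - p) + (2^-1 : C) *: ((b - p) - (a - p)).
        by rewrite /c opprB [b - p + _]addrA subrK addrAC.
      rewrite E scalerBr; move: (a - p) (b - p) => A B.
      by rewrite {1}(half2 A) [_ *: B - _]addrC addrA addrK.
    by apply: le_lt_trans (rnormD _ _) _; rewrite !rnormZ half; lra.
  have -> : f b - f a = (f b - f c) + (f c - f a) by rewrite addrA subrK.
  apply: le_trans (cmodD _ _) _.
  apply: le_trans (lerD (IH c b cp bp) (IH a c ap cp)) _.
  rewrite ca bc !rnormZ half (exprS 2^-1 k) le_eqVlt; apply/orP; left; apply/eqP.
  by move: (2^-1 ^+ k) (rnorm (b - a)) => q N; field.
have H e : 0 < e -> cmod (f y - f x) <= e.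
  move=> e0; pose N := K * rnorm (y - x) ^+ 2 + 1.
  have N0 : 0 < N by rewrite ltr_wpDl // mulr_ge0 // sqr_ge0.
  have [k kP] := half_pow_small (divr_gt0 e0 N0).
  apply: le_trans (Q k x y xp yp) _.
  rewrite ltr_pdivlMr // in kP; apply: le_trans (ltW kP).
  rewrite mulrAC mulrC ler_wpM2l ?exprn_ge0 // /N lerDl //.
apply/esym/eqP; rewrite -subr_eq0 -cmod_eq0 eq_le cmod_ge0 andbT.
by apply/ler_addgt0Pr => e /H; rewrite add0r.
Qed.

End InverseFunction.

(** * Regular points of injective holomorphic maps *)

Section InjectiveHolomorphic.
Context {R : realType}.
Local Notation C := (Cplx R).

Lemma diff_linear (V W : normedModType C) (f : V -> W) (lf : linear f) (k : R) :
  (forall h, rnorm (f h) <= k * rnorm h) ->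
  forall (a : W) x, differentiable (fun y => a + f y) x /\
    forall h, 'd (fun y => a + f y) x h = f h.
Proof.
move=> fk a x; have [] // := @rnorm_differentiable _ _ _ (fun y => a + f y) x (packlin lf) k fk.
  move=> e e0; exists 1 => // h _.
  have -> : a + f (x + h) - (a + f x) - f h = 0.
    have -> : f (x + h) = f x + f h by rewrite -[x](scale1r x) lf !scale1r.
    by rewrite addrA [a + f x + f h - _]addrAC subrr add0r subrr.
  by rewrite rnorm0 mulr_ge0 ?rnorm_ge0 // ltW.
by move=> df dE; split=> // h; rewrite dE.
Qed.

Lemma diff_coord_id n (x v : 'rV[C]_n) l :
  differentiable (fun y : 'rV[C]_n => y 0 l) x /\ 'd (fun y : 'rV[C]_n => y 0 l) x v = v 0 l.
Proof.
have lin : linear (fun y : 'rV[C]_n => y 0 l : C) by move=> a u w; rewrite !mxE.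
have [|d D] := diff_linear lin (k := 1) _ 0 x.
  by move=> h; rewrite mul1r rnormC cmod_coord.
have E : (fun y : 'rV[C]_n => 0 + y 0 l) = (fun y => y 0 l).
  by apply/funext => y; rewrite add0r.
by split; [move: d|move: (D v)]; rewrite E.
Qed.

(* By induction on the source dimension: where some partial derivative of a component does
   not vanish, restrict to a level hypersurface of that component. *)
Lemma injective_regular_point n : forall m (f : 'rV[C]_n -> 'rV[C]_m) (p : 'rV[C]_n) (r : R),
  0 < r -> (forall x, rnorm (x - p) < r -> differentiable f x) ->
  (forall x y, rnorm (x - p) < r -> rnorm (y - p) < r -> f x = f y -> x = y) ->
  exists q, rnorm (q - p) < r /\ forall v : 'rV[C]_n, v *m jac f q = 0 -> v = 0.
Proof.
elim: n => [|n IH] m f p r r0 df inj.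
  by exists p; rewrite subrr rnorm0; split=> // v _; apply/rowP => -[].
have [[q0 [i [j [q0p a0]]]]|none] :=
  pselect (exists q i j, rnorm (q - p) < r /\ jac f q i j != 0); last first.
  (* If all partial derivatives vanish near [p], then [f] is locally constant, against injectivity
     in positive dimension. *)
  exfalso.
  have Z x v j : rnorm (x - p) < r -> 'd (fun y => f y 0 j) x v = 0.
    move=> xr; rewrite -mul_jac mxE big1 // => i _.
    have [->|a0] := eqVneq (jac f x i j) 0; first by rewrite mulr0.
    by exfalso; apply: none; exists x, i, j.
  have H j : exists d : R, 0 < d /\
      forall x y, rnorm (x - p) < d -> rnorm (y - p) < d -> f x 0 j = f y 0 j.
    have [|x v xr|d d0 dP] := @diff_eq0_constant _ _ (fun y => f y 0 j) p r r0.
    - by move=> x xr; apply: differentiable_coordP; exact: df.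
    - exact: Z.
    - by exists d.
  have /choice[d dP] := H.
  pose d' := \big[Num.min/r]_j d j.
  have d'0 : 0 < d' by apply: lt_bigmin => // j _; have [] := dP j.
  have d'r : d' <= r by exact: bigmin_le_id.
  pose E : 'rV[C]_n.+1 := delta_mx 0 0.
  have nE : rnorm E <= 1.
    by apply: rnorm_le => // a b; rewrite mxE; case: (_ && _); rewrite ?cmod1 ?cmod0.
  pose y := p + ofr (d' / 2) *: E.
  have yp : rnorm (y - p) < d'.
    rewrite /y addrC addKr rnormZ cmod_ofr gtr0_norm ?divr_gt0 //.
    apply: (@le_lt_trans _ _ (d' / 2)); last lra.
    by rewrite ler_piMr // ltW // divr_gt0.
  have pp : rnorm (p - p) < d' by rewrite subrr rnorm0.
  have : y = p.
    apply: inj; [exact: lt_le_trans d'r|exact: lt_le_trans d'r|].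
    apply/rowP => j; have [_ dPj] := dP j; apply: dPj.
      by apply: lt_le_trans yp _; exact: bigmin_le.
    by apply: lt_le_trans pp _; exact: bigmin_le.
  move/rowP/(_ 0); rewrite !mxE eqxx mulr1 => /eqP.
  by rewrite -subr_eq0 [_ - p 0 0]addrC addKr ofr_eq0 gt_eqF // divr_gt0.
pose r1 := r - rnorm (q0 - p); have r10 : 0 < r1 by rewrite subr_gt0.
have sub x : rnorm (x - q0) < r1 -> rnorm (x - p) < r.
  move=> xq; have -> : x - p = (x - q0) + (q0 - p) by rewrite addrA subrK.
  by apply: le_lt_trans (rnormD _ _) _; rewrite -ltrBrDr.
(* A local chart in which component [j] of [f] replaces coordinate [i]; level sets of that component
   become coordinate hyperplanes. *)
pose Phi (x : 'rV[C]_n.+1) : 'rV[C]_n.+1 := \row_l (if l == i then f x 0 j else x 0 l).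
have Phii x : Phi x 0 i = f x 0 j by rewrite mxE eqxx.
have PhiE l : l != i -> (fun x => Phi x 0 l) = (fun x => x 0 l).
  by move=> li; apply/funext => x; rewrite mxE (negbTE li).
have Phiie : (fun x => Phi x 0 i) = (fun x => f x 0 j) by apply/funext => x.
have dPhi x : rnorm (x - q0) < r1 -> differentiable Phi x.
  move=> xr; apply: differentiable_mx => a l; rewrite ord1.
  have [->|li] := eqVneq l i.
    by rewrite Phiie; apply: differentiable_coordP; apply: df; exact: sub.
  by rewrite PhiE //; have [] := diff_coord_id x 0 l.
have JPhi (x v : 'rV[C]_n.+1) : (v *m jac Phi x) 0 i = (v *m jac f x) 0 j by rewrite !mul_jac Phiie.
have JPhi' (x v : 'rV[C]_n.+1) l : l != i -> (v *m jac Phi x) 0 l = v 0 l.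
  by move=> li; rewrite mul_jac PhiE //; have [] := diff_coord_id x v l.
have uJ : jac Phi q0 \in unitmx.
  apply: contrapT => /negP/singular_vector[v v0 vJ]; case/eqP: v0.
  have vl l : l != i -> v 0 l = 0 by move=> li; rewrite -(JPhi' q0 v l li) vJ mxE.
  apply/rowP => l; rewrite [RHS]mxE; have [->|/vl//] := eqVneq l i.
  have := JPhi q0 v; rewrite vJ [LHS]mxE [RHS]mxE (bigD1 i) //= big1 ?addr0.
    by move=> /esym/eqP; rewrite mulf_eq0 (negbTE a0) orbF => /eqP.
  by move=> k ki; rewrite vl // mul0r.
have [d [g [d0 gP]]] := inverse_function r10 dPhi uJ.
pose ins (v : 'rV[C]_n) : 'rV[C]_n.+1 :=
  \row_l (if unlift i l is Some k then v 0 k else 0).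
have insl v k : ins v 0 (lift i k) = v 0 k by rewrite mxE liftK.
have insi v : ins v 0 i = 0 by rewrite mxE unlift_none.
have lins : linear ins.
  by move=> a u v; apply/rowP => l; rewrite !mxE; case: (unlift i l) => [k|]; rewrite ?mxE ?mulr0 ?addr0.
have ins1 v : rnorm (ins v) <= 1 * rnorm v.
  rewrite mul1r; apply: rnorm_le => [|a l]; first exact: rnorm_ge0.
  by rewrite mxE; case: (unlift i l) => [k|]; rewrite ?cmod0 ?rnorm_ge0 // cmod_coord.
pose y0 := Phi q0.
have inb (v : 'rV[C]_n) : rnorm (v - 0) < d -> rnorm (y0 + ins v - y0) < d.
  by rewrite subr0 addrC addKr => vd; apply: le_lt_trans (ins1 v) _; rewrite mul1r.
(* The restriction of [f] to a level hypersurface of its component [j], with source dimension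
   lowered by one. *)
pose F v := f (g (y0 + ins v)).
have dF v : rnorm (v - 0) < d -> differentiable F v /\
    forall w, 'd F v w = 'd f (g (y0 + ins v)) ('d g (y0 + ins v) (ins w)).
  move=> /inb vd; have [gq _ dg _ _] := gP _ vd.
  have [di Di] := diff_linear lins ins1 y0 v.
  have dfg : differentiable f (g (y0 + ins v)) by apply/df/sub.
  have dgi := differentiable_comp di dg.
  split; first exact: (differentiable_comp dgi dfg).
  move=> w; rewrite (_ : F = f \o (g \o (fun v => y0 + ins v))) //.
  by rewrite (diff_comp dgi dfg) /= (diff_comp di dg) /= Di.
have [v0 [v0d v0P]] : exists q, rnorm (q - 0) < d /\ forall v : 'rV[C]_n, v *m jac F q = 0 -> v = 0.
  apply: IH => // [v /dF[]//|v v' vd vd' E].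
  have [gq gy _ _ _] := gP _ (inb v vd); have [gq' gy' _ _ _] := gP _ (inb v' vd').
  have gg := inj _ _ (sub _ gq) (sub _ gq') E.
  have : y0 + ins v = y0 + ins v' by rewrite -gy -gy' gg.
  by move=> /addrI ii; apply/rowP => k; rewrite -!insl ii.
have [gq gy dg ug Dg] := gP _ (inb v0 v0d).
exists (g (y0 + ins v0)); split; first exact: sub.
set q := g (y0 + ins v0) in gq gy ug Dg *.
(* A vector killed by [jac f q] does not change component [j], so it is tangent to the level set; in
   the chart it is [ins w'], and [w'] is killed by [jac F v0]. *)
move=> x xJ; pose w' : 'rV[C]_n := \row_k x 0 (lift i k).
have wE : x *m jac Phi q = ins w'.
  apply/rowP => l; case: (unliftP i l) => [k ->|->].
    rewrite JPhi'; last by rewrite eq_sym neq_lift.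
    by rewrite (insl w' k) mxE.
  by rewrite JPhi xJ insi mxE.
have w0 : w' = 0.
  apply: v0P; have [dFv DFv] := dF v0 v0d.
  have dfq : differentiable f q by apply/df/sub.
  rewrite -(diff_jac w' dFv) DFv Dg -wE (mulmxK ug); exact: etrans (diff_jac x dfq) xJ.
have : x *m jac Phi q = 0.
  by rewrite wE w0; apply/rowP => l; rewrite !mxE; case: (unlift i l) => [k|]; rewrite ?mxE.
by move=> /(congr1 (mulmx^~ (invmx (jac Phi q)))); rewrite mulmxK // mul0mx.
Qed.

End InjectiveHolomorphic.

(** * Osgood's theorem *)

Section Osgood.
Context {R : realType}.
Local Notation C := (Cplx R).

Lemma rnorm_continuous (V : normedModType C) (a x : V) :
  {for x, continuous (fun y : V => rnorm (y - a))}.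
Proof.
apply/continuous_realP => d d0; exists d => // y; apply: le_lt_trans.
have h1 := rnormD (y - x) (x - a); have h2 := rnormD (x - y) (y - a).
rewrite !addrA !subrK in h1 h2; rewrite [rnorm (x - y)]rnormB in h2.
by rewrite ler_norml; clear - h1 h2; lra.
Qed.

Lemma sphere_gap n (f : 'rV[C]_n -> 'rV[C]_n) (p : 'rV[C]_n) (e : R) : 0 < e ->
  (forall x, rnorm (x - p) = e -> {for x, continuous f}) ->
  (forall x, rnorm (x - p) = e -> f x != f p) ->
  exists2 c : R, 0 < c & forall x, rnorm (x - p) = e -> c <= rnorm (f x - f p).
Proof.
move=> egt0 fc inj.
have [[x0 x0e]|none] := pselect (exists x, rnorm (x - p) = e); last first.
  by exists 1 => // x xe; exfalso; apply: none; exists x.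
have [x xS xmin] : exists2 x, x \in [set x | rnorm (x - p) = e] &
    forall t, t \in [set x | rnorm (x - p) = e] -> rnorm (f x - f p) <= rnorm (f t - f p).
  apply: compact_EVT_min.
  - by exists x0.
  - apply: (subclosed_compact _ (@compact_polydisc R n p e (ltW egt0))).
      have -> : [set x | rnorm (x - p) = e] = (fun x => rnorm (x - p)) @^-1` [set t | t = e] by [].
      by apply: closed_comp => [x _|]; [exact: rnorm_continuous|exact: closed_eq].
    by move=> x /= ->.
  - apply: continuous_in_subspaceT => x; rewrite inE /= => /fc xc.
    apply: (@continuous_comp _ _ _ f (fun y => rnorm (y - f p))); first exact: xc.
    exact: rnorm_continuous.
rewrite inE /= in xS.
exists (rnorm (f x - f p)); last by move=> t te; apply: xmin; rewrite inE.
by rewrite rnorm_gt0 subr_eq0; exact: inj.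
Qed.

(** Compactness: points whose images tend to [y] can accumulate only at preimages of [y]. If [y] has
    no preimage, the conclusion says that the image stays away from [y]. *)
Lemma preimage_close n (f : 'rV[C]_n -> 'rV[C]_n) (p y : 'rV[C]_n) (e eta : R) :
  0 < e -> 0 < eta ->
  (forall x, rnorm (x - p) <= e -> {for x, continuous f}) ->
  exists2 d : R, 0 < d &
  forall x, rnorm (x - p) <= e -> rnorm (f x - y) < d ->
    exists x', [/\ rnorm (x' - p) <= e, f x' = y & rnorm (x - x') < eta].
Proof.
move=> egt0 eta0 fc; apply: contrapT => none.
have H k : exists x, [/\ rnorm (x - p) <= e, rnorm (f x - y) < 2^-1 ^+ k &
    forall x', rnorm (x' - p) <= e -> f x' = y -> eta <= rnorm (x - x')].
  apply: contrapT => N; apply: none; exists (2^-1 ^+ k); first by rewrite exprn_gt0.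
  move=> x xN xy; apply: contrapT => N2; apply: N; exists x; split=> // x' x'N x'y.
  by rewrite leNgt; apply/negP => xx'; apply: N2; exists x'.
have [x xP] := choice H.
have [|l lN xl] := ultra_compact_cvg (@compact_polydisc R n p e (ltW egt0)) (u := x).
  by move=> k; have [] := xP k.
have fl : f l = y.
  have c1 : f (x k) @[k --> nat_ultra] --> f l by apply: continuous_cvg xl; exact: fc.
  have c2 : f (x k) @[k --> nat_ultra] --> y.
    apply: nat_ultra_cvg; apply/cvg_rnormP => d d0.
    have [K KP] := half_pow_small d0; exists K => // k /= Kk.
    have [_ + _] := xP k; move=> /lt_trans; apply; apply: le_lt_trans KP.
    by rewrite ler_wiXn2l // invf_le1 ?ler1n.
  exact: (norm_cvg_unique c1 c2).
have /filter_ex[k] : \forall k \near nat_ultra, rnorm (x k - l) < eta.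
  by move/cvg_rnormP: xl => /(_ eta eta0).
have [_ _ /(_ l lN fl)] := xP k; rewrite leNgt => /negbTE h h'.
by rewrite h' in h.
Qed.

Lemma near_rball (V : normedModType C) (x y : V) (d : R) : rnorm (x - y) < d ->
  \forall z \near x, rnorm (z - y) < d.
Proof.
move=> xy; apply/near_rnormP; exists (d - rnorm (x - y)); first by rewrite subr_gt0.
move=> z zx; have -> : z - y = (z - x) + (x - y) by rewrite addrA subrK.
by apply: le_lt_trans (rnormD _ _) _; rewrite -ltrBrDr.
Qed.

Lemma differentiable_jacdet n (f : 'rV[C]_n -> 'rV[C]_n) (x : 'rV[C]_n) :
  (\forall y \near x, differentiable f y) -> differentiable (fun y => \det (jac f y)) x.
Proof.
by move=> df; apply: differentiable_det => a b; exact: differentiable_jac.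
Qed.

Lemma regular_dense n (f : 'rV[C]_n -> 'rV[C]_n) (p x : 'rV[C]_n) (e eta : R) :
  (forall x, rnorm (x - p) < e -> differentiable f x) ->
  (forall x y, rnorm (x - p) < e -> rnorm (y - p) < e -> f x = f y -> x = y) ->
  rnorm (x - p) < e -> 0 < eta ->
  exists x', [/\ rnorm (x' - x) < eta, rnorm (x' - p) < e & \det (jac f x') != 0].
Proof.
move=> df inj xe eta0; pose r := Num.min eta (e - rnorm (x - p)).
have r0 : 0 < r by rewrite lt_min eta0 subr_gt0.
have sub y : rnorm (y - x) < r -> rnorm (y - p) < e.
  rewrite lt_min => /andP[_ yx]; have -> : y - p = (y - x) + (x - p) by rewrite addrA subrK.
  by apply: le_lt_trans (rnormD _ _) _; rewrite -ltrBrDr.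
have [q [qx qJ]] := @injective_regular_point R n n f x r r0
  (fun y yx => df y (sub y yx)) (fun y z yx zx => inj y z (sub y yx) (sub z zx)).
exists q; split; last 1 first.
- rewrite -unitfE -unitmxE; apply: contrapT => /negP/singular_vector[v v0 /qJ vz].
  by rewrite vz eqxx in v0.
- by move: qx; rewrite lt_min => /andP[].
- exact: sub.
Qed.

(* The Jacobian determinant, transported to the image of a closed ball and extended by 0,
   is continuous, and holomorphic where it does not vanish; hence it vanishes identically
   on discs missing the image, which forces the image to be a neighbourhood.  The same
   function controls the difference quotients of the inverse. *)
Lemma osgood n (f : 'rV[C]_n -> 'rV[C]_n) (p : 'rV[C]_n) (e0 : R) : 0 < e0 ->
  (forall x, rnorm (x - p) < e0 -> differentiable f x) ->
  (forall x y, rnorm (x - p) < e0 -> rnorm (y - p) < e0 -> f x = f y -> x = y) ->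
  exists d L : R, 0 < d /\ forall y, rnorm (y - f p) < d ->
  exists x, [/\ rnorm (x - p) < e0, f x = y & rnorm (x - p) <= L * rnorm (y - f p)].
Proof.
move=> e00 df inj.
(* Half the radius keeps the closed ball inside the region where [f] is holomorphic and
   injective. *)
pose e := e0 / 2; have egt0 : 0 < e by rewrite divr_gt0.
pose inN (x : 'rV[C]_n) := rnorm (x - p) <= e.
have N_e0 x : inN x -> rnorm (x - p) < e0.
  by move=> xN; apply: le_lt_trans xN _; rewrite ltr_pdivrMr // ltr_pMr // ltr1n.
have fc x : rnorm (x - p) < e0 -> {for x, continuous f}.
  by move=> /df /differentiable_continuous.
pose inS y := exists x, inN x /\ f x = y.
pose g y := xget p [set x | inN x /\ f x = y].
have gP y : inS y -> inN (g y) /\ f (g y) = y.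
  by move=> [x xP]; rewrite /g; case: xgetP => [_ _ //|/(_ x)].
have g_eq x : inN x -> g (f x) = x.
  move=> xN; have [gN fg] := gP _ (ex_intro _ x (conj xN erefl)).
  by apply: inj fg; exact: N_e0.
pose J x := \det (jac f x).
pose j y := if pselect (inS y) then J (g y) else 0.
have jS y : inS y -> j y = J (g y) by rewrite /j; case: pselect.
have jnS y : ~ inS y -> j y = 0 by rewrite /j; case: pselect.
have dJ x : rnorm (x - p) < e0 -> differentiable J x.
  by move=> /near_rball xe0; apply: differentiable_jacdet; exact: filterS xe0.
have g_cont y (eta : R) : inS y -> 0 < eta -> exists2 d : R, 0 < d &
    forall y', inS y' -> rnorm (y' - y) < d -> rnorm (g y' - g y) < eta.
  move=> yS eta0; have [d d0 dP] := preimage_close y egt0 eta0 (fun x xN => fc x (N_e0 x xN)).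
  exists d => // y' y'S y'y.
  have [gN' fg'] := gP y' y'S; have [gN fg] := gP y yS.
  have [|x' [x'N fx' xx']] := dP (g y') gN'; first by rewrite fg'.
  by rewrite -[in g y]fx' g_eq.
have S_closed y : ~ inS y -> exists2 d : R, 0 < d &
    forall y', rnorm (y' - y) < d -> ~ inS y'.
  move=> yS; have [d d0 dP] := preimage_close y egt0 ltr01 (fun x xN => fc x (N_e0 x xN)).
  exists d => // y' y'y [x [xN fx]].
  have [|x' [x'N fx' _]] := dP x xN; first by rewrite fx.
  by apply: yS; exists x'.
have S_open y : inS y -> rnorm (g y - p) < e -> J (g y) != 0 -> exists2 d : R, 0 < d &
    forall y', rnorm (y' - y) < d ->
    [/\ inS y', rnorm (g y' - p) < e, differentiable g y' & differentiable j y'].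
  move=> yS ge Jg; have [gN fg] := gP y yS.
  have r0 : 0 < e - rnorm (g y - p) by rewrite subr_gt0.
  have sub x : rnorm (x - g y) < e - rnorm (g y - p) -> rnorm (x - p) < e.
    move=> xg; have -> : x - p = (x - g y) + (g y - p) by rewrite addrA subrK.
    by apply: le_lt_trans (rnormD _ _) _; rewrite -ltrBrDr.
  have uJ : jac f (g y) \in unitmx by rewrite unitmxE unitfE.
  have [d [h [d0 hP]]] := inverse_function r0 (fun x xg => df x (N_e0 x (ltW (sub x xg)))) uJ.
  rewrite fg in hP.
  have hS y' : rnorm (y' - y) < d -> inS y' /\ g y' = h y'.
    move=> /hP[/sub/ltW hN fh _ _ _]; split; first by exists (h y').
    by rewrite -[in LHS]fh g_eq.
  exists d => // y' y'd; have [y'S gh] := hS y' y'd; have [hN fh dh _ _] := hP y' y'd.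
  have nr := near_rball y'd.
  have dg : differentiable g y'.
    by apply: differentiable_near dh; apply: filterS nr => z /hS[_ ->].
  have g'e : rnorm (g y' - p) < e by rewrite gh; exact: sub.
  split; [exact: y'S|exact: g'e|exact: dg|].
  apply: (@differentiable_near _ _ _ (J \o g)).
    by apply: filterS nr => z /hS[zS _]; rewrite jS.
  exact: (differentiable_comp dg (dJ _ (N_e0 _ (ltW g'e)))).
(* Two cases at a point of the image: where the determinant vanishes, the default value 0 fits the
   limit; where it does not, a whole neighbourhood lies in the image. *)
have j_cont y : (inS y -> rnorm (g y - p) < e) -> {for y, continuous j}.
  move=> yint; apply/continuous_rnormP => eps eps0.
  have [yS|yS] := pselect (inS y); last first.
    have [d d0 dP] := S_closed y yS; exists d => // y' /dP y'S.
    by rewrite !jnS // subrr rnorm0.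
  have [gN fg] := gP y yS.
  have [d1 d10 d1P] : exists2 d : R, 0 < d & forall x, rnorm (x - g y) < d -> rnorm (J x - J (g y)) < eps.
    exact: ((continuous_rnormP _ _).1 (differentiable_continuous (dJ _ (N_e0 _ gN))) eps eps0).
  have [d2 d20 d2P] := g_cont y _ yS d10.
  have [J0|J0] := eqVneq (J (g y)) 0.
    exists d2 => // y' y'd; rewrite (jS y yS); have [y'S|y'S] := pselect (inS y').
      by rewrite (jS y' y'S); apply/d1P/d2P.
    by rewrite (jnS y' y'S) J0 subrr rnorm0.
  have [d3 d30 d3P] := S_open y yS (yint yS) J0.
  exists (Num.min d2 d3); first by rewrite lt_min d20.
  move=> y'; rewrite lt_min => /andP[y'2 /d3P[y'S _ _ _]].
  by rewrite (jS y yS) (jS y' y'S); apply/d1P/d2P.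
have xe_e0 x : rnorm (x - p) = e -> rnorm (x - p) < e0.
  by move=> xe; apply: N_e0; rewrite /inN xe.
(* The image of the sphere stays at distance [c] from [f p], so image points closer than [c] come
   from the open ball, where [j_cont] applies. *)
have [|x xe|c c0 cP] := @sphere_gap n f p e egt0.
- by move=> x /xe_e0/fc.
- apply: contraTneq egt0 => /inj xp; rewrite -xe xp ?subrr ?rnorm0 ?ltxx //; exact: xe_e0.
have pN : inN p by rewrite /inN subrr rnorm0 ltW.
have pe : rnorm (p - p) < e by rewrite subrr rnorm0.
have gint y : rnorm (y - f p) < c -> inS y -> rnorm (g y - p) < e.
  move=> yc yS; have [gN fg] := gP y yS; rewrite lt_neqAle [_ <= e]gN andbT.
  by apply: contraTneq yc => /cP; rewrite fg -leNgt.
have jc y : rnorm (y - f p) < c -> {for y, continuous j}.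
  by move=> yc; apply: j_cont; exact: gint.
have jd y : rnorm (y - f p) < c -> j y != 0 -> exists2 d : R, 0 < d &
  forall y', rnorm (y' - y) < d ->
    [/\ inS y', rnorm (g y' - p) < e, differentiable g y' & differentiable j y'].
  move=> yc jy; have yS : inS y by apply: contrapT => /(jnS y) j0; rewrite j0 eqxx in jy.
  by apply: S_open => //; [exact: gint|rewrite -jS].
have dfe x : rnorm (x - p) < e -> differentiable f x by move=> /ltW/N_e0/df.
have inje x y : rnorm (x - p) < e -> rnorm (y - p) < e -> f x = f y -> x = y.
  by move=> /ltW/N_e0 xe /ltW/N_e0 ye; exact: inj.
have dense y (eta : R) : rnorm (y - f p) < c -> inS y -> 0 < eta ->
    exists y', [/\ inS y', rnorm (y' - y) < eta, rnorm (g y' - g y) < eta & j y' != 0].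
  move=> yc yS eta0; have [gN fg] := gP y yS.
  have [d d0 dP] := (continuous_rnormP _ _).1 (fc _ (N_e0 _ gN)) eta eta0.
  have m0 : 0 < Num.min d eta by rewrite lt_min d0.
  have [x [xg xe Jx]] := regular_dense dfe inje (gint y yc yS) m0.
  move: xg; rewrite lt_min => /andP[xd xeta].
  have fxS : inS (f x) by exists x; split=> //; exact: ltW.
  have gfx : g (f x) = x by apply: g_eq; exact: ltW.
  exists (f x); rewrite (jS _ fxS) gfx; split; [exact: fxS| |exact: xeta|exact: Jx].
  by rewrite -[in X in _ - X]fg; exact: dP.
have line (y1 v : 'rV[C]_n) (t : C) (r : R) : rnorm (y1 - f p) + r <= c -> cmod t * rnorm v < r ->
    rnorm (y1 + t *: v - f p) < c.
  move=> h1 h2; rewrite addrAC; apply: le_lt_trans (rnormD _ _) _; rewrite rnormZ.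
  by apply: lt_le_trans h1; rewrite ltrD2l.
have near_line (y1 v : 'rV[C]_n) (t : C) d : 0 < d -> exists2 d' : R, 0 < d' &
    forall t', cmod (t' - t) < d' -> rnorm ((y1 + t' *: v) - (y1 + t *: v)) < d.
  move=> d0; have v1 : 0 < rnorm v + 1 by rewrite ltr_wpDl ?rnorm_ge0.
  exists (d / (rnorm v + 1)) => [|t']; first by rewrite divr_gt0.
  rewrite ltr_pdivlMr // => h; rewrite opprD addrACA subrr add0r -scalerBl rnormZ.
  by apply: le_lt_trans h; rewrite ler_wpM2l ?cmod_ge0 // lerDl.
have jline_c (y1 v : 'rV[C]_n) (t : C) : rnorm (y1 + t *: v - f p) < c ->
    {for t, continuous (fun t : C => j (y1 + t *: v))}.
  move=> /jc jt; apply/continuous_rnormP => eps eps0.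
  have [d d0 dP] := (continuous_rnormP _ _).1 jt eps eps0.
  have [d' d'0 d'P] := near_line y1 v t d d0.
  by exists d' => // t' /d'P/dP.
(* If [y1] is missed, [j] vanishes near [y1], hence along the complex line to a nearby [y2] with
   [j y2 != 0]. The radius [6 / 5] puts the parameter 1 of [y2] inside the disc and keeps the disc
   within distance [c] of [f p]. *)
have surj (y1 : 'rV[C]_n) : rnorm (y1 - f p) < c / 3 -> inS y1.
  move=> y1c; apply: contrapT => y1S.
  have c6 : 0 < c / 6 by rewrite divr_gt0.
  have pS : inS (f p) by exists p.
  have fpc : rnorm (f p - f p) < c by rewrite subrr rnorm0.
  have [y2 [y2S y2p _ jy2]] := dense _ _ fpc pS c6.
  pose v := y2 - y1.
  have vc : rnorm v < c / 2.
    have -> : v = (y2 - f p) + (f p - y1) by rewrite addrA subrK.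
    apply: le_lt_trans (rnormD _ _) _; rewrite [rnorm (f p - y1)]rnormB.
    by clear - y1c y2p; lra.
  have inW (t : C) : cmod (t - 0) <= 6 / 5 -> rnorm (y1 + t *: v - f p) < c.
    rewrite subr0 => ht; apply: (line _ _ _ (2 * c / 3)); first by clear - y1c; lra.
    have h0 := rnorm_ge0 v; have := cmod_ge0 t.
    have : cmod t * rnorm v <= 6 / 5 * rnorm v by rewrite ler_wpM2r.
    by clear - vc c0; lra.
  have [d d0 dP] := S_closed y1 y1S.
  have [d' d'0 d'P] := near_line y1 v 0 d d0.
  have r0 : 0 < 6 / 5 :> R by rewrite divr_gt0.
  have v2 : y1 + 1 *: v = y2 by rewrite scale1r /v addrC subrK.
  case/eqP: jy2; rewrite -v2.
  apply: (@vanish_propagates _ (fun t => j (y1 + t *: v)) 0 (6 / 5) d' r0 d'0 _ _ _ 1).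
  - by move=> t /inW; exact: jline_c.
  - move=> t /ltW/inW tc /(jd _ tc)[d1 d10 d1P].
    have [d2 d20 d2P] := near_line y1 v t d1 d10.
    exists d2 => // t' /andP[_ /d2P/d1P[_ _ _ dj]].
    exact: differentiable_along.
  - move=> t /d'P; rewrite scale0r addr0 => /dP; exact: jnS.
  - by rewrite subr0 cmod1; clear; lra.
have v12 (y1 y2 : 'rV[C]_n) : y1 + 1 *: (y2 - y1) = y2 by rewrite scale1r addrC subrK.
pose B := e + 1; have B0 : 0 < B by rewrite addr_gt0.
pose L := 12 * B / c.
have L0 : 0 < L by rewrite divr_gt0 // mulr_gt0.
(* The slope of each coordinate of [g] along the line is holomorphic only where [j] does not vanish,
   which is what [rado_bound] asks. The radius [c / 6 / rnorm v] exceeds 1 and keeps the disc inside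
   the image; the bound [2 * B / r] then equals [L * rnorm v]. *)
have lip1 (y1 y2 : 'rV[C]_n) : rnorm (y1 - f p) < c / 12 -> rnorm (y2 - f p) < c / 12 ->
    j y1 != 0 -> j y2 != 0 -> rnorm (g y2 - g y1) <= L * rnorm (y2 - y1).
  move=> y1c y2c j1 j2; have [->|y21] := eqVneq y2 y1.
    by rewrite !subrr rnorm0 mulr0.
  pose v := y2 - y1; have v0 : 0 < rnorm v by rewrite rnorm_gt0 subr_eq0.
  have vc : rnorm v < c / 6.
    have -> : v = (y2 - f p) + (f p - y1) by rewrite addrA subrK.
    apply: le_lt_trans (rnormD _ _) _; rewrite [rnorm (f p - y1)]rnormB.
    by clear - y1c y2c; lra.
  pose r := c / 6 / rnorm v.
  have r1 : 1 < r by rewrite ltr_pdivlMr // mul1r.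
  have r0 : 0 < r by apply: lt_trans r1.
  have in3 (t : C) : cmod (t - 0) <= r -> rnorm (y1 + t *: v - f p) < c / 3.
    rewrite subr0 /r ler_pdivlMr // => tv; rewrite addrAC.
    apply: le_lt_trans (rnormD _ _) _; rewrite rnormZ.
    by clear - y1c tv c0; lra.
  have inW (t : C) : cmod (t - 0) <= r -> rnorm (y1 + t *: v - f p) < c.
    by move=> /in3 h; apply: lt_trans h _; clear - c0; lra.
  have y1W : rnorm (y1 - f p) < c by apply: lt_trans y1c _; clear - c0; lra.
  have y1S : inS y1 by apply: surj; apply: lt_trans y1c _; clear - c0; lra.
  apply: rnorm_le => [|a i]; first by rewrite mulr_ge0 ?rnorm_ge0 // ltW.
  rewrite ord1 !mxE.
  pose G (t : C) : C := g (y1 + t *: v) 0 i.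
  have Gc t : cmod (t - 0) <= r -> {for t, continuous G}.
    move=> tr; apply/continuous_rnormP => eps eps0.
    have [d d0 dP] := g_cont _ _ (surj _ (in3 t tr)) eps0.
    have c3 : 0 < c / 3 - rnorm (y1 + t *: v - f p) by rewrite subr_gt0; exact: in3.
    have m0 : 0 < Num.min d (c / 3 - rnorm (y1 + t *: v - f p)) by rewrite lt_min d0.
    have [d' d'0 d'P] := near_line y1 v t _ m0.
    exists d' => // t'; rewrite rnormC => /d'P; rewrite lt_min => /andP[h1 h2].
    have t'S : inS (y1 + t' *: v).
      apply: surj; have -> : y1 + t' *: v - f p = (y1 + t' *: v - (y1 + t *: v)) + (y1 + t *: v - f p).
        by rewrite addrA subrK.
      by apply: le_lt_trans (rnormD _ _) _; rewrite -ltrBrDr.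
    rewrite rnormC; apply: le_lt_trans (dP _ t'S h1).
    by have := cmod_coord (g (y1 + t' *: v) - g (y1 + t *: v)) 0 i; rewrite !mxE.
  have dG (t : C) : cmod (t - 0) <= r -> j (y1 + t *: v) != 0 -> exists2 d : R, 0 < d &
      forall t', cmod (t' - t) < d -> differentiable G t' /\ differentiable (fun t : C => j (y1 + t *: v)) t'.
    move=> /inW tc /(jd _ tc)[d1 d10 d1P].
    have [d2 d20 d2P] := near_line y1 v t d1 d10.
    exists d2 => // t' /d2P/d1P[_ _ dg dj]; split; last exact: differentiable_along.
    exact: (@differentiable_along _ _ (fun y => g y 0 i) y1 v t' (differentiable_coordP 0 i dg)).
  have z0 : cmod (0 - 0 : C) <= r by rewrite subrr cmod0 ltW.
  have dG0 : differentiable G 0.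
    have [|d d0 dP] := dG 0 z0; first by rewrite scale0r addr0.
    by have [|//] := dP 0; rewrite subrr cmod0.
  have [l lP] := differentiable_cderiv dG0.
  pose s := slope G 0 l.
  have sc t : cmod (t - 0) <= r -> {for t, continuous s}.
    move=> tr; have [->|t0] := eqVneq t 0; first exact: slope_continuous.
    apply: (@continuous_near _ _ _ (fun y => (G y - G 0) * (y - 0)^-1)).
      by apply: filterS (near_neq t0) => y ya; rewrite /s /slope (negbTE ya).
    apply: continuousM.
      by apply: continuousB; [exact: Gc|exact: cst_continuous].
    apply/differentiable_continuous/differentiableV; last by rewrite subr_eq0.
    by apply: differentiableB; [exact: ex_diff|exact: differentiable_cst].
  have GB t : cmod (t - 0) <= r -> cmod (G t - G 0) <= 2 * B.
    move=> tr; have [gN _] := gP _ (surj _ (in3 t tr)); have [gN1 _] := gP _ y1S.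
    rewrite /G scale0r addr0.
    have -> : g (y1 + t *: v) 0 i - g y1 0 i = (g (y1 + t *: v) - p) 0 i - (g y1 - p) 0 i.
      by rewrite !mxE; ring.
    apply: le_trans (cmodD _ _) _; rewrite cmodN.
    have := le_trans (cmod_coord _ 0 i) gN; have := le_trans (cmod_coord _ 0 i) gN1.
    by rewrite /B; clear; lra.
  have one_r : cmod (1 - 0 : C) <= r by rewrite subr0 cmod1 ltW.
  have : cmod (s 1) <= 2 * B / r.
    apply: (@rado_bound _ s (fun t => j (y1 + t *: v)) 0 r (2 * B / r) r0 _ _ _ _ 1 one_r).
    - by rewrite divr_ge0 ?(ltW r0) // mulr_ge0 // ltW.
    - move=> k t tr; apply: continuousM; last exact/jline_c/inW.
      elim: k => [|k IHk].
        rewrite (_ : (fun t => s t ^+ 0) = cst 1); last by apply/funext => t'; rewrite expr0.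
        exact: cst_continuous.
      rewrite (_ : (fun t => s t ^+ k.+1) = (fun t => s t * s t ^+ k)).
        exact: continuousM (sc t tr) IHk.
      by apply/funext => t'; rewrite exprS.
    - move=> t /ltW tr jt; have [d d0 dP] := dG t tr jt.
      have [t0|t0] := eqVneq t 0.
        exists d; [exact: d0|move=> t' /andP[t'0 t'd]]; have [dGt djt] := dP t' t'd; split; last exact: djt.
        apply: slope_differentiable; last exact: dGt.
        by move: t'0; rewrite t0 cmod_gt0 subr_eq0.
      exists (Num.min d (cmod t)); first by rewrite lt_min d0 cmod_gt0.
      move=> t' /andP[_]; rewrite lt_min => /andP[t'd t't].
      have [dGt djt] := dP t' t'd; split; last exact: djt.
      apply: slope_differentiable; last exact: dGt.
      by apply: contraTneq t't => ->; rewrite sub0r cmodN ltxx.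
    - move=> t tr; have t0 : t != 0.
        by apply: contra_eq_neq tr => ->; rewrite subrr cmod0 lt_eqF.
      rewrite /s /slope (negbTE t0) cmodM cmodV tr; apply: ler_wpM2r; first by rewrite invr_ge0 ltW.
      by apply: GB; rewrite tr.
    - by rewrite v12.
  have := slopeE G 0 l 1; rewrite -/s subr0 mulr1 /G scale1r scale0r addr0.
  have -> : y1 + v = y2 by rewrite -[v]scale1r v12.
  move=> -> sB; apply: (le_trans sB); rewrite le_eqVlt; apply/orP; left; apply/eqP.
  by rewrite /L /r; field; rewrite !gt_eqF.
(* Points with [j] nonzero are dense in the image and [g] is continuous, so the estimate of [lip1]
   extends to all points. *)
have lip y : rnorm (y - f p) < c / 12 -> rnorm (g y - g (f p)) <= L * rnorm (y - f p).
  move=> yc; apply/ler_addgt0Pr => eps eps0.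
  have w1 : rnorm (y - f p) < c by apply: lt_trans yc _; clear - c0; lra.
  have yS : inS y by apply: surj; apply: lt_trans yc _; clear - c0; lra.
  have pS : inS (f p) by exists p.
  have w0 : rnorm (f p - f p) < c by rewrite subrr rnorm0.
  pose eta := Num.min (c / 12 - rnorm (y - f p)) (Num.min (c / 12) (eps / (2 + 2 * L))).
  have L2 : 0 < 2 + 2 * L by clear - L0; lra.
  have eta0 : 0 < eta by rewrite !lt_min subr_gt0 yc !divr_gt0.
  have e1 : eta <= c / 12 - rnorm (y - f p) by rewrite /eta ge_min lexx.
  have e2 : eta <= c / 12 by rewrite /eta !ge_min lexx orbT.
  have e3 : eta * (2 + 2 * L) <= eps by rewrite -ler_pdivlMr // /eta !ge_min lexx !orbT.
  have [y2 [y2S y2y gy2 jy2]] := dense y eta w1 yS eta0.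
  have [y1 [y1S y1p gy1 jy1]] := dense (f p) eta w0 pS eta0.
  have y2c : rnorm (y2 - f p) < c / 12.
    have -> : y2 - f p = (y2 - y) + (y - f p) by rewrite addrA subrK.
    by apply: le_lt_trans (rnormD _ _) _; clear - y2y e1; lra.
  have y1c : rnorm (y1 - f p) < c / 12 by exact: lt_le_trans e2.
  have K := lip1 y1 y2 y1c y2c jy1 jy2.
  have K1 : rnorm (g y - g (f p)) <= rnorm (g y2 - g y) + rnorm (g y2 - g y1) + rnorm (g y1 - g (f p)).
    have -> : g y - g (f p) = (g y - g y2) + (g y2 - g y1) + (g y1 - g (f p)).
      by rewrite !addrA !subrK.
    apply: le_trans (rnormD _ _) _; rewrite lerD2r.
    by apply: le_trans (rnormD _ _) _; rewrite lerD2r rnormB.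
  have K2 : rnorm (y2 - y1) <= rnorm (y2 - y) + rnorm (y - f p) + rnorm (y1 - f p).
    have -> : y2 - y1 = (y2 - y) + (y - f p) + (f p - y1) by rewrite !addrA !subrK.
    apply: le_trans (rnormD _ _) _; rewrite [rnorm (f p - y1)]rnormB lerD2r.
    exact: rnormD.
  have K3 : rnorm (y2 - y1) <= rnorm (y - f p) + 2 * eta.
    by clear - K2 y2y y1p; lra.
  have K4 := ler_wpM2l (ltW L0) K3.
  by clear - K K1 K4 gy1 gy2 e3; lra.
exists (c / 12), L; split; first by rewrite divr_gt0.
move=> y yc; have yS : inS y by apply: surj; apply: lt_trans yc _; clear - c0; lra.
have [gN fg] := gP y yS; exists (g y); split; [exact: N_e0|exact: fg|].
by have := lip y yc; rewrite g_eq.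
Qed.

End Osgood.

(** * Euclidean geometry and automorphisms of the ball *)

Section OpenMapping.
Context {R : realType}.
Local Notation C := (Cplx R).

Lemma open_rball (V : normedModType C) (A : set V) x : open A -> A x ->
  exists2 d : R, 0 < d & forall y, rnorm (y - x) < d -> A y.
Proof. by rewrite openE => oA /oA; rewrite /interior => /rnorm_nbhsP. Qed.

Lemma rball_open (V : normedModType C) (A : set V) :
  (forall x, A x -> exists2 d : R, 0 < d & forall y, rnorm (y - x) < d -> A y) -> open A.
Proof. by rewrite openE => H x /H; rewrite /interior => h; apply/rnorm_nbhsP. Qed.

(** Osgood's theorem provides preimages close to [g y] with a Lipschitz bound; injectivity
    identifies them with the values of [g], and [inverse_differentiable] applies. *)
Lemma inverse_holomorphic n (f g : 'rV[C]_n -> 'rV[C]_n) (X Y : set 'rV[C]_n) :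
  open X -> (forall x, X x -> differentiable f x) -> set_inj X f ->
  open Y -> (forall y, Y y -> X (g y) /\ f (g y) = y) ->
  forall y, Y y -> differentiable g y.
Proof.
move=> oX df inj oY gP y Yy; have [Xg fg] := gP y Yy.
have [e e0 eX] := open_rball oX Xg.
have [d [L [d0 dP]]] := @osgood R n f (g y) e e0 (fun x xe => df x (eX x xe))
  (fun x x' xe x'e => inj x x' (mem_set (eX x xe)) (mem_set (eX x' x'e))).
rewrite fg in dP.
have [d' d'0 d'Y] := open_rball oY Yy.
have m0 : 0 < Num.min d d' by rewrite lt_min d0.
have [|//] := @inverse_differentiable R n f g y L (Num.min d d') m0 (df _ Xg).
move=> y'; rewrite lt_min => /andP[/dP[x [xe fx xL]] /d'Y/gP[Xg' fg']]; split; first exact: fg'.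
suff -> : g y' = x by [].
by apply: inj; [exact: mem_set|exact/mem_set/eX|rewrite fg'].
Qed.

End OpenMapping.

(** * Euclidean norm and Hermitian product *)

Section Euclid.
Context {R : realType}.
Local Notation C := (Cplx R).

Definition cdot n (x y : 'rV[C]_n) : C := \sum_i x 0 i * cconj (y 0 i).

Section Rows.
Context {n : nat}.
Implicit Types x y z a : 'rV[C]_n.

Lemma cdotDl x y z : cdot (x + y) z = cdot x z + cdot y z.
Proof. by rewrite -big_split; apply: eq_bigr => i _; rewrite mxE mulrDl. Qed.

Lemma cdotZl (c : C) x y : cdot (c *: x) y = c * cdot x y.
Proof. by rewrite mulr_sumr; apply: eq_bigr => i _; rewrite mxE mulrA. Qed.

Lemma cconj_sum (I : Type) (s : seq I) (F : I -> C) :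
  cconj (\sum_(i <- s) F i) = \sum_(i <- s) cconj (F i).
Proof.
elim: s => [|i s IHs]; last by rewrite !big_cons cconjD IHs.
by rewrite !big_nil; apply: eq_cplx; rewrite ?creal_conj ?cimag_conj // oppr0.
Qed.

Lemma cdotC x y : cdot x y = cconj (cdot y x).
Proof.
by rewrite cconj_sum; apply: eq_bigr => i _; rewrite cconjM cconjK mulrC.
Qed.

Lemma enorm_ge0 x : 0 <= enorm x.
Proof. exact: sqrtr_ge0. Qed.

Lemma enorm_sqr x : enorm x ^+ 2 = \sum_i cmod (x 0 i) ^+ 2.
Proof. by rewrite sqr_sqrtr // sumr_ge0 // => i _; rewrite sqr_ge0. Qed.

Lemma ofr_sum (I : Type) (s : seq I) (F : I -> R) :
  ofr (\sum_(i <- s) F i) = \sum_(i <- s) ofr (F i).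
Proof. by elim/big_rec2: _ => // i a b _ <-; rewrite ofrD. Qed.

Lemma cdot_self x : cdot x x = ofr (enorm x ^+ 2).
Proof. by rewrite enorm_sqr ofr_sum; apply: eq_bigr => i _; rewrite mulcconj. Qed.

Lemma enorm0 : enorm (0 : 'rV[C]_n) = 0.
Proof.
by rewrite /enorm big1 ?sqrtr0 // => i _; rewrite mxE cmod0 expr0n.
Qed.

Lemma enormZ (c : C) x : enorm (c *: x) = cmod c * enorm x.
Proof.
rewrite /enorm (eq_bigr (fun i => cmod c ^+ 2 * cmod (x 0 i) ^+ 2)).
  by rewrite -mulr_sumr sqrtrM ?sqr_ge0 // sqrtr_sqr ger0_norm ?cmod_ge0.
by move=> i _; rewrite mxE cmodM exprMn.
Qed.

Lemma enormN x : enorm (- x) = enorm x.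
Proof. by rewrite -scaleN1r enormZ cmodN cmod1 mul1r. Qed.

Lemma enormBC x y : enorm (x - y) = enorm (y - x).
Proof. by rewrite -enormN opprB. Qed.

Lemma cmod_coord_enorm x i : cmod (x 0 i) <= enorm x.
Proof.
rewrite -(@ler_pXn2r _ 2) ?nnegrE ?cmod_ge0 ?enorm_ge0 // enorm_sqr (bigD1 i) //= lerDl.
by rewrite sumr_ge0 // => j _; rewrite sqr_ge0.
Qed.

Lemma rnorm_le_enorm x : rnorm x <= enorm x.
Proof.
by apply: rnorm_le => [|i j]; rewrite ?enorm_ge0 // ord1 cmod_coord_enorm.
Qed.

(** A crude constant suffices; [n.+1] is positive in every dimension, so one may divide by it. *)
Lemma enorm_le_rnorm x : enorm x <= n.+1%:R * rnorm x.
Proof.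
rewrite -(@ler_pXn2r _ 2) ?nnegrE ?enorm_ge0 ?mulr_ge0 ?rnorm_ge0 // enorm_sqr.
apply: (@le_trans _ _ (\sum_(i < n) rnorm x ^+ 2)).
  by apply: ler_sum => i _; rewrite ler_pXn2r ?nnegrE ?cmod_ge0 ?rnorm_ge0 ?cmod_coord.
rewrite sumr_const card_ord exprMn -[_ *+ n]mulr_natl; apply: ler_wpM2r; first exact: sqr_ge0.
rewrite -natrX ler_nat.
by rewrite expnS expn1 (leq_trans (leqnSn n)) // leq_pmulr.
Qed.

Lemma enorm_eq0 x : (enorm x == 0) = (x == 0).
Proof.
apply/eqP/eqP => [x0|->]; last exact: enorm0.
apply/eqP; rewrite -rnorm_eq0 -(rwP eqP); apply/eqP; rewrite eq_le rnorm_ge0 andbT -x0.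
exact: rnorm_le_enorm.
Qed.

Lemma enorm_gt0 x : (0 < enorm x) = (x != 0).
Proof. by rewrite lt_def enorm_ge0 andbT enorm_eq0. Qed.

Lemma cdot_le x y : cmod (cdot x y) <= enorm x * enorm y.
Proof.
have [->|y0] := eqVneq y 0.
  rewrite enorm0 mulr0 /cdot big1 ?cmod0 // => i _.
  by rewrite mxE (_ : cconj 0 = 0) ?mulr0 //; exact: (cconj_ofr 0).
have [->|x0] := eqVneq x 0.
  by rewrite enorm0 mul0r /cdot big1 ?cmod0 // => i _; rewrite mxE mul0r.
have xy0 : 0 < 2 * enorm x * enorm y by rewrite !mulr_gt0 ?enorm_gt0.
apply: (@le_trans _ _ (\sum_i cmod (x 0 i) * cmod (y 0 i))).
  rewrite /cdot; elim/big_rec2: _ => [|i a b _ ab]; first by rewrite cmod0.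
  by apply: le_trans (cmodD _ _) _; rewrite cmodM cmod_conj lerD2l.
rewrite -(ler_pM2l xy0) mulr_sumr.
apply: (@le_trans _ _ (\sum_i (enorm y ^+ 2 * cmod (x 0 i) ^+ 2 +
                               enorm x ^+ 2 * cmod (y 0 i) ^+ 2))).
  apply: ler_sum => i _; rewrite -subr_ge0.
  have -> : enorm y ^+ 2 * cmod (x 0 i) ^+ 2 + enorm x ^+ 2 * cmod (y 0 i) ^+ 2 -
    2 * enorm x * enorm y * (cmod (x 0 i) * cmod (y 0 i)) =
    (enorm y * cmod (x 0 i) - enorm x * cmod (y 0 i)) ^+ 2 by ring.
  exact: sqr_ge0.
rewrite big_split /= -!mulr_sumr -!enorm_sqr le_eqVlt; apply/orP; left; apply/eqP.
by ring.
Qed.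

Lemma enorm_sqrD x y : enorm (x + y) ^+ 2 =
  enorm x ^+ 2 + 2 * creal (cdot x y) + enorm y ^+ 2.
Proof.
have creal_sum (F : 'I_n -> C) : creal (\sum_i F i) = \sum_i creal (F i).
  by elim/big_rec2: _ => // i a b _ <-; rewrite crealD.
rewrite !enorm_sqr creal_sum mulr_sumr -!big_split; apply: eq_bigr => i _ /=.
by rewrite mxE !cmod_sqr crealD cimagD crealM creal_conj cimag_conj; ring.
Qed.

Lemma enormD x y : enorm (x + y) <= enorm x + enorm y.
Proof.
rewrite -(@ler_pXn2r _ 2) ?nnegrE ?enorm_ge0 ?addr_ge0 ?enorm_ge0 // enorm_sqrD sqrrD.
rewrite lerD2r lerD2l -[enorm x * enorm y *+ 2]mulr_natl; apply: ler_wpM2l => //.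
apply: le_trans (cdot_le x y); apply: le_trans (creal_le _); exact: ler_norm.
Qed.

Lemma enorm_dist x y : `|enorm x - enorm y| <= n.+1%:R * rnorm (x - y).
Proof.
apply: le_trans (enorm_le_rnorm _).
have h1 := enormD (x - y) y; have h2 := enormD (y - x) x.
rewrite !subrK in h1 h2; rewrite [enorm (y - x)]enormBC in h2.
by rewrite ler_norml; clear - h1 h2; lra.
Qed.

Lemma enorm_continuous x : {for x, continuous (@enorm R n)}.
Proof.
apply/continuous_realP => e e0; exists (e / n.+1%:R) => [|y]; first by rewrite divr_gt0.
by rewrite ltr_pdivlMr // mulrC => h; apply: le_lt_trans h; exact: enorm_dist.
Qed.

Lemma unit_ballE x : unit_ball R n x = (enorm x < 1).
Proof. by rewrite /unit_ball /eball /= subr0. Qed.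

Lemma open_unit_ball : open (unit_ball R n).
Proof.
apply: rball_open => x; rewrite unit_ballE => x1.
have [d d0 dP] := (continuous_realP _ _).1 (@enorm_continuous x) (1 - enorm x) ltac:(by rewrite subr_gt0).
exists d => // y /dP; rewrite unit_ballE => /(le_lt_trans (ler_norm _)).
by rewrite ltrBlDr subrK.
Qed.

Lemma differentiable_cdot (V : normedModType C) (f : V -> 'rV[C]_n) a v :
  differentiable f v -> differentiable (fun x : V => cdot (f x) a) v.
Proof.
move=> df; apply: differentiable_bigsum => i.
by apply: differentiableM; [exact: differentiable_coordP|exact: differentiable_cst].
Qed.

End Rows.

(** * Automorphisms of the ball *)

Section Automorphism.
Context {n : nat}.
Implicit Types x y z a : 'rV[C]_n.

(* [aut_s] and [aut_k] are the constants of the standard involution of the ball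
   exchanging [a] and [0], written without the projection onto the line of [a]. *)
Definition aut_s a : R := Num.sqrt (1 - enorm a ^+ 2).

Definition aut_k a : R := (1 + aut_s a)^-1.

(** In the usual formula the projection of [z] onto the line of [a] has coefficient
    [(1 - aut_s a) / enorm a ^+ 2], which is [aut_k a]. This form also makes sense at [a = 0], where
    the map is [- z]. *)
Definition ball_aut a z : 'rV[C]_n :=
  (1 - cdot z a)^-1 *:
    ((1 - ofr (aut_k a) * cdot z a) *: a - ofr (aut_s a) *: z).

Lemma sqr_lt1 x : enorm x < 1 -> enorm x ^+ 2 < 1.
Proof. by move=> x1; rewrite expr_lt1 ?enorm_ge0. Qed.

Lemma aut_s_gt0 a : enorm a < 1 -> 0 < aut_s a.
Proof. by move=> a1; rewrite sqrtr_gt0 subr_gt0 sqr_lt1. Qed.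

Lemma aut_s_sqr a : enorm a < 1 -> enorm a ^+ 2 = 1 - aut_s a ^+ 2.
Proof.
move=> a1; rewrite /aut_s [Num.sqrt (1 - _) ^+ 2]sqr_sqrtr; first by ring.
by rewrite subr_ge0 ltW // sqr_lt1.
Qed.

Lemma aut_kE a : enorm a < 1 -> aut_k a * enorm a ^+ 2 = 1 - aut_s a.
Proof.
move=> a1; rewrite aut_s_sqr // /aut_k.
by field; rewrite gt_eqF // ltr_wpDr // ltW // aut_s_gt0.
Qed.

Lemma cdot_lt1 a z : enorm a < 1 -> enorm z < 1 -> cmod (cdot z a) < 1.
Proof.
move=> a1 z1; apply: le_lt_trans (cdot_le _ _) _.
by apply: le_lt_trans a1; rewrite ler_piMl ?enorm_ge0 // ltW.
Qed.

Lemma subr1_neq0 (t : C) : cmod t < 1 -> 1 - t != 0.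
Proof.
move=> t1; rewrite subr_eq0; apply: contraTneq t1 => <-.
by rewrite cmod1 ltxx.
Qed.

Lemma ball_aut0 a : ball_aut a 0 = a.
Proof.
rewrite /ball_aut /cdot big1 => [|i _]; last by rewrite mxE mul0r.
by rewrite mulr0 subr0 invr1 !scale1r scaler0 subr0.
Qed.

Lemma ball_aut_self a : enorm a < 1 -> ball_aut a a = 0.
Proof.
move=> a1; rewrite /ball_aut cdot_self -ofrM aut_kE // -scalerBl.
rewrite (_ : 1 - ofr (1 - aut_s a) - ofr (aut_s a) = 0) ?scale0r ?scaler0 //.
by rewrite ofrB ofr1; ring.
Qed.

Lemma cdot_aut a z : enorm a < 1 -> enorm z < 1 ->
  cdot (ball_aut a z) a = (ofr (enorm a ^+ 2) - cdot z a) / (1 - cdot z a).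
Proof.
move=> a1 z1; rewrite /ball_aut cdotZl cdotDl cdotZl cdot_self -[- (_ *: z)]scaleNr cdotZl mulrC.
congr (_ / _); have := congr1 ofr (aut_kE a1); rewrite ofrM ofrB ofr1 => kE.
by rewrite mulrBl mul1r mulrAC kE; ring.
Qed.

Lemma ball_autK a z : enorm a < 1 -> enorm z < 1 -> ball_aut a (ball_aut a z) = z.
Proof.
move=> a1 z1; rewrite {1}/ball_aut cdot_aut //.
have t1 := subr1_neq0 (cdot_lt1 a1 z1).
have s0 : ofr (aut_s a) != 0 by rewrite ofr_eq0 gt_eqF // aut_s_gt0.
have k0 : 1 + ofr (aut_s a) != 0.
  by rewrite -ofr1 -ofrD ofr_eq0 gt_eqF // ltr_wpDr // ltW // aut_s_gt0.
rewrite /ball_aut aut_s_sqr // /aut_k; apply/rowP => l; rewrite !mxE.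
rewrite ofrB ofr1 ofrV ofrD ofr1 !expr2 ofrM.
move: t1 s0 k0; set t := cdot z a; set s := ofr (aut_s a) => t1 s0 k0.
have -> : 1 - (1 - s * s - t) / (1 - t) = s * s / (1 - t) by field.
by field; rewrite ?s0 ?k0 ?t1.
Qed.

Lemma ball_aut_enorm a z : enorm a < 1 -> enorm z < 1 ->
  (1 - enorm (ball_aut a z) ^+ 2) * cmod (1 - cdot z a) ^+ 2 =
  (1 - enorm a ^+ 2) * (1 - enorm z ^+ 2).
Proof.
move=> a1 z1; have t1 := subr1_neq0 (cdot_lt1 a1 z1).
rewrite /ball_aut enormZ exprMn mulrBl mul1r cmodV mulrAC -exprMn mulVf; last first.
  by rewrite cmod_eq0.
rewrite expr1n mul1r -[- (_ *: z)]scaleNr enorm_sqrD !enormZ cdotZl [cdot a _]cdotC cdotZl -ofrN.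
set t := cdot z a; rewrite !exprMn !cmod_sqr.
rewrite !(crealM, cimagM, crealB, cimagD, cimagN, creal_ofr, cimag_ofr, creal_conj, cimag_conj).

have kE := aut_kE a1; have k0 : 1 + aut_s a != 0 by rewrite gt_eqF // ltr_wpDr // ltW // aut_s_gt0.
rewrite aut_s_sqr //; rewrite /aut_k.
move: (aut_s a) k0 => s k0.
by field.
Qed.

Lemma ball_aut_lt1 a z : enorm a < 1 -> enorm z < 1 -> enorm (ball_aut a z) < 1.
Proof.
move=> a1 z1; have t1 := subr1_neq0 (cdot_lt1 a1 z1).
rewrite -(@expr_lt1 _ 2) ?enorm_ge0 // -subr_gt0.
have t0 : 0 < cmod (1 - cdot z a) ^+ 2 by rewrite exprn_gt0 // cmod_gt0.
by rewrite -(pmulr_lgt0 _ t0) ball_aut_enorm // mulr_gt0 // subr_gt0 sqr_lt1.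
Qed.

Lemma differentiable_ball_aut a z : enorm a < 1 -> enorm z < 1 ->
  differentiable (ball_aut a) z.
Proof.
move=> a1 z1; have t1 := subr1_neq0 (cdot_lt1 a1 z1).
have dt : differentiable (fun x => cdot x a) z.
  apply: (@differentiable_cdot n _ id); exact: ex_diff.
apply: differentiable_mx => i j; rewrite ord1.
have -> : (fun x => ball_aut a x 0 j) = (fun x => (1 - cdot x a)^-1 *
    ((1 - ofr (aut_k a) * cdot x a) * a 0 j - ofr (aut_s a) * x 0 j)).
  by apply/funext => x; rewrite /ball_aut !mxE.
apply: differentiableM.
  apply: differentiableV; last exact: t1.
  by apply: differentiableB; [exact: differentiable_cst|exact: dt].
apply: differentiableB; apply: differentiableM.
- apply: differentiableB; first exact: differentiable_cst.
  by apply: differentiableM; [exact: differentiable_cst|exact: dt].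
- exact: differentiable_cst.
- exact: differentiable_cst.
- exact: (diff_coord_id z 0 j).1.
Qed.

End Automorphism.
End Euclid.

(** * Schwarz lemma and Caratheodory distance *)

Section HyperbolicTangent.
Context {R : realType}.
Implicit Types x y r : R.

Lemma tanhE x : tanh x = 1 - 2 / (expR x ^+ 2 + 1).
Proof.
rewrite /tanh expRN; have := expR_gt0 x; move: (expR x) => E E0.
have E1 : E ^+ 2 + 1 != 0 by rewrite gt_eqF // addr_gt0 // exprn_gt0.
have E2 : E + E^-1 != 0 by rewrite gt_eqF // addr_gt0 // invr_gt0.
by field; rewrite ?E1 ?(gt_eqF E0).
Qed.

Lemma tanh_lt x y : (tanh x < tanh y) = (x < y).
Proof.
have pos u : 0 < expR u ^+ 2 + 1 :> R by rewrite addr_gt0 // exprn_gt0 // expR_gt0.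
rewrite !tanhE ltrD2l ltrN2 ltr_pM2l // ltf_pV2 ?posrE // ltrD2r.
by rewrite ltr_pXn2r ?nnegrE ?expR_ge0 // ltr_expR.
Qed.

Lemma artanhK x : -1 < x < 1 -> tanh (artanh x) = x.
Proof.
move=> /andP[x0 x1]; have x0' : 0 < 1 + x by rewrite -ltrBlDl sub0r.
have x1' : 0 < 1 - x by rewrite subr_gt0.
rewrite tanhE -expRM_natr /artanh divfK ?pnatr_eq0 // lnK ?posrE ?divr_gt0 //.
field; rewrite gt_eqF //= (_ : 1 + x + (1 - x) = 2); last by ring.
by rewrite pnatr_eq0.
Qed.

Lemma artanhK_ge0 x : 0 <= x < 1 -> tanh (artanh x) = x.
Proof. by move=> /andP[x0 x1]; apply: artanhK; rewrite x1 (lt_le_trans _ x0) ?ltrN10. Qed.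

Lemma artanh_le x y : 0 <= x -> x <= y -> y < 1 -> artanh x <= artanh y.
Proof.
move=> x0 xy y1; rewrite leNgt -tanh_lt !artanhK_ge0 -?leNgt //.
- by rewrite x0 (le_lt_trans xy).
- by rewrite y1 (le_trans x0).
Qed.

Lemma artanh_lt x r : 0 <= x < 1 -> (artanh x < r) = (x < tanh r).
Proof. by move=> x01; rewrite -tanh_lt artanhK_ge0. Qed.

Lemma minimum_eq (A : set R) m : A m -> lbound A m -> minimum A = m.
Proof.
move=> Am lm; rewrite /minimum; case: xgetP => [x _ [Ax lx]|/(_ m)]; last by case.
by apply/eqP; rewrite eq_le lx ?lm.
Qed.

Lemma sup_max (A : set R) m : A m -> ubound A m -> sup A = m.
Proof.
move=> Am um; apply/eqP; rewrite eq_le; apply/andP; split.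
  by apply: ge_sup => //; exists m.
by apply: ub_le_sup => //; exists m.
Qed.

End HyperbolicTangent.

(** * Schwarz lemma and Caratheodory distance on the ball *)

Section SchwarzLemma.
Context {R : realType} {n : nat}.
Local Notation C := (Cplx R).
Local Notation B := (unit_ball R n).
Implicit Types (z w v : 'rV[C]_n).

(* Slices of the ball through the image of the base point at the origin. *)
Lemma schwarz_ball (F : 'rV[C]_n -> C) z w : B z -> B w ->
  (forall x, B x -> differentiable F x) -> (forall x, B x -> cmod (F x) <= 1) ->
  F z = 0 -> cmod (F w) <= enorm (ball_aut z w).
Proof.
rewrite !unit_ballE => z1 w1 dF F1 Fz; set v := ball_aut z w.
have [v0|v0] := eqVneq v 0.
  have := ball_autK z1 w1; rewrite -/v v0 ball_aut0 => <-.
  by rewrite Fz cmod0 enorm0.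
have ev : 0 < enorm v by rewrite enorm_gt0.
pose r := (enorm v)^-1; have r0 : 0 < r by rewrite invr_gt0.
pose G y := F (ball_aut z y).
have inB (t : C) : cmod (t - 0) < r -> enorm (0 + t *: v) < 1.
  by rewrite subr0 add0r enormZ /r -[_^-1]mul1r ltr_pdivlMr.
have v1 : enorm v < 1 by exact: ball_aut_lt1.
pose u (t : C) := G (0 + t *: v).
have u0 : u 0 = 0 by rewrite /u scale0r addr0 /G ball_aut0.
have u1 : u 1 = F w by rewrite /u scale1r add0r /G ball_autK.
have r1 : cmod (1 - 0 : C) < r.
  by rewrite subr0 cmod1 /r -[X in X < _]invr1 ltf_pV2 ?posrE.
have : cmod (u 1 - u 0) <= 1 / r * cmod (1 - 0 : C).
  apply: (@schwarz_bound R u 0 r 1 r0 _ _ 1 r1) => t /inB tv.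
    apply: (@differentiable_along _ _ G 0 v t).
    apply: (@differentiable_comp _ _ _ _ (ball_aut z) F); first exact: differentiable_ball_aut.
    by apply: dF; rewrite unit_ballE ball_aut_lt1.
  by rewrite u0 subr0; apply: F1; rewrite unit_ballE ball_aut_lt1.
by rewrite u0 u1 !subr0 cmod1 mulr1 div1r invrK.
Qed.

Lemma cmod_cdot_unit m (v x : 'rV[C]_m) :
  cmod (cdot x (ofr (enorm v)^-1 *: v)) <= enorm x.
Proof.
apply: le_trans (cdot_le _ _) _; rewrite ler_piMr ?enorm_ge0 // enormZ cmod_ofr.
rewrite ger0_norm ?invr_ge0 ?enorm_ge0 //.
have [->|v0] := eqVneq (enorm v) 0; first by rewrite mulr0 ler01.
by rewrite mulVf.
Qed.

Lemma cdot_unit m (v : 'rV[C]_m) : cdot v (ofr (enorm v)^-1 *: v) = ofr (enorm v).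
Proof.
rewrite cdotC cdotZl cconjM cdot_self !cconj_ofr -ofrM; congr ofr.
have [->|v0] := eqVneq (enorm v) 0; first by rewrite expr2 !mulr0.
by rewrite expr2 mulKf.
Qed.

Lemma caratheodory_eq (X : set 'rV[C]_n) z w : X `<=` B -> X z -> X w ->
  (forall f, holo X (unit_disk R) f -> f z = 0 -> cmod (f w) <= enorm (ball_aut z w)) ->
  caratheodory X z w = (artanh (enorm (ball_aut z w)))%:E.
Proof.
move=> XB Xz Xw H; have z1 : enorm z < 1 by rewrite -unit_ballE; exact: XB.
have aut1 x : X x -> enorm (ball_aut z x) < 1.
  by move=> /XB; rewrite unit_ballE; exact: ball_aut_lt1.
apply/eqP; rewrite eq_le; apply/andP; split.
  apply: ge_ereal_sup => _ [f [fX fz] <-]; rewrite lee_fin.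
  by apply: artanh_le; [exact: cmod_ge0|exact: H|exact: aut1].
apply: ereal_sup_ubound.
(* Unit vector in the direction of the value at [w]. For [w = z] the inverse of 0 is 0, so [e = 0],
   which is still correct. *)
pose e := ofr (enorm (ball_aut z w))^-1 *: ball_aut z w.
exists (fun x => cdot (ball_aut z x) e); last first.
  by rewrite cdot_unit cmod_ofr ger0_norm ?enorm_ge0.
split; last first.
  by rewrite ball_aut_self // /cdot big1 // => i _; rewrite mxE mul0r.
split=> x Xx.
  apply: differentiable_cdot; apply: differentiable_ball_aut z1 _.
  by rewrite -unit_ballE; exact: XB.
by apply: le_lt_trans (cmod_cdot_unit _ _) _; exact: aut1.
Qed.

(* Pairing a vector-valued map with its value at [w] reduces it to the scalar case. *)
Lemma holo_vector_bound (X : set 'rV[C]_n) m (f : 'rV[C]_n -> 'rV[C]_m) z w : X w ->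
  (forall f, holo X (unit_disk R) f -> f z = 0 -> cmod (f w) <= enorm (ball_aut z w)) ->
  holo X (unit_ball R m) f -> f z = 0 -> enorm (f w) <= enorm (ball_aut z w).
Proof.
move=> Xw H [df fB] fz; pose e := ofr (enorm (f w))^-1 *: f w.
have := H (fun x => cdot (f x) e); rewrite cdot_unit cmod_ofr ger0_norm ?enorm_ge0 //.
apply; last by rewrite fz /cdot big1 // => i _; rewrite mxE mul0r.
split=> x Xx; first exact: differentiable_cdot (df x Xx).
apply: le_lt_trans (cmod_cdot_unit _ _) _.
by have := fB x Xx; rewrite unit_ballE.
Qed.

Lemma caratheodory_ball z w : B z -> B w ->
  caratheodory B z w = (artanh (enorm (ball_aut z w)))%:E.
Proof.
move=> Bz Bw; apply: caratheodory_eq => // f [df fB] fz.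
by apply: schwarz_ball => // x /fB /ltW.
Qed.

Lemma enorm_aut_continuous z w : B z -> B w ->
  {for w, continuous (fun x => enorm (ball_aut z x))}.
Proof.
rewrite !unit_ballE => z1 w1.
apply: (@continuous_comp _ _ _ (ball_aut z) (@enorm R n)).
  exact: differentiable_continuous (differentiable_ball_aut z1 w1).
exact: enorm_continuous.
Qed.

Lemma cara_dist_attained (K : set 'rV[C]_n) z : compact K -> K !=set0 -> K `<=` B ->
  B z -> exists w, [/\ K w, cara_dist K z = enorm (ball_aut z w) &
    forall w', K w' -> enorm (ball_aut z w) <= enorm (ball_aut z w')].
Proof.
move=> cK K0 KB Bz.
have [w wK wmin] : exists2 w, w \in K &
    forall t, t \in K -> enorm (ball_aut z w) <= enorm (ball_aut z t).
  apply: compact_EVT_min => //; apply: continuous_in_subspaceT => x /set_mem /KB Bx.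
  exact: enorm_aut_continuous.
have tE w' : K w' -> tanh (fine (caratheodory B z w')) = enorm (ball_aut z w').
  move=> /KB Bw'; rewrite caratheodory_ball //= artanhK_ge0 // enorm_ge0 /=.
  by apply: ball_aut_lt1; rewrite -unit_ballE.
exists w; split; [exact: set_mem| |by move=> w' Kw'; apply: wmin; exact: mem_set].
apply: minimum_eq; first by exists w; [exact: set_mem|apply: tE; exact: set_mem].
by move=> _ [w' Kw' <-]; rewrite (tE w' Kw'); exact: wmin (mem_set Kw').
Qed.

End SchwarzLemma.

(** * Hartogs extension *)

Section Hartogs.
Context {R : realType}.
Local Notation C := (Cplx R).

Lemma avg_differentiable (V : normedModType C) (phi : V -> C -> C) m a d x :
  (forall t : R, 0 <= t <= 1 -> differentiable (fun y => phi y (a + ofr t * d)) x) ->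
  differentiable (fun y => avg m (phi y) a d) x.
Proof.
elim: m a d => [|m IHm] a d H /=.
  have := H 2^-1; rewrite ofrV ofr_nat [_^-1 * d]mulrC; apply.
  by rewrite invr_ge0 ler0n invf_le1 // ler1n.
apply: differentiableM; last exact: differentiable_cst.
apply: differentiableD; apply: IHm => t t01.
- have := H (t / 2); rewrite ofrM ofrV ofr_nat -mulrA [_^-1 * d]mulrC; apply.
  by clear - t01; lra.
- have -> : a + d / 2 + ofr t * (d / 2) = a + ofr ((1 + t) / 2) * d.
    by rewrite ofrM ofrV ofr_nat ofrD ofr1; ring.
  by apply: H; clear - t01; lra.
Qed.

Definition mobius (q x : C) : C := (x + q) / (1 + cconj q * x).

Lemma mobius_den (q x : C) : cmod q < 1 -> cmod x <= 1 ->
  1 - cmod q <= cmod (1 + cconj q * x).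
Proof.
move=> q1 x1; have h := cmodD (1 + cconj q * x) (- (cconj q * x)).
rewrite addrK cmod1 cmodN cmodM cmod_conj in h; have q0 := cmod_ge0 q.
have : cmod q * cmod x <= cmod q by rewrite ler_piMr.
by clear - h; lra.
Qed.

Lemma mobius_cmod (q x : C) : cmod q < 1 -> cmod x <= 1 ->
  (1 - cmod (mobius q x) ^+ 2) * cmod (1 + cconj q * x) ^+ 2 =
  (1 - cmod x ^+ 2) * (1 - cmod q ^+ 2).
Proof.
move=> q1 x1; have h := mobius_den q1 x1.
have d0 : cmod (1 + cconj q * x) != 0.
  by rewrite gt_eqF // (lt_le_trans _ h) // subr_gt0.
rewrite /mobius cmodM cmodV exprMn mulrBl mul1r -mulrA -exprMn mulVf // expr1n mulr1.
rewrite !cmod_sqr !(crealM, crealD, cimagD, cimagM, creal_conj, cimag_conj).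
by rewrite (_ : creal (1 : C) = 1) // (_ : cimag (1 : C) = 0) //; ring.
Qed.

(** The lower bound keeps the recentred discs strictly inside the ball; the upper bound on the
    circle pushes their boundaries towards the sphere. *)
Lemma mobius_bounds (q x : C) (tau : R) : cmod q < 1 -> tau < 1 -> cmod x <= tau ->
  (1 - tau ^+ 2) * (1 - cmod q ^+ 2) / 4 <= 1 - cmod (mobius q x) ^+ 2 /\
  (cmod x = tau -> 1 - cmod (mobius q x) ^+ 2 <= (1 - tau ^+ 2) / (1 - cmod q) ^+ 2).
Proof.
move=> q1 tau1 xt; have x1 : cmod x <= 1 by apply: le_trans xt (ltW tau1).
have xt2 : cmod x ^+ 2 <= tau ^+ 2.
  by rewrite ler_pXn2r ?nnegrE ?cmod_ge0 // (le_trans (cmod_ge0 x)).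
have tau2 : tau ^+ 2 < 1 by rewrite expr_lt1 // (le_trans (cmod_ge0 x)).
have q2 : cmod q ^+ 2 < 1 by rewrite expr_lt1 ?cmod_ge0.
have q0 := cmod_ge0 q; have q20 := sqr_ge0 (cmod q); have x20 := sqr_ge0 (cmod x).
have E := mobius_cmod q1 x1; have h := mobius_den q1 x1.
have lo : (1 - cmod q) ^+ 2 <= cmod (1 + cconj q * x) ^+ 2.
  by rewrite ler_pXn2r ?nnegrE ?cmod_ge0 // subr_ge0 ltW.
have lo0 : 0 < (1 - cmod q) ^+ 2 by rewrite exprn_gt0 // subr_gt0.
have up : cmod (1 + cconj q * x) ^+ 2 <= 4.
  rewrite (_ : 4 = 2 ^+ 2) ?ler_pXn2r ?nnegrE ?cmod_ge0 //; last by rewrite -natrX.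
  apply: le_trans (cmodD _ _) _; rewrite cmod1 cmodM cmod_conj -[2]/(1 + 1) lerD2l.
  by rewrite mulr_ile1 ?cmod_ge0 // ltW.
set D := cmod (1 + cconj q * x) ^+ 2 in E lo up *.
have D0 : 0 < D by exact: lt_le_trans lo0 lo.
have -> : 1 - cmod (mobius q x) ^+ 2 = (1 - cmod x ^+ 2) * (1 - cmod q ^+ 2) / D.
  by rewrite -E mulfK // gt_eqF.
have a0 : 0 <= (1 - tau ^+ 2) * (1 - cmod q ^+ 2).
  by rewrite mulr_ge0 // subr_ge0 ltW.
split=> [|->]; apply: ler_pM.
- by [].
- by rewrite invr_ge0 ler0n.
- by apply: ler_wpM2r; [rewrite subr_ge0 ltW|clear - xt2; lra].
- by rewrite lef_pV2 ?posrE.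
- by [].
- by rewrite invr_ge0 ltW.
- by apply: ler_piMr; [rewrite subr_ge0 ltW|clear - q20; lra].
- by rewrite lef_pV2 ?posrE.
Qed.

Lemma differentiable_mobius (q x : C) : cmod q < 1 -> cmod x <= 1 ->
  differentiable (mobius q) x.
Proof.
move=> q1 x1; have h := mobius_den q1 x1; apply: differentiableM.
  apply: differentiableD; [exact: ex_diff|exact: differentiable_cst].
apply: differentiableV; last first.
  by rewrite -cmod_gt0 (lt_le_trans _ h) // subr_gt0.
apply: differentiableD; first exact: differentiable_cst.
apply: differentiableM; [exact: differentiable_cst|exact: ex_diff].
Qed.

Section Extension.
Context {n : nat} (i0 iN : 'I_n).
Local Notation B := (unit_ball R n).
Local Notation e_ i := (delta_mx 0 i : 'rV[C]_n).

Lemma enorm_sqr_set (p : 'rV[C]_n) (t : C) :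
  enorm (p + (t - p 0 i0) *: e_ i0) ^+ 2 = enorm p ^+ 2 - cmod (p 0 i0) ^+ 2 + cmod t ^+ 2.
Proof.
rewrite !enorm_sqr (bigD1 i0) //= [in RHS](bigD1 i0) //= !mxE !eqxx mulr1.
have -> : p 0 i0 + (t - p 0 i0) = t by rewrite addrC subrK.
rewrite [X in _ = X - _ + _]addrC addrK [RHS]addrC; congr (_ + _).
by apply: eq_bigr => i /negbTE ni; rewrite !mxE ni andbF mulr0 addr0.
Qed.

(* The disc through [p] parallel to the [i0]-axis is the full slice of the ball,
   recentred at [p] by a Moebius map, so that its boundary avoids smaller balls. *)
Lemma centred_slice (p : 'rV[C]_n) (k : R) : B p -> 0 <= k < 1 ->
  exists (tau delta : R) (d : C -> C), [/\ 0 < tau, 0 < delta, d 0 = 0,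
    forall x, cmod x <= tau -> differentiable d x &
    forall x z, cmod x <= tau -> rnorm (z - p) < delta ->
      enorm (z + d x *: e_ i0) < 1 /\ (cmod x = tau -> k < enorm (z + d x *: e_ i0))].
Proof.
rewrite unit_ballE => p1 /andP[k0 k1].
have pp : enorm p ^+ 2 < 1 by rewrite expr_lt1 ?enorm_ge0.
have p0p : cmod (p 0 i0) ^+ 2 <= enorm p ^+ 2.
  by rewrite ler_pXn2r ?nnegrE ?cmod_ge0 ?enorm_ge0 // cmod_coord_enorm.
have p00 := sqr_ge0 (cmod (p 0 i0)).
(* [S] is the squared radius of the slice of the ball through [p] along the axis [i0], and [q] below
   is the position of [p] in that slice, rescaled to the unit disc. *)
pose S := 1 - enorm p ^+ 2 + cmod (p 0 i0) ^+ 2.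
have S0 : 0 < S by rewrite /S; clear - pp p00; lra.
have S1 : S <= 1 by rewrite /S; clear - p0p; lra.
pose r := Num.sqrt S; have r0 : 0 < r by rewrite sqrtr_gt0.
have rr : r ^+ 2 = S by rewrite sqr_sqrtr // ltW.
pose q := p 0 i0 / ofr r.
have rq : ofr r * q = p 0 i0 by rewrite /q mulrC divfK // ofr_eq0 gt_eqF.
have q1 : cmod q < 1.
  rewrite cmodM cmodV cmod_ofr ger0_norm ?(ltW r0) // ltr_pdivrMr // mul1r.
  rewrite -(@ltr_pXn2r _ 2) ?nnegrE ?cmod_ge0 ?(ltW r0) // rr /S.
  by clear - pp; lra.
set A := cmod q in q1; have A0 : 0 <= A by exact: cmod_ge0.
have kk : k ^+ 2 < 1 by rewrite expr_lt1.
have k20 := sqr_ge0 k.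
have A2 : 0 < (1 - A) ^+ 2 by rewrite exprn_gt0 // subr_gt0.
have A2' : (1 - A) ^+ 2 <= 1 by rewrite expr_le1 // ?subr_ge0 ?(ltW q1) // lerBlDr lerDl.
(* With [tau ^+ 2 = T] the upper bound of [mobius_bounds] becomes [(1 - k ^+ 2) / 2], so the
   boundary circle has squared norm at least [nu ^+ 2], halfway between [k ^+ 2] and 1. *)
pose T := 1 - (1 - k ^+ 2) * (1 - A) ^+ 2 / 2.
have kA0 : 0 < (1 - k ^+ 2) * (1 - A) ^+ 2 by rewrite mulr_gt0 // subr_gt0.
have kA1 : (1 - k ^+ 2) * (1 - A) ^+ 2 <= 1.
  by rewrite mulr_ile1 ?(ltW A2) // ?subr_ge0 ?(ltW kk) // lerBlDr lerDl.
have T0 : 0 < T by rewrite /T; clear - kA1; lra.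
have T1 : T < 1 by rewrite /T; clear - kA0; lra.
pose tau := Num.sqrt T; have tau0 : 0 < tau by rewrite sqrtr_gt0.
have tau2 : tau ^+ 2 = T by rewrite sqr_sqrtr // ltW.
have tau1 : tau < 1 by rewrite -(@expr_lt1 _ 2) ?tau2 // ltW.
have AA : A ^+ 2 < 1 by rewrite expr_lt1.
(* Bounds the squared norm on the whole disc through [p]; the gaps [1 - mu] and [nu - k] leave room
   to move [p] to a nearby [z]. *)
pose M := 1 - S * ((1 - tau ^+ 2) * (1 - A ^+ 2) / 4).
have M1 : M < 1.
  by rewrite /M tau2 ltrBlDr ltrDl mulr_gt0 // divr_gt0 // mulr_gt0 // subr_gt0.
pose mu := Num.sqrt M; have mu1 : mu < 1.
  have [M0|M0] := lerP M 0; first by rewrite /mu ler0_sqrtr.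
  by rewrite -(@expr_lt1 _ 2) ?sqrtr_ge0 // sqr_sqrtr // ltW.
pose nu := Num.sqrt ((1 + k ^+ 2) / 2).
have nu0 : 0 <= (1 + k ^+ 2) / 2 by clear - k20; lra.
have knu : k < nu.
  rewrite -(@ltr_pXn2r _ 2) ?nnegrE ?sqrtr_ge0 // sqr_sqrtr //.
  by clear - kk; lra.
pose dd (x : C) : C := ofr r * mobius q x - p 0 i0.
have nn : 0 < n.+1%:R :> R by rewrite ltr0n.
exists tau, (Num.min (1 - mu) (nu - k) / n.+1%:R), dd.
split.
- exact: tau0.
- by rewrite divr_gt0 // lt_min !subr_gt0 mu1.
- rewrite /dd /mobius add0r mulr0 addr0 divr1 rq; exact: subrr.
- move=> x xt; apply: differentiableB; last exact: differentiable_cst.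
  apply: differentiableM; first exact: differentiable_cst.
  by apply: differentiable_mobius q1 _; apply: le_trans xt (ltW tau1).
move=> x z xt; rewrite ltr_pdivlMr // mulrC => /(le_lt_trans (enorm_le_rnorm _)).
rewrite lt_min => /andP[z1 z2].
have [lo up] := mobius_bounds q1 tau1 xt; rewrite -/A in lo up.
have E : enorm (p + dd x *: e_ i0) ^+ 2 = 1 - S * (1 - cmod (mobius q x) ^+ 2).
  rewrite /dd enorm_sqr_set cmodM cmod_ofr exprMn ger0_norm ?(ltW r0) // rr /S.
  by ring.
have zp : z + dd x *: e_ i0 = (z - p) + (p + dd x *: e_ i0) by rewrite addrA subrK.
split.
  rewrite zp; apply: le_lt_trans (enormD _ _) _.
  have : enorm (p + dd x *: e_ i0) <= mu.
    rewrite -[leLHS]ger0_norm ?enorm_ge0 // -sqrtr_sqr; apply: ler_wsqrtr.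
    by rewrite E /M lerD2l lerN2 ler_pM2l.
  by clear - z1; lra.
move=> /up {}up.
have : nu <= enorm (p + dd x *: e_ i0).
  rewrite -[leRHS]ger0_norm ?enorm_ge0 // -sqrtr_sqr; apply: ler_wsqrtr; rewrite E.
  have {up}: 1 - cmod (mobius q x) ^+ 2 <= (1 - k ^+ 2) / 2.
    apply: le_trans up _; rewrite tau2 ler_pdivrMr // /T; clear - k; lra.
  have : 0 <= 1 - cmod (mobius q x) ^+ 2.
    apply: le_trans lo; rewrite divr_ge0 // mulr_ge0 // subr_ge0 ?tau2 ltW //.
  move: (1 - cmod _ ^+ 2) => X X0 XX.
  have : S * X <= X by rewrite ler_piMl.
  by clear - XX; lra.
have := enormD (p - z) (z + dd x *: e_ i0); rewrite addrA subrK [enorm (p - z)]enormBC.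
by clear - z2; lra.
Qed.

(** Serves to compare extensions at points of the hyperplane, approached from one side where both
    agree with [f]. *)
Lemma line_limit (G H : 'rV[C]_n -> C) (y v : 'rV[C]_n) (d : R) : 0 < d ->
  {for y, continuous G} -> {for y, continuous H} ->
  (forall t : R, 0 < t < d -> G (y + ofr t *: v) = H (y + ofr t *: v)) -> G y = H y.
Proof.
move=> d0 Gc Hc GH; apply/eqP; rewrite -subr_eq0 -cmod_eq0 eq_le cmod_ge0 andbT.
apply/ler_addgt0Pr => e e0; rewrite add0r.
have e2 : 0 < e / 2 by rewrite divr_gt0.
have [d1 d10 d1P] := (continuous_rnormP _ _).1 Gc _ e2.
have [d2 d20 d2P] := (continuous_rnormP _ _).1 Hc _ e2.
have v1 : 0 < rnorm v + 1 by rewrite ltr_wpDl ?rnorm_ge0.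
pose m := Num.min d1 d2; have m0 : 0 < m by rewrite lt_min d10.
pose t := Num.min (d / 2) (m / (rnorm v + 1)).
have t0 : 0 < t by rewrite lt_min !divr_gt0.
have td : t < d by rewrite gt_min ltr_pdivrMr // ltr_pMr // ltr1n.
have tm : rnorm (y + ofr t *: v - y) < m.
  rewrite addrAC subrr add0r rnormZ cmod_ofr ger0_norm ?(ltW t0) //.
  have : t * (rnorm v + 1) <= m by rewrite -ler_pdivlMr // ge_min lexx orbT.
  by apply: lt_le_trans; rewrite mulrDr mulr1 ltrDl.
move: tm; rewrite lt_min => /andP[/d1P h1 /d2P h2].
have Gt : G (y + ofr t *: v) = H (y + ofr t *: v) by apply: GH; rewrite t0.
rewrite !rnormC Gt in h1 h2; rewrite cmodB in h1.
have := cmodD (G y - H (y + ofr t *: v)) (H (y + ofr t *: v) - H y); rewrite addrA subrK.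
by clear - h1 h2; lra.
Qed.

Lemma compact_radius (K : set 'rV[C]_n) : compact K -> K `<=` B ->
  exists k : R, 0 <= k < 1 /\ forall w, K w -> enorm w <= k.
Proof.
move=> cK KB; have [K0|/set0P/negP] := pselect (K !=set0); last first.
  rewrite negbK => /eqP ->; exists 0; split=> //; by rewrite lexx ltr01.
have [w wK wmax] : exists2 w, w \in K & forall t, t \in K -> enorm t <= enorm w.
  apply: compact_EVT_max => //; apply: continuous_in_subspaceT => x _.
  exact: enorm_continuous.
exists (enorm w); split=> [|t Kt]; last exact: wmax (mem_set Kt).
by rewrite enorm_ge0 -unit_ballE; apply: KB; exact: set_mem.
Qed.

Lemma rnorm_delta i : rnorm (e_ i) <= 1.
Proof. by apply: rnorm_le => // a j; rewrite mxE; case: (_ && _); rewrite ?cmod0 ?cmod1. Qed.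

Lemma rnorm_shift (y : 'rV[C]_n) (t : C) i : rnorm (y + t *: e_ i - y) <= cmod t.
Proof. by rewrite addrAC subrr add0r rnormZ ler_piMr ?cmod_ge0 // rnorm_delta. Qed.

(* The averages of [f] over the boundaries of the discs of [centred_slice] are holomorphic,
   and by the mean value property they converge to [f] off the hyperplane containing [K]. *)
Lemma local_extension (K : set 'rV[C]_n) (f : 'rV[C]_n -> C) (p : 'rV[C]_n) : i0 != iN ->
  compact K -> K `<=` B -> (forall w, K w -> creal (w 0 iN) = 0) ->
  (forall x, B x -> ~ K x -> differentiable f x) ->
  (forall x, B x -> ~ K x -> cmod (f x) <= 1) ->
  B p -> exists (delta : R) (F : 'rV[C]_n -> C), 0 < delta /\ forall z, rnorm (z - p) < delta ->
  [/\ B z, differentiable F z, cmod (F z) <= 1 & creal (z 0 iN) != 0 -> F z = f z].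
Proof.
move=> i0N cK KB Kflat df f1 Bp; have [k [k01 Kk]] := compact_radius cK KB.
have [tau [delta [d [tau0 delta0 d0 dd dP]]]] := centred_slice Bp k01.
pose a : C := ofr (ln tau).
pose phi (z : 'rV[C]_n) (s : C) : C := f (z + d (0 + cexp s) *: e_ i0).
pose F m z := avg m (phi z) a period.
have circle t : cmod (0 + cexp (a + ofr t * period) : C) = tau.
  by rewrite add0r cmod_cexp creal_vertical lnK.
(* The circles run where the norm exceeds [k], hence outside [K], even if the discs themselves meet
   [K]. *)
have off z t : rnorm (z - p) < delta ->
    let w := z + d (0 + cexp (a + ofr t * period)) *: e_ i0 in B w /\ ~ K w.
  move=> zp w; have [|w1 kw] := dP (0 + cexp (a + ofr t * period)) z _ zp.
    by rewrite circle.
  split; first by rewrite unit_ballE.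
  by move=> /Kk; rewrite leNgt kw // circle.
have dF m z : rnorm (z - p) < delta -> differentiable (F m) z.
  move=> zp; apply: avg_differentiable => t _; rewrite /phi.
  set c := d _ *: _; have [Bw Kw] := off z t zp.
  apply: (@differentiable_comp _ _ _ _ (fun y : 'rV[C]_n => y + c) f); last exact: df.
  apply: differentiableD; [exact: ex_diff|exact: differentiable_cst].
have F1 m z : rnorm (z - p) < delta -> cmod (F m z) <= 1.
  by move=> zp; apply: avg_cmod_le => t _; have [Bw Kw] := off z t zp; exact: f1.
have H z : exists l : C, rnorm (z - p) < delta -> F ^~ z @ nat_ultra --> l.
  have [zp|zp] := ltP (rnorm (z - p)) delta; last by exists 0.
  by have [l lP] := ultra_cmod_cvg (u := F ^~ z) (fun m => F1 m z zp); exists l.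
have [G GP] := choice H.
exists delta, G; split=> // z zp; split.
- have [] := dP 0 z _ zp; first by rewrite cmod0 ltW.
  by rewrite d0 scale0r addr0 unit_ballE.
- have r0 : 0 < delta - rnorm (z - p) by rewrite subr_gt0.
  have sub x : rnorm (x - z) < delta - rnorm (z - p) -> rnorm (x - p) < delta.
    move=> xz; have -> : x - p = (x - z) + (z - p) by rewrite addrA subrK.
    by apply: le_lt_trans (rnormD _ _) _; rewrite -ltrBrDr.
  apply: (limit_differentiable (F := F) (M := 1) r0) => [m x /sub|m x /sub|x /sub].
  + exact: dF.
  + exact: F1.
  + exact: GP.
- exact: (ultra_cmod_le (GP z zp) (fun m => F1 m z zp)).
move=> zN; apply: norm_cvg_unique (GP z zp) _.
apply: nat_ultra_cvg; apply/cvg_rnormP => e e0.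
pose u x : C := f (z + d x *: e_ i0).
(* A disc along [i0] leaves coordinate [iN] unchanged, so if [z] is off the hyperplane the whole
   disc avoids [K] and the mean value property applies. *)
have du x : cmod x <= tau -> differentiable u x.
  move=> xt; have [w1 _] := dP x z xt zp.
  have dw : differentiable f (z + d x *: e_ i0).
    apply: df; first by rewrite unit_ballE.
    move=> /Kflat; rewrite !mxE (negbTE (_ : iN != i0)) 1?eq_sym //= mulr0 addr0.
    by apply/eqP.
  exact: (differentiable_comp (dd x xt) (differentiable_along dw)).
have u0 : u 0 = f z by rewrite /u d0 scale0r addr0.
have e2 : 0 < e / 2 by rewrite divr_gt0.
have [] := @mean_value R u 0 tau tau0 _ _ _ e2.
- by apply/differentiable_continuous/du; rewrite cmod0 ltW.
- by move=> t; rewrite subr0 => /andP[_]; exact: du.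
move=> m0 _ mP; exists m0 => // m /= /mP; rewrite u0 rnormC => /le_lt_trans; apply.
by rewrite ltr_pdivrMr // ltr_pMr // ltr1n.
Qed.

(** Local extensions glue because each agrees with [f] off the hyperplane, and every point of the
    hyperplane is a limit of such points. *)
Lemma hartogs_extension (K : set 'rV[C]_n) (f : 'rV[C]_n -> C) : i0 != iN ->
  compact K -> K `<=` B -> (forall w, K w -> creal (w 0 iN) = 0) ->
  (forall x, B x -> ~ K x -> differentiable f x) ->
  (forall x, B x -> ~ K x -> cmod (f x) <= 1) ->
  exists F : 'rV[C]_n -> C, forall x, B x ->
  [/\ differentiable F x, cmod (F x) <= 1 & ~ K x -> F x = f x].
Proof.
move=> i0N cK KB Kflat df f1.
have H p : exists G : R * ('rV[C]_n -> C), B p -> 0 < G.1 /\ forall z, rnorm (z - p) < G.1 ->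
    [/\ B z, differentiable G.2 z, cmod (G.2 z) <= 1 & creal (z 0 iN) != 0 -> G.2 z = f z].
  have [/(local_extension i0N cK KB Kflat df f1)[d [F FP]]|Bp] := pselect (B p); last by exists (0, f).
  by exists (d, F).
have [G GP] := choice H.
(* Each point of [K] takes its value from the extension centred at itself; [near_eq] shows that
   these values agree with every local extension around. *)
pose F x := if pselect (K x) then (G x).2 x else f x.
have FK x : K x -> F x = (G x).2 x by rewrite /F; case: (pselect (K x)).
have FnK x : ~ K x -> F x = f x by rewrite /F; case: (pselect (K x)).
have generic (y : 'rV[C]_n) (t : R) : creal (y 0 iN) = 0 -> 0 < t ->
    creal ((y + ofr t *: e_ iN) 0 iN) != 0.
  by move=> y0 t0; rewrite !mxE !eqxx mulr1 crealD y0 add0r creal_ofr gt_eqF.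
have near_eq p z : B p -> rnorm (z - p) < (G p).1 -> F z = (G p).2 z.
  move=> Bp zp; have [Gp0 GpP] := GP p Bp; have [Bz dGz _ Gz] := GpP z zp.
  have [zN|zN] := eqVneq (creal (z 0 iN)) 0; last first.
    by rewrite FnK ?Gz // => /Kflat z0; rewrite z0 eqxx in zN.
  have c0 : 0 < (G p).1 - rnorm (z - p) by rewrite subr_gt0.
  have sub (t : R) : 0 < t < (G p).1 - rnorm (z - p) -> rnorm (z + ofr t *: e_ iN - p) < (G p).1.
    move=> /andP[t0 tc]; have -> : z + ofr t *: e_ iN - p = (z + ofr t *: e_ iN - z) + (z - p).
      by rewrite addrA subrK.
    apply: le_lt_trans (rnormD _ _) _; rewrite -ltrBrDr; apply: le_lt_trans (rnorm_shift _ _ _) _.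
    by rewrite cmod_ofr ger0_norm // ltW.
  have [Kz|Kz] := pselect (K z); rewrite ?(FK z Kz) ?(FnK z Kz).
    have [Gz0 GzP] := GP z Bz.
    have [|_ dGzz _ _] := GzP z; first by rewrite subrr rnorm0.
    have m0 : 0 < Num.min (G z).1 ((G p).1 - rnorm (z - p)) by rewrite lt_min Gz0.
    apply: (line_limit (v := e_ iN) m0 (differentiable_continuous dGzz) (differentiable_continuous dGz)).
    move=> t /andP[t0]; rewrite lt_min => /andP[t1 t2].
    have zt : rnorm (z + ofr t *: e_ iN - z) < (G z).1.
      by apply: le_lt_trans (rnorm_shift _ _ _) _; rewrite cmod_ofr ger0_norm // ltW.
    have zt' : rnorm (z + ofr t *: e_ iN - p) < (G p).1 by apply: sub; rewrite t0.
    have [_ _ _ ->] := GzP _ zt; last exact: generic.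
    by have [_ _ _ ->] := GpP _ zt'; last exact: generic.
  apply: (line_limit (v := e_ iN) c0 (differentiable_continuous (df z Bz Kz)) (differentiable_continuous dGz)).
  move=> t tc; have [t0 _] := andP tc.
  by have [_ _ _ ->] := GpP _ (sub t tc); last exact: generic.
exists F => x Bx; have [Gx0 GxP] := GP x Bx.
have xx : rnorm (x - x) < (G x).1 by rewrite subrr rnorm0.
have [_ dG G1 _] := GxP x xx; split.
- apply: differentiable_near dG; apply/near_rnormP; exists (G x).1 => // y yx.
  by rewrite (near_eq x).
- by rewrite (near_eq x).
exact: FnK.
Qed.

End Extension.
End Hartogs.

(** * Complements of flat compact sets *)

Section OneSided.
Context {R : realType}.
Local Notation C := (Cplx R).

Lemma ultra_le (V : normedModType C) (x : nat -> V) (l : V) (h : V -> R) (M : R) :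
  x @ nat_ultra --> l -> {for l, continuous h} ->
  (forall e : R, 0 < e -> \forall k \near nat_ultra, h (x k) <= M + e) -> h l <= M.
Proof.
move=> xl hc H; apply/ler_addgt0Pr => e e0; have e2 : 0 < e / 2 by rewrite divr_gt0.
have [d d0 dP] := (continuous_realP _ _).1 hc _ e2.
have xd : \forall k \near nat_ultra, rnorm (x k - l) < d by move/cvg_rnormP: xl => /(_ d d0).
have [k [/dP + kM]] := filter_ex (filterI xd (H _ e2)).
by rewrite ltr_norml => /andP[+ _]; clear - kM; lra.
Qed.

(* Schwarz-Pick for [t |-> <u t, u 0>]. *)
Lemma disc_oscillation n (u : C -> 'rV[C]_n) (r : R) : 0 < r ->
  (forall t, cmod (t - 0) < r -> differentiable u t) ->
  (forall t, cmod (t - 0) < r -> enorm (u t) < 1) ->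
  forall t, cmod t <= r / 2 -> enorm (u t - u 0) ^+ 2 <= 5 * (1 - enorm (u 0) ^+ 2).
Proof.
move=> r0 du u1 t tr.
have z0 : cmod (0 - 0 : C) < r by rewrite subrr cmod0.
have tr' : cmod (t - 0) < r.
  by rewrite subr0 (le_lt_trans tr) // ltr_pdivrMr // ltr_pMr // ltr1n.
set b := u 0; have b1 : enorm b < 1 by exact: u1.
pose be := enorm b ^+ 2; have be0 : 0 <= be by exact: sqr_ge0.
have be1 : be < 1 by rewrite expr_lt1 ?enorm_ge0.
(* The Moebius map with parameter [q] sends [v 0 = ofr be] to 0, so the Schwarz lemma gives modulus
   at most [2^-1] on the half-radius disc. *)
pose q : C := - ofr be.
have cq : cconj q = q by rewrite /q -ofrN cconj_ofr.
have q1 : cmod q < 1 by rewrite /q cmodN cmod_ofr ger0_norm.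
pose v s := cdot (u s) b.
have v1 s : cmod (s - 0) < r -> cmod (v s) <= 1.
  move=> /u1 us; apply: le_trans (cdot_le _ _) _.
  by rewrite mulr_ile1 ?enorm_ge0 // ltW.
have v0 : v 0 = ofr be by exact: cdot_self.
pose Q s := mobius q (v s).
have Q0 : Q 0 = 0 by rewrite /Q /mobius v0 /q subrr mul0r.
have Q1 s : cmod (s - 0) < r -> cmod (Q s - Q 0) <= 1.
  move=> sr; rewrite Q0 subr0; have E := mobius_cmod q1 (v1 s sr).
  have D0 : 0 < cmod (1 + cconj q * v s) ^+ 2.
    rewrite exprn_gt0 //; apply: lt_le_trans (mobius_den q1 (v1 s sr)).
    by rewrite subr_gt0.
  rewrite -(@expr_le1 _ 2) ?cmod_ge0 // -subr_ge0 -(pmulr_lge0 _ D0) E.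
  by rewrite mulr_ge0 // subr_ge0 expr_le1 ?cmod_ge0 ?v1 // ltW.
have dQ s : cmod (s - 0) < r -> differentiable Q s.
  move=> sr; apply: (@differentiable_comp_C _ _ v (mobius q)).
    exact: differentiable_cdot (du s sr).
  exact: differentiable_mobius q1 (v1 s sr).
have := schwarz_bound r0 dQ Q1 tr'; rewrite Q0 !subr0 => Qt.
have {}Qt : cmod (Q t) <= 2^-1.
  apply: le_trans Qt _; rewrite mul1r mulrC ler_pdivrMr //.
  by rewrite mulrC.
have den := mobius_den q1 (v1 t tr'); have den0 : 1 + cconj q * v t != 0.
  by rewrite -cmod_gt0 (lt_le_trans _ den) // subr_gt0.
pose w := v t - ofr be.
have wE : w = Q t * (1 + cconj q * v t) by rewrite /Q /mobius divfK.
have wD : 1 + cconj q * v t = ofr (1 - be ^+ 2) - ofr be * w.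
  by rewrite cq /q /w ofrB ofr1 [be ^+ 2]expr2 ofrM; ring.
have be2 : be ^+ 2 < 1 by rewrite expr_lt1.
have w1 : cmod w <= 1 - be ^+ 2.
  have h : cmod (1 + cconj q * v t) <= 1 - be ^+ 2 + be * cmod w.
    rewrite wD; apply: le_trans (cmodD _ _) _; rewrite cmodN cmodM !cmod_ofr.
    by rewrite !ger0_norm // subr_ge0 ltW.
  have h1 : be * cmod w <= cmod w by rewrite ler_piMl ?cmod_ge0 // ltW.
  have h2 : cmod w <= 2^-1 * (1 - be ^+ 2 + be * cmod w).
    by rewrite {1}wE cmodM ler_pM ?cmod_ge0.
  by clear - h1 h2; lra.
have w2 : 1 - be ^+ 2 <= 2 * (1 - be).
  by rewrite -subr_ge0 (_ : _ - _ = (1 - be) ^+ 2) ?sqr_ge0 //; ring.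
(* Since [cmod w <= 2 * (1 - be)] and [enorm (u t) < 1], solving for the square of the displacement
   gives at most [1 - be + 4 * (1 - be)], whence the factor 5. *)
have E : enorm (u t) ^+ 2 = enorm (u t - b) ^+ 2 + 2 * creal w + be.
  have := enorm_sqrD (u t - b) b; rewrite subrK => ->.
  by rewrite (_ : cdot (u t - b) b = w) // cdotDl -scaleN1r cdotZl cdot_self mulN1r.
have ut : enorm (u t) ^+ 2 < 1 by rewrite expr_lt1 ?enorm_ge0 ?u1.
have := creal_le w; rewrite ler_norml => /andP[wl _].
rewrite -/be; clear - w1 w2 E ut wl; lra.
Qed.

Section Flat.
Context {n : nat} (i0 iN : 'I_n).
Local Notation B := (unit_ball R n).
Local Notation e_ i := (delta_mx 0 i : 'rV[C]_n).

Lemma shift_coord (y : 'rV[C]_n) (t : C) i : (y + t *: e_ i) 0 i = y 0 i + t.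
Proof. by rewrite !mxE !eqxx mulr1. Qed.

Lemma shift_coord_neq (y : 'rV[C]_n) (t : C) i j : i != j -> (y + t *: e_ i) 0 j = y 0 j.
Proof. by move=> ij; rewrite !mxE eq_sym (negbTE ij) andbF mulr0 addr0. Qed.

Lemma creal_coord_continuous i (y : 'rV[C]_n) :
  {for y, continuous (fun x : 'rV[C]_n => `|creal (x 0 i)|)}.
Proof.
apply/continuous_realP => e e0; exists e => // x; apply: le_lt_trans.
apply: le_trans (ler_dist_dist _ _) _.
rewrite -crealB; apply: le_trans (creal_le _) _.
by have := cmod_coord (x - y) 0 i; rewrite !mxE.
Qed.

Lemma inverse_to_sphere (K : set 'rV[C]_n) (f g : 'rV[C]_n -> 'rV[C]_n) (p : 'rV[C]_n) (e eta : R) :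
  0 < e ->
  (forall x, rnorm (x - p) < e -> creal (x 0 iN) = 0 -> K x) ->
  (forall x, rnorm (x - p) < e -> creal (x 0 iN) != 0 ->
    [/\ B (g x), f (g x) = x & differentiable g x]) ->
  (forall y, B y -> {for y, continuous f}) -> (forall y, B y -> ~ K (f y)) ->
  0 < eta -> exists2 d : R, 0 < d &
  forall x, rnorm (x - p) <= e / 2 -> 0 < creal (x 0 iN) < d -> 1 - eta < enorm (g x).
Proof.
move=> egt0 Kflat gP fc fK eta0; apply: contrapT => none.
have H k : exists x, [/\ rnorm (x - p) <= e / 2, 0 < creal (x 0 iN) < 2^-1 ^+ k &
    enorm (g x) <= 1 - eta].
  apply: contrapT => N; apply: none; exists (2^-1 ^+ k); first by rewrite exprn_gt0.
  move=> x xp xN; rewrite ltNge; apply/negP => gx; apply: N.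
  by exists x.
have [x xP] := choice H.
have e20 : 0 < e / 2 by rewrite divr_gt0.
have e2 : e / 2 < e by rewrite ltr_pdivrMr // ltr_pMr // ltr1n.
have xe k : rnorm (x k - p) < e by have [h _ _] := xP k; apply: le_lt_trans e2.
have xN k : creal (x k 0 iN) != 0 by have [_ /andP[h _] _] := xP k; rewrite gt_eqF.
have [|l lp xl] := ultra_compact_cvg (@compact_polydisc R n p (e / 2) (ltW e20)) (u := x).
  by move=> k; have [] := xP k.
have [|q _ gq] := ultra_compact_cvg (@compact_polydisc R n 0 1 ler01) (u := g \o x).
  move=> k /=; rewrite subr0; apply: le_trans (rnorm_le_enorm _) _; apply: ltW.
  by rewrite -unit_ballE; have [] := gP _ (xe k) (xN k).
have q1 : enorm q <= 1 - eta.
  apply: (@ultra_le 'rV[C]_n (g \o x) q (@enorm R n) _ gq); first exact: enorm_continuous.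
  move=> d d0; apply: nearW => k.
  by have [_ _ h] := xP k; apply: le_trans h _; rewrite lerDl ltW.
have Bq : B q by rewrite unit_ballE (le_lt_trans q1) // ltrBlDr ltrDl.
have lq : l = f q.
  apply: norm_cvg_unique xl _.
  have -> : x = f \o (g \o x).
    by apply/funext => k /=; have [_ -> _] := gP _ (xe k) (xN k).
  by apply: continuous_cvg gq; exact: fc.
have lN : `|creal (l 0 iN)| <= 0.
  apply: (@ultra_le 'rV[C]_n x l (fun y => `|creal (y 0 iN)|) _ xl).
    exact: creal_coord_continuous.
  move=> d d0; rewrite add0r.
  apply: nat_ultra_near; have [k0 k0d] := half_pow_small d0; exists k0 => // k /= kk.
  have [_ /andP[h1 h2] _] := xP k; rewrite ger0_norm ?(ltW h1) //.
  apply: ltW (lt_trans h2 (le_lt_trans _ k0d)).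
  by rewrite ler_wiXn2l // invf_le1 ?ler1n.
apply: (fK _ Bq); rewrite -lq; apply: Kflat; first exact: le_lt_trans e2.
by apply/eqP; rewrite -normr_le0.
Qed.

(* Moving parallel to the flat piece displaces [g] by an amount tending to 0 at the
   piece, by [disc_oscillation]; extended by 0 the displacement is holomorphic off its
   zeros, so it vanishes and [g] is not injective. *)
Lemma no_one_sided_inverse (K : set 'rV[C]_n) (f g : 'rV[C]_n -> 'rV[C]_n) (p : 'rV[C]_n) (e : R) :
  0 < e -> creal (p 0 iN) = 0 ->
  (forall x, rnorm (x - p) < e -> creal (x 0 iN) = 0 -> K x) ->
  (forall x, rnorm (x - p) < e -> creal (x 0 iN) != 0 ->
    [/\ B (g x), f (g x) = x & differentiable g x]) ->
  (forall y, B y -> {for y, continuous f}) -> (forall y, B y -> ~ K (f y)) ->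
  i0 != iN -> False.
Proof.
move=> egt0 p0 Kflat gP fc fK i0N; have [c c0 e8] : exists2 c : R, 0 < c & e = 8 * c.
  by exists (e / 8); rewrite ?divr_gt0 // mulrC divfK.
(* The displacement compared along the flat piece; the factor 8 in [e] leaves room for this shift
   together with all parameters [w] used below. *)
pose z : C := ofr c; pose p' := p + z *: e_ i0.
have cz : cmod z = c by rewrite cmod_ofr ger0_norm // ltW.
have reg (t w : C) : cmod t < 2 * c -> cmod w < 4 * c ->
    rnorm (p + w *: e_ iN + t *: e_ i0 - p) < e /\
    creal ((p + w *: e_ iN + t *: e_ i0) 0 iN) = creal w.
  move=> t1 w1; split; last by rewrite shift_coord_neq // shift_coord crealD p0 add0r.
  have -> : p + w *: e_ iN + t *: e_ i0 - p =
    (p + w *: e_ iN + t *: e_ i0 - (p + w *: e_ iN)) + (p + w *: e_ iN - p).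
    by rewrite addrA subrK.
  apply: le_lt_trans (rnormD _ _) _.
  have h1 := rnorm_shift (p + w *: e_ iN) t i0; have h2 := rnorm_shift p w iN.
  apply: le_lt_trans (lerD h1 h2) _; apply: lt_le_trans (ltrD t1 w1) _.
  by rewrite e8; clear - c0; lra.
have p'E (w : C) : p' + w *: e_ iN = p + w *: e_ iN + z *: e_ i0 by rewrite addrAC.
have zc : cmod z < 2 * c by rewrite cz; clear - c0; lra.
have z2c : cmod (0 : C) < 2 * c by rewrite cmod0 mulr_gt0.
have reg0 (w : C) : cmod w < 4 * c ->
    rnorm (p + w *: e_ iN - p) < e /\ creal ((p + w *: e_ iN) 0 iN) = creal w.
  by move=> /(reg 0 w z2c); rewrite scale0r addr0.
have reg1 (w : C) : cmod w < 4 * c ->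
    rnorm (p' + w *: e_ iN - p) < e /\ creal ((p' + w *: e_ iN) 0 iN) = creal w.
  by move=> /(reg z w zc); rewrite p'E.
have osc (w : C) : cmod w < 4 * c -> 0 < creal w ->
    enorm (g (p' + w *: e_ iN) - g (p + w *: e_ iN)) ^+ 2 <=
    5 * (1 - enorm (g (p + w *: e_ iN)) ^+ 2).
  move=> wc w0; pose u (t : C) := g (p + w *: e_ iN + t *: e_ i0).
  have c20 : 0 < 2 * c by rewrite mulr_gt0.
  have ur t : cmod (t - 0) < 2 * c -> [/\ B (u t), f (u t) = p + w *: e_ iN + t *: e_ i0 &
      differentiable g (p + w *: e_ iN + t *: e_ i0)].
    by rewrite subr0 => /reg/(_ wc)[h1 h2]; apply: gP _ h1 _; rewrite h2 gt_eqF.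
  have u0 : u 0 = g (p + w *: e_ iN) by rewrite /u scale0r addr0.
  rewrite p'E -u0; apply: (disc_oscillation (u := u) c20) => [t /ur[_ _ dg]|t /ur[+ _ _]|].
  - exact: (differentiable_comp (differentiable_line _ _ _) dg).
  - by rewrite unit_ballE.
  - by rewrite cz mulrC mulKf.
(* Coordinate [i] of the displacement of [g], as a function of the parameter [w] transversal to the
   hyperplane, continued by 0 to the other side. *)
pose h i (w : C) : C :=
  if 0 < creal w then g (p' + w *: e_ iN) 0 i - g (p + w *: e_ iN) 0 i else 0.
have h_pos i w : 0 < creal w -> h i w = g (p' + w *: e_ iN) 0 i - g (p + w *: e_ iN) 0 i.
  by rewrite /h => ->.
have h_neg i w : creal w <= 0 -> h i w = 0 by rewrite /h ltNge => ->.
have near_creal (w w' : C) : creal w - cmod (w' - w) <= creal w' /\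
    creal w' <= creal w + cmod (w' - w).
  have := creal_le (w' - w); rewrite crealB ler_norml => /andP[].
  by split; lra.
have dh i w : cmod w < 4 * c -> 0 < creal w -> differentiable (h i) w.
  move=> wc w0; apply: (@differentiable_near _ _ _
    (fun w : C => g (p' + w *: e_ iN) 0 i - g (p + w *: e_ iN) 0 i)).
    apply/near_rnormP; exists (creal w) => // w'; rewrite rnormC => w'w.
    by rewrite h_pos //; have [+ _] := near_creal w w'; clear - w'w; lra.
  apply: differentiableB.
    apply: (@differentiable_along _ _ (fun y => g y 0 i)); apply: differentiable_coordP.
    have [h1 h2] := reg1 w wc.
    by have [|_ _ dg] := gP _ h1; [rewrite h2 gt_eqF|exact: dg].
  apply: (@differentiable_along _ _ (fun y => g y 0 i)); apply: differentiable_coordP.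
  have [h1 h2] := reg0 w wc.
  by have [|_ _ dg] := gP _ h1; [rewrite h2 gt_eqF|exact: dg].
have hc i w : cmod w <= 3 * c -> {for w, continuous (h i)}.
  move=> wc; have w4 : cmod w < 4 * c by clear - wc c0; lra.
  have [w0|w0|w0] := ltgtP (creal w) 0.
  - apply: (@continuous_near R C C (cst 0)); last exact: cst_continuous.
    apply/near_rnormP; exists (- creal w) => [|w']; first by rewrite oppr_gt0.
    rewrite rnormC => w'w; rewrite h_neg //.
    by have [_ +] := near_creal w w'; clear - w'w; lra.
  - exact: differentiable_continuous (dh i w w4 w0).
  apply/continuous_rnormP => d d0.
  (* [osc] bounds the squared displacement by [5 * (1 - s ^+ 2) <= 10 * (1 - s)], with [s] the norm
     of [g] at the unshifted point. *)
  have eta0 : 0 < d ^+ 2 / 10 by rewrite divr_gt0 // exprn_gt0.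
  have [b b0 bP] := inverse_to_sphere egt0 Kflat gP fc fK eta0.
  exists (Num.min b c); first by rewrite lt_min b0.
  move=> w'; rewrite rnormC lt_min => /andP[w'b w'c]; rewrite (h_neg i w) ?w0 // subr0 rnormC.
  have [w'0|w'0] := lerP (creal w') 0; first by rewrite h_neg // cmod0.
  have w'4 : cmod w' < 4 * c.
    rewrite -(subrK w w'); apply: le_lt_trans (cmodD _ _) _; clear - w'c wc; lra.
  have sph : 1 - d ^+ 2 / 10 < enorm (g (p + w' *: e_ iN)).
    apply: bP; first by apply: le_trans (rnorm_shift _ _ _) _; rewrite e8; clear - w'4; lra.
    rewrite shift_coord crealD p0 add0r w'0 /=.
    by have [_ +] := near_creal w w'; rewrite w0; clear - w'b; lra.
  have g1 : enorm (g (p + w' *: e_ iN)) < 1.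
    have [h1 h2] := reg0 w' w'4.
    by rewrite -unit_ballE; have [|] := gP _ h1; first by rewrite h2 gt_eqF.
  have O := osc w' w'4 w'0; rewrite h_pos //.
  have -> : g (p' + w' *: e_ iN) 0 i - g (p + w' *: e_ iN) 0 i =
    (g (p' + w' *: e_ iN) - g (p + w' *: e_ iN)) 0 i by rewrite !mxE.
  apply: le_lt_trans (cmod_coord_enorm _ _) _.
  rewrite -(@ltr_pXn2r _ 2) ?nnegrE ?enorm_ge0 ?(ltW d0) //.
  apply: le_lt_trans O _; set s := enorm _ in sph g1 *.
  have : 1 - s ^+ 2 <= 2 * (1 - s).
    by rewrite -subr_ge0 (_ : _ - _ = (1 - s) ^+ 2) ?sqr_ge0 //; ring.
  by clear - sph; lra.
(* The disc of radius [c] about [- z] lies in the closed half-plane where [h i] is 0, and the one of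
   radius [2 * c] reaches [ofr (c / 2)], on the side where [g] lives. *)
pose a : C := - z.
have ac (t : C) : t - a = t + z by rewrite opprK.
have tcr (t : C) r : cmod (t - a) <= r -> cmod t <= r + c /\ creal t <= r - c.
  rewrite ac => tr; split.
    rewrite -(addrK z t); apply: le_trans (cmodD _ _) _; rewrite cmodN cz.
    by clear - tr; lra.
  have := le_trans (ler_norm _) (creal_le (t + z)); rewrite crealD creal_ofr.
  by clear - tr; lra.
have h0 i : h i (ofr (c / 2)) = 0.
  have c20 : 0 < 2 * c by rewrite mulr_gt0.
  apply: (@vanish_propagates R (h i) a (2 * c) c c20 c0).
  - by move=> t /tcr[t3 _]; apply: hc; clear - t3; lra.
  - move=> w wa hw; have [w3 _] := tcr w _ (ltW wa).
    have w0 : 0 < creal w by rewrite ltNge; apply: contra_neqN hw; exact: h_neg.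
    exists (Num.min (creal w) c); first by rewrite lt_min w0.
    move=> t /andP[_]; rewrite lt_min => /andP[tw tc]; apply: dh.
      rewrite -(subrK w t); apply: le_lt_trans (cmodD _ _) _; clear - w3 tc; lra.
    by have [+ _] := near_creal w t; clear - tw; lra.
  - by move=> t /ltW/tcr[_]; rewrite subrr; exact: h_neg.
  - rewrite ac -ofrD cmod_ofr ger0_norm; last by clear - c0; lra.
    by clear - c0; lra.
have [w [w0 w4 hw]] : exists w : C, [/\ 0 < creal w, cmod w < 4 * c & forall i, h i w = 0].
  exists (ofr (c / 2)); split; [by rewrite creal_ofr divr_gt0| |exact: h0].
  by rewrite cmod_ofr ger0_norm; clear - c0; lra.
have gE : g (p' + w *: e_ iN) = g (p + w *: e_ iN).
  by apply/rowP => i; apply/eqP; rewrite -subr_eq0 -h_pos // hw.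
have [h1 h2] := reg1 w w4; have [h3 h4] := reg0 w w4.
have [|_ f1 _] := gP _ h1; first by rewrite h2 gt_eqF.
have [|_ f2 _] := gP _ h3; first by rewrite h4 gt_eqF.
have := congr1 (fun y : 'rV[C]_n => y 0 i0) (etrans (esym f1) (etrans (congr1 f gE) f2)).
rewrite p'E shift_coord => /(canRL (addKr _)); rewrite addNr => z0.
by move: cz c0; rewrite z0 cmod0 => <-; rewrite ltxx.
Qed.

End Flat.
End OneSided.

(** * The two invariants off a flat compact set *)

Section FlatCompact.
Context {R : realType} {n : nat} (i0 iN : 'I_n).
Local Notation C := (Cplx R).
Local Notation B := (unit_ball R n).
Local Notation e_ i := (delta_mx 0 i : 'rV[C]_n).
Implicit Types (K : set 'rV[C]_n) (z w : 'rV[C]_n).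

(** The open piece is required near [w] rather than around it, because a nearest point of [K] may
    lie on the relative boundary of [K]. *)
Definition flat_compact K := [/\ compact K, K !=set0, K `<=` B &
  forall w, K w -> creal (w 0 iN) = 0 /\
    forall eta : R, 0 < eta -> exists p (e : R), [/\ rnorm (p - w) < eta,
      creal (p 0 iN) = 0, 0 < e &
      forall x, rnorm (x - p) < e -> creal (x 0 iN) = 0 -> K x]].

Lemma open_complement K : flat_compact K -> open (B `\` K).
Proof.
move=> [cK _ _ _]; rewrite setDE; apply: openI; first exact: open_unit_ball.
apply: closed_openC; exact: compact_closed (@norm_hausdorff _ _) cK.
Qed.

(** The extension across [K] keeps the bound 1, so the Schwarz lemma of the full ball applies. *)
Lemma flat_bound K f z w : i0 != iN -> flat_compact K ->
  (B `\` K) z -> (B `\` K) w -> holo (B `\` K) (unit_disk R) f -> f z = 0 ->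
  cmod (f w) <= enorm (ball_aut z w).
Proof.
move=> i0N [cK _ KB Kflat] [Bz Kz] [Bw Kw] [df f1] fz.
have [F FP] := hartogs_extension i0N cK KB (fun w Kw => (Kflat w Kw).1)
  (fun x Bx Kx => df x (conj Bx Kx)) (fun x Bx Kx => ltW (f1 x (conj Bx Kx))).
have [_ _ <- //] := FP w Bw.
apply: schwarz_ball => // [x /FP[]|x /FP[]|] //.
by have [_ _ ->] := FP z Bz.
Qed.

Lemma caratheodory_flat K z w : i0 != iN -> flat_compact K ->
  (B `\` K) z -> (B `\` K) w ->
  caratheodory (B `\` K) z w = (artanh (enorm (ball_aut z w)))%:E.
Proof.
move=> i0N fK Dz Dw; apply: caratheodory_eq; [by move=> x [] |exact: Dz|exact: Dw|].
by move=> f; exact: flat_bound.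
Qed.

(** A step along the real direction of [e_ iN] leaves the hyperplane and therefore [K]. *)
Lemma approach K w : flat_compact K -> K w ->
  exists2 x : nat -> 'rV[C]_n, forall k, (B `\` K) (x k) & x @ nat_ultra --> w.
Proof.
move=> [cK _ KB Kflat] Kw; have [w0 _] := Kflat w Kw.
have [d d0 dB] := open_rball (@open_unit_ball R n) (KB w Kw).
pose t k : R := d / 2 * 2^-1 ^+ k.
have t0 k : 0 < t k by rewrite mulr_gt0 ?divr_gt0 // exprn_gt0.
have d2 : d / 2 < d by rewrite ltr_pdivrMr // ltr_pMr // ltr1n.
have td k : t k < d.
  apply: le_lt_trans d2; rewrite ler_piMr ?divr_ge0 ?(ltW d0) //.
  by rewrite exprn_ile1 // ?invr_ge0 ?ler0n // invf_le1 // ler1n.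
have tx k : rnorm (w + ofr (t k) *: e_ iN - w) <= t k.
  by apply: le_trans (rnorm_shift _ _ _) _; rewrite cmod_ofr ger0_norm // ltW.
exists (fun k => w + ofr (t k) *: e_ iN) => [k|].
  split; first exact/dB/(le_lt_trans (tx k)).
  move=> /Kflat[+ _]; rewrite shift_coord crealD w0 add0r creal_ofr => tk.
  by have := t0 k; rewrite tk ltxx.
apply: nat_ultra_cvg; apply/cvg_rnormP => e e0.
have [k0 k0e] := half_pow_small (divr_gt0 e0 d0); exists k0 => // k /= kk.
apply: le_lt_trans (tx k) _; rewrite ltr_pdivlMr // mulrC in k0e.
apply: le_lt_trans k0e; apply: ler_pM.
- by rewrite divr_ge0 // ltW.
- by rewrite exprn_ge0 // invr_ge0.
- exact: ltW.
- by rewrite ler_wiXn2l // invf_le1 // ler1n.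
Qed.

Lemma dist_gt0 K z w : (B `\` K) z -> K w -> B w ->
  0 < enorm (ball_aut z w) < 1.
Proof.
rewrite /setD /= !unit_ballE => -[z1 Kz] Kw w1; rewrite ball_aut_lt1 // andbT enorm_gt0.
by apply: contra_notN Kz => /eqP v0; rewrite -(ball_aut0 z) -v0 ball_autK.
Qed.

(* A map beating the bound would send points tending to the nearest point of [K]
   into a compact part of its image, against the openness of injective maps. *)
Lemma squeezing_le K z w f (r : R) : i0 != iN -> flat_compact K ->
  (B `\` K) z -> K w -> holo (B `\` K) B f -> set_inj (B `\` K) f -> f z = 0 ->
  eball 0 r `<=` f @` (B `\` K) -> r <= enorm (ball_aut z w).
Proof.
move=> i0N fK Dz Kw hf inj fz sub; rewrite leNgt; apply/negP => mr.
have [cK _ KB Kflat] := fK; have [Bz Kz] := Dz; have [df fB] := hf.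
have [x Dx xw] := approach fK Kw.
have [|y _ fy] := ultra_compact_cvg (@compact_polydisc R n 0 1 ler01) (u := f \o x).
  move=> k /=; rewrite subr0; apply: le_trans (rnorm_le_enorm _) _; apply: ltW.
  by rewrite -unit_ballE; exact: fB.
have ym : enorm y <= enorm (ball_aut z w).
  apply: (@ultra_le R 'rV[C]_n (f \o x) y (@enorm R n) _ fy); first exact: enorm_continuous.
  move=> e e0; have [d d0 dP] := (continuous_realP _ _).1 (enorm_aut_continuous Bz (KB w Kw)) e e0.
  move/cvg_rnormP: xw => /(_ d d0); apply: filterS => k /dP /=; rewrite ltr_norml => /andP[_].
  have : enorm (f (x k)) <= enorm (ball_aut z (x k)).
    by apply: holo_vector_bound hf fz => // g; exact: flat_bound.
  by move=> h; rewrite ltrBlDl => /ltW; exact: le_trans.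
(* The limit [y] lies in the ball covered by the image, so it has a preimage [w'] off [K], distinct
   from [w]. *)
have [|w' Dw' fw'] := sub y; first by rewrite /eball /= subr0 (le_lt_trans ym).
have ww' : 0 < rnorm (w - w').
  rewrite rnorm_gt0 subr_eq0; apply/eqP => ww'; by case: Dw' => _; rewrite -ww'.
have [e e0 eD] := open_rball (open_complement fK) Dw'.
pose m := Num.min e (rnorm (w - w') / 2).
have m0 : 0 < m by rewrite lt_min e0 divr_gt0.
have mD v : rnorm (v - w') < m -> (B `\` K) v.
  by rewrite lt_min => /andP[/eD].
(* Points near [y] have preimages near [w']; by injectivity the preimage of [f (x k)] is [x k]
   itself, which tends to [w] instead. *)
have [d [L [d0 dP]]] := @osgood R n f w' m m0 (fun v vm => df v (mD v vm))
  (fun v v' vm v'm => inj v v' (mem_set (mD v vm)) (mem_set (mD v' v'm))).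
have ww2 : 0 < rnorm (w - w') / 2 by rewrite divr_gt0.
have c1 : \forall k \near nat_ultra, rnorm (f (x k) - y) < d by move/cvg_rnormP: fy => /(_ d d0).
have c2 : \forall k \near nat_ultra, rnorm (x k - w) < rnorm (w - w') / 2.
  by move/cvg_rnormP: xw => /(_ _ ww2).
have [k [fk xk]] := filter_ex (filterI c1 c2).
rewrite -fw' in fk; have [v [vm fv _]] := dP _ fk.
have vx : v = x k by apply: inj fv; apply: mem_set; [exact: mD|exact: Dx].
rewrite vx in vm; move: vm; rewrite lt_min => /andP[_ vm].
have := rnormD (w - x k) (x k - w'); rewrite addrA subrK [rnorm (w - x k)]rnormB.
by clear - vm xk; lra.
Qed.

Lemma squeezing_eq K z : i0 != iN -> flat_compact K -> (B `\` K) z ->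
  squeezing (B `\` K) z = cara_dist K z.
Proof.
move=> i0N fK Dz; have [cK K0 KB Kflat] := fK; have [Bz Kz] := Dz.
have [w [Kw -> wmin]] := cara_dist_attained cK K0 KB Bz.
have /andP[m0 m1] := dist_gt0 Dz Kw (KB w Kw).
rewrite unit_ballE in Bz.
apply: sup_max; last by move=> r [r0 [f [hf inj fz sub]]]; exact: squeezing_le hf inj fz sub.
split=> //; exists (ball_aut z); split.
- split=> x [Bx _]; rewrite unit_ballE in Bx; first exact: differentiable_ball_aut.
  by rewrite unit_ballE ball_aut_lt1.
- move=> x y /set_mem[Bx _] /set_mem[By _] xy; rewrite unit_ballE in Bx; rewrite unit_ballE in By.
  by rewrite -(ball_autK Bz Bx) xy ball_autK.
- exact: ball_aut_self.
move=> y; rewrite /eball /= subr0 => ym.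
have y1 : enorm y < 1 by exact: lt_trans m1.
exists (ball_aut z y); last exact: ball_autK.
split; first by rewrite unit_ballE ball_aut_lt1.
by move=> /wmin; rewrite ball_autK // leNgt ym.
Qed.

(** A Caratheodory ball that is too large contains all points off the hyperplane near [w], hence
    near a relatively open piece of [K]; the inverse of [f] lives there and contradicts
    [no_one_sided_inverse]. *)
Lemma fridman_le K z w f (r : R) : i0 != iN -> flat_compact K ->
  (B `\` K) z -> K w -> holo B (B `\` K) f -> set_inj B f ->
  cara_ball (B `\` K) z r `<=` f @` B -> tanh r <= enorm (ball_aut z w).
Proof.
move=> i0N fK Dz Kw [df fD] inj sub; rewrite leNgt; apply/negP => mr.
have [cK _ KB Kflat] := fK; have [Bz Kz] := Dz.
pose V := [set x | (B `\` K) x /\ enorm (ball_aut z x) < tanh r].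
have aut_lt (x : 'rV[C]_n) : B x -> enorm (ball_aut z x) < tanh r ->
    exists2 d : R, 0 < d & forall y, rnorm (y - x) < d -> B y /\ enorm (ball_aut z y) < tanh r.
  move=> Bx xr; have [d1 d10 d1B] := open_rball (@open_unit_ball R n) Bx.
  have rx : 0 < tanh r - enorm (ball_aut z x) by rewrite subr_gt0.
  have [d2 d20 d2P] := (continuous_realP _ _).1 (enorm_aut_continuous Bz Bx) _ rx.
  exists (Num.min d1 d2) => [|y]; first by rewrite lt_min d10.
  rewrite lt_min => /andP[/d1B By /d2P]; rewrite ltr_norml => /andP[_]; rewrite ltrD2r; split; [exact: By|by []].
have oV : open V.
  apply: rball_open => x [Dx xr]; have [d1 d10 d1D] := open_rball (open_complement fK) Dx.
  have [d2 d20 d2P] := aut_lt x Dx.1 xr.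
  exists (Num.min d1 d2) => [|y]; first by rewrite lt_min d10.
  by rewrite lt_min => /andP[/d1D Dy /d2P[_ yr]]; split.
have Vf x : V x -> exists y, B y /\ f y = x.
  move=> [Dx xr]; have [|y By fy] := sub x; last by exists y.
  split; first exact: Dx.
  rewrite (caratheodory_flat i0N fK Dz Dx) lte_fin artanh_lt // enorm_ge0 /= ball_aut_lt1 -?unit_ballE //.
  exact: Dx.1.
pose g x := xget 0 [set y | B y /\ f y = x].
have gP x : V x -> B (g x) /\ f (g x) = x.
  by move=> /Vf[y yP]; rewrite /g; case: xgetP => [_ _ //|/(_ y)].
have dg := inverse_holomorphic (@open_unit_ball R n) df inj oV gP.
have [eta eta0 etaP] := aut_lt w (KB w Kw) mr.
have [_ /(_ eta eta0)[p [e [pw p0 e0 pK]]]] := Kflat w Kw.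
have m0 : 0 < Num.min e (eta - rnorm (p - w)) by rewrite lt_min e0 subr_gt0.
apply: (@no_one_sided_inverse R n i0 iN K f g p _ m0 p0 _ _ _ _ i0N).
- by move=> x; rewrite lt_min => /andP[xe _]; exact: pK.
- move=> x; rewrite lt_min => /andP[_ xp] xN.
  have [|Bx xr] := etaP x.
    have -> : x - w = (x - p) + (p - w) by rewrite addrA subrK.
    by apply: le_lt_trans (rnormD _ _) _; rewrite -ltrBrDr.
  have Vx : V x by split=> //; split=> // /Kflat[x0 _]; rewrite x0 eqxx in xN.
  by have [Bg fg] := gP x Vx; split=> //; exact: dg.
- move=> y By; exact: differentiable_continuous (df y By).
- by move=> y /fD[].
Qed.

Lemma fridman_eq K z : i0 != iN -> flat_compact K -> (B `\` K) z ->
  fridman (B `\` K) z = cara_dist K z.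
Proof.
move=> i0N fK Dz; have [cK K0 KB Kflat] := fK; have [Bz Kz] := Dz.
have [w [Kw -> wmin]] := cara_dist_attained cK K0 KB Bz.
have /andP[m0 m1] := dist_gt0 Dz Kw (KB w Kw).
have z1 : enorm z < 1 by rewrite -unit_ballE.
set m := enorm (ball_aut z w) in wmin m0 m1 *.
apply: sup_max; last first.
  by move=> _ [r [f [hf inj sub]] <-]; exact: fridman_le hf inj sub.
exists (artanh m); last by rewrite artanhK_ge0 // m1 ltW.
have cm : cmod (ofr m) = m by rewrite cmod_ofr ger0_norm // ltW.
have om : ofr m != 0 by rewrite ofr_eq0 gt_eqF.
have mx (x : 'rV[C]_n) : B x -> enorm (ofr m *: x) < m.
  by rewrite unit_ballE enormZ cm => x1; rewrite gtr_pMr.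
have mx1 (x : 'rV[C]_n) : B x -> enorm (ofr m *: x) < 1.
  by move=> /mx /lt_trans; apply.
(* Its image is the set where [enorm (ball_aut z x) < m], which avoids [K] by minimality of [m] and
   is the Caratheodory ball of radius [artanh m]. *)
exists (fun x => ball_aut z (ofr m *: x)); split.
- split=> x Bx.
    apply: (@differentiable_comp _ _ _ _ (fun x : 'rV[C]_n => ofr m *: x) (ball_aut z)).
      by apply: differentiableZ; exact: ex_diff.
    exact: differentiable_ball_aut z1 (mx1 x Bx).
  split; first by rewrite unit_ballE; exact: ball_aut_lt1 z1 (mx1 x Bx).
  by move=> /wmin; rewrite (ball_autK z1 (mx1 x Bx)) leNgt mx.
- move=> x y /set_mem Bx /set_mem By xy; apply: (scalerI om).
  by rewrite -(ball_autK z1 (mx1 x Bx)) xy (ball_autK z1 (mx1 y By)).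
move=> x [Dx]; have x1 : enorm x < 1 by rewrite -unit_ballE; exact: Dx.1.
rewrite (caratheodory_flat i0N fK Dz Dx) lte_fin artanh_lt ?enorm_ge0 /= ?ball_aut_lt1 // artanhK_ge0 ?(ltW m0) // => xm.
exists (ofr m^-1 *: ball_aut z x).
  by rewrite unit_ballE enormZ cmod_ofr ger0_norm ?invr_ge0 ?(ltW m0) // mulrC ltr_pdivrMr // mul1r.
by rewrite scalerA -ofrM divff ?gt_eqF // scale1r ball_autK.
Qed.

End FlatCompact.

(** * The closure of the product as a flat compact set *)

Section Slice.
Context {R : realType} {n1 n2 : nat}.
Local Notation C := (Cplx R).
Implicit Types x p w : 'rV[C]_(n1.+1 + n2.+1).

Lemma rnorm_lsubmx x : rnorm (lsubmx x) <= rnorm x.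
Proof.
by apply: rnorm_le => [|i j]; [exact: rnorm_ge0|rewrite mxE; exact: cmod_coord].
Qed.

Lemma rnorm_rsubmx x : rnorm (rsubmx x) <= rnorm x.
Proof.
by apply: rnorm_le => [|i j]; [exact: rnorm_ge0|rewrite mxE; exact: cmod_coord].
Qed.

(** Points of the product approximate those of [K]; around them openness of [D1] and of the ball in
    the second factor leaves the hyperplane equation as the only constraint. *)
Lemma closure_slice_flat (D1 : set 'rV[C]_n1.+1) (K : set 'rV[C]_(n1.+1 + n2.+1)) :
  domain D1 -> K = closure (prod_set D1 (slice R n2)) -> compact K ->
  K `<=` unit_ball R _ -> flat_compact (rshift n1.+1 ord_max) K.
Proof.
move=> [oD1 _ [a D1a]] defK cK KB.
have subK x : prod_set D1 (slice R n2) x -> K x by rewrite defK; exact: subset_closure.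
split=> //.
  exists (row_mx a 0); apply: subK; split; rewrite ?row_mxKl ?row_mxKr //.
  split; first by rewrite /= mxE.
  by rewrite /eball /= subr0 enorm0 invr_gt0.
have near w (eta : R) : K w -> 0 < eta ->
    exists2 p, prod_set D1 (slice R n2) p & rnorm (p - w) < eta.
  by rewrite defK => /(_ _ (nbhs_rball w _)) H eta0; have [p [Dp pw]] := H _ eta0; exists p.
have flat p : prod_set D1 (slice R n2) p -> creal (p 0 (rshift n1.+1 ord_max)) = 0.
  by move=> [_ [+ _]]; rewrite /= mxE.
move=> w Kw; split.
  apply: contrapT => /eqP; rewrite -normr_gt0 => w0; have [p /flat p0] := near w _ Kw w0.
  have := le_trans (creal_le _) (cmod_coord (p - w) 0 (rshift n1.+1 ord_max)).
  rewrite !mxE crealB p0 sub0r normrN => /le_lt_trans h /h.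
  by rewrite ltxx.
move=> eta eta0; have [p Dp pw] := near w eta Kw eta0; exists p.
have [D1p [p0 p2]] := Dp; rewrite /eball /= subr0 in p2.
have [d1 d10 d1P] := open_rball oD1 D1p.
have c0 : 0 < 2^-1 - enorm (rsubmx p) by rewrite subr_gt0.
have [d2 d20 d2P] := (continuous_realP _ _).1 (@enorm_continuous R _ (rsubmx p)) _ c0.
exists (Num.min d1 d2); split=> //; first exact: flat.
  by rewrite lt_min d10.
move=> x; rewrite lt_min => /andP[x1 x2] x0; apply: subK; split.
  apply: d1P; apply: le_lt_trans x1; rewrite -raddfB; exact: rnorm_lsubmx.
split; first by rewrite /= mxE.
have := d2P (rsubmx x); rewrite -raddfB => /(_ (le_lt_trans (rnorm_rsubmx _) x2)).
by rewrite ltr_norml /eball /= subr0 => /andP[_ h]; clear - h; lra.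
Qed.

End Slice.

Theorem theorem2p13 (R : realType) (n1 n2 : nat)
    (D1 : set 'rV[Cplx R]_n1.+1) (hD1 : domain D1)
    (K : set 'rV[Cplx R]_(n1.+1 + n2.+1))
    (defK : K = closure (prod_set D1 (slice R n2)))
    (Kcompact : compact K)
    (Kball : K `<=` unit_ball R (n1.+1 + n2.+1))
    (D : set 'rV[Cplx R]_(n1.+1 + n2.+1))
    (defD : D = unit_ball R (n1.+1 + n2.+1) `\` K)
    (Dconnected : connected D)
    (z : 'rV[Cplx R]_(n1.+1 + n2.+1)) (Dz : D z) :
  squeezing D z = fridman D z /\ fridman D z = cara_dist K z.
Proof.
have fK := closure_slice_flat hD1 defK Kcompact Kball.
(* The direction parallel to the hyperplane is taken from the first factor, the normal one is the
   last coordinate of the second. *)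
have i0N : lshift n2.+1 ord0 != rshift n1.+1 ord_max :> 'I_(n1.+1 + n2.+1).
  by rewrite eq_lrshift.
rewrite defD in Dz *; rewrite (squeezing_eq i0N fK Dz).
by rewrite (fridman_eq i0N fK Dz).
Qed.
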